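(* Let $\alpha<1$, $\alpha\neq0$, $\beta=\frac{\alpha}{1-\alpha}$, and let $\tau>\max\{4T\|\sigma^{-1}\|_F^2,\ 2T(4\beta^2-2\beta)\|\sigma^{-1}\|_F^2\}$. Let $\mathbb{P}_0$ be a probability measure on $\mathbb{R}^d$ for which there is $\gamma_0>0$ with $\mathbb{E}_{\mathbb{P}_0}[\exp(\gamma^2\|B\|_2^2)]<\infty$ for every $\gamma<\gamma_0$, where $$\frac{\gamma_0^2}{\|\sigma^{-1}\|_F^2}>T\max\Big\{\tfrac12\Big(\beta^2-\beta+2+\sqrt{(\beta^2-\beta+2)^2+8(\beta^2+\beta)}\Big),\ 8,\ \frac{\tau\cdot2T(4\beta^2-2\beta)}{\tau-2T(4\beta^2-2\beta)\|\sigma^{-1}\|_F^2}\Big\}.$$ Define $$\mathcal{J}(\mathbb{Q})=\int_{\mathbb{R}^d}\big(\mathbb{E}_{\mathbb{Q}}[L_T(B,z)]\big)^{\frac1{1-\alpha}}\varphi_T(z)dz,\qquad H(b):=\frac1{1-\alpha}\int_{\mathbb{R}^d}\nabla_bL_T(b,y)\,\mathbb{E}_{\mathbb{P}_0}[L_T(B,y)]^{\frac{\alpha}{1-\alpha}}\varphi_T(y)dy,$$ $\|H\|_{L^2_2(\mathbb{P}_0)}:=(\mathbb{E}_{\mathbb{P}_0}\|H(B)\|_2^2)^{1/2}$, and $\mathcal{U}_{\delta}=\{\mathbb{Q}:D_{c_\tau}(\mathbb{Q},\mathbb{P}_0)\le\delta\}$ with cost $c_\tau(x,y)=e^{\tau\|x-y\|_2^2}-1$.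 Then, if $\alpha\in(0,1)$, as $\delta\to0$ an asymptotically optimal perturbation is the deterministic pushforward by $b\mapsto b+\Delta^*_\delta(b)$ with $\Delta^*_\delta(b)=-\sqrt{\delta/\tau}\,H(b)/\|H\|_{L^2_2(\mathbb{P}_0)}+o(\sqrt\delta)$, and $$\inf_{\mathbb{Q}\in\mathcal{U}_\delta}\mathcal{J}(\mathbb{Q})=\mathcal{J}(\mathbb{P}_0)-\sqrt{\delta/\tau}\,\|H\|_{L^2_2(\mathbb{P}_0)}+o(\sqrt\delta).$$ If $\alpha<0$, as $\delta\to0$ an asymptotically optimal perturbation is the deterministic pushforward with $\Delta^*_\delta(b)=\sqrt{\delta/\tau}\,H(b)/\|H\|_{L^2_2(\mathbb{P}_0)}+o(\sqrt\delta)$, and $$\sup_{\mathbb{Q}\in\mathcal{U}_\delta}\mathcal{J}(\mathbb{Q})=\mathcal{J}(\mathbb{P}_0)+\sqrt{\delta/\tau}\,\|H\|_{L^2_2(\mathbb{P}_0)}+o(\sqrt\delta).$$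
   Context: Fix $d\ge1$, $T>0$, $r>0$ and an invertible $d\times d$ matrix $\sigma$; $\|\cdot\|_F$ is the Frobenius norm; $\mathbf1=(1,\dots,1)^\top$. $L_T(b,y)=\exp(\langle\sigma^{-1}(b-r\mathbf1),y\rangle-\tfrac12\|\sigma^{-1}(b-r\mathbf1)\|^2T)$ and $\varphi_T$ is the density of $\mathcal N(0,TI_d)$. $\mathbb{Q}$ ranges over Borel probability measures on $\mathbb{R}^d$ (laws of the drift $B$). $D_{c}(\mu,\nu)=\inf$ over couplings of $\mu,\nu$ of the expected cost. This functional arises from power utility $U(x)=x^\alpha/\alpha$. *)

(* Defs.v *)
From HB Require Import structures.
From mathcomp Require Import all_boot all_order all_algebra.
From mathcomp Require Import all_classical all_reals all_analysis.
Set Implicit Arguments. Unset Strict Implicit. Unset Printing Implicit Defensive.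
Import Order.TTheory GRing.Theory Num.Theory.
Import numFieldNormedType.Exports.
Local Open Scope classical_set_scope.
Local Open Scope ring_scope.

(** The state space R^d is modelled by [d.-tuple R], which MathComp-Analysis
    equips with the product sigma-algebra of the Borel sets of R (= Borel
    sigma-algebra of R^d).  Linear algebra is done on column vectors. *)

Definition vec {R : realType} {d : nat} (x : d.-tuple R) : 'cV[R]_d :=
  \col_i tnth x i.
Definition unvec {R : realType} {d : nat} (v : 'cV[R]_d) : d.-tuple R :=
  [tuple v i 0 | i < d].

Definition dotv {R : realType} {d : nat} (u v : 'cV[R]_d) : R :=
  \sum_(i < d) u i 0 * v i 0.
Definition sqnorm2 {R : realType} {d : nat} (v : 'cV[R]_d) : R :=
  \sum_(i < d) v i 0 ^+ 2.
Definition norm2 {R : realType} {d : nat} (v : 'cV[R]_d) : R :=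
  Num.sqrt (sqnorm2 v).
Definition sqfrob {R : realType} {d : nat} (A : 'M[R]_d) : R :=
  \sum_(i < d) \sum_(j < d) A i j ^+ 2.

Definition LT {R : realType} {d : nat} (T r : R) (sigma : 'M[R]_d)
    (b y : 'cV[R]_d) : R :=
  let m := invmx sigma *m (b - const_mx r) in
  expR (dotv m y - 2^-1 * sqnorm2 m * T).

Definition phiT {R : realType} {d : nat} (T : R) (z : d.-tuple R) : R :=
  (Num.sqrt (pi *+ 2 * T)) ^- d * expR (- sqnorm2 (vec z) / (T *+ 2)).

(* Lebesgue integral over R^d, written as the iterated one-dimensional
   Lebesgue integral (this equals the integral w.r.t. d-dimensional Lebesgue
   measure by Tonelli/Fubini for nonnegative resp. integrable integrands). *)
Fixpoint lebint {R : realType} (n : nat) : (n.-tuple R -> \bar R) -> \bar R :=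
  match n return (n.-tuple R -> \bar R) -> \bar R with
  | 0 => fun g => g [tuple]
  | n'.+1 => fun g =>
      (\int[@lebesgue_measure R]_x lebint (fun t => g (cons_tuple x t)))%E
  end.

Definition ELT {R : realType} {d : nat} (T r : R) (sigma : 'M[R]_d)
    (Q : probability (d.-tuple R) R) (y : d.-tuple R) : \bar R :=
  (\int[Q]_x (LT T r sigma (vec x) (vec y))%:E)%E.

Definition Jfun {R : realType} {d : nat} (alpha T r : R) (sigma : 'M[R]_d)
    (Q : probability (d.-tuple R) R) : \bar R :=
  lebint (fun z => (ELT T r sigma Q z `^ (1 - alpha)^-1 * (phiT T z)%:E)%E).

Definition Hfun {R : realType} {d : nat} (alpha T r : R) (sigma : 'M[R]_d)
    (P0 : probability (d.-tuple R) R) (b : 'cV[R]_d) : 'cV[R]_d :=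
  \col_i ((1 - alpha)^-1 *
    fine (lebint (fun y : d.-tuple R =>
      ('D_(delta_mx i 0) (fun v : 'cV[R]_d => LT T r sigma v (vec y)) b *
       fine (ELT T r sigma P0 y) `^ (alpha / (1 - alpha)) * phiT T y)%:E))).

Definition HnormL2 {R : realType} {d : nat} (alpha T r : R) (sigma : 'M[R]_d)
    (P0 : probability (d.-tuple R) R) : R :=
  Num.sqrt (fine (\int[P0]_x (sqnorm2 (Hfun alpha T r sigma P0 (vec x)))%:E)%E).

Definition coupling {R : realType} {d : nat} (Q P : probability (d.-tuple R) R)
    (p : probability (d.-tuple R * d.-tuple R)%type R) : Prop :=
  (forall A, measurable A -> p (A `*` setT) = Q A) /\
  (forall B, measurable B -> p (setT `*` B) = P B).

Definition Dcost {R : realType} {d : nat} (c : d.-tuple R -> d.-tuple R -> \bar R)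
    (Q P : probability (d.-tuple R) R) : \bar R :=
  ereal_inf [set (\int[p]_z c z.1 z.2)%E | p in [set p | coupling Q P p]].

Definition ctau {R : realType} {d : nat} (tau : R) (x y : d.-tuple R) : \bar R :=
  (expR (tau * sqnorm2 (vec x - vec y)) - 1)%:E.

Definition Uset {R : realType} {d : nat} (tau delta : R)
    (P0 : probability (d.-tuple R) R) : set (probability (d.-tuple R) R) :=
  [set Q | (Dcost (ctau tau) Q P0 <= delta%:E)%E].

Definition is_pushforward {R : realType} {d : nat}
    (P Q : probability (d.-tuple R) R) (g : d.-tuple R -> d.-tuple R) : Prop :=
  measurable_fun setT g /\ forall A, measurable A -> Q A = P (g @^-1` A).

(* Main.v *)
(* Put p = 1 / (1 - alpha).  The tangent inequality of t |-> t `^ p at E_P0[L]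
   bounds J(Q) from below (p > 1) or from above (p < 1) by
   J(P0) + E[psi(X') - psi(X)], where (X', X) couples Q with P0 and the gradient
   of psi is H; so only the first-order term has to be optimised.  For the
   exponential likelihood the remainder psi(b + v) - psi(b) - <H(b), v> is at most
   a(b) |v|^2 exp(c |v|^2), and Young's inequality with exponents 4 and 4/3,
   against the cost, makes its expectation O(delta^(3/4)), while Cauchy-Schwarz
   bounds |E<H, v>| by sqrt(delta / tau) |H| up to the same order.  The bound is
   attained up to o(sqrt delta) by the truncated shift
   -+ theta sqrt(delta / tau) H / |H| on {|H(b)|^2 <= delta^(-1/4)}; the truncation
   keeps the exponential cost comparable to the quadratic one, and the factor
   theta -> 1 brings the cost below delta. *)
Require Import Defs.
From HB Require Import structures.
From mathcomp Require Import all_boot all_order all_algebra.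
From mathcomp Require Import all_classical all_reals all_analysis.
From mathcomp Require Import measurable_realfun ring lra.
Set Implicit Arguments. Unset Strict Implicit. Unset Printing Implicit Defensive.
Import Order.TTheory GRing.Theory Num.Theory.
Import numFieldNormedType.Exports.
Local Open Scope classical_set_scope.
Local Open Scope ring_scope.

(** The drift enters only through m = sigma^-1 (b - r 1), in which the likelihood is exp(<m, y> - T
    |m|^2 / 2). Every estimate is therefore a product of exp(k T |m|^2), paid for by moments of P0,
    and exp(k |y|^2 / T), integrable under the Gaussian law for k < 1/2. The fractions that recur
    are one budget for y: 1/32 for E[L] and its inverse, 1/8 for E[L]^beta, 5/16 for the Taylor
    remainder of L, 3/16 for its squared increment; no sum exceeds 7/16. For the drift, orders up to
    8 are integrated directly, and an order t >= max(8, 2 beta) controls the powers of E[L]. The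
    obstacle is that a Q in the ball has no moment assumption of its own, only a coupling of small
    cost. The one-sided tangent inequality asks no more than E_Q[L] >= 0 and tolerates J(Q) = +oo;
    the two-sided second-order expansion is kept for bounded shifts, whose moments of order t are
    uniformly controlled. Rates are written in q = delta^(1/4): sqrt delta is q^2 and every error is
    K q^3. *)

Local Notation itg P f := ((P).-integrable setT (EFin \o f)).

(** * Real-valued integrals against a probability measure *)

Section ProbabilityIntegrals.
Context dX (X : measurableType dX) (R : realType) (P : probability X R).
Implicit Types f g h : X -> R.

Lemma itg_measurable f : itg P f -> measurable_fun setT f.
Proof. by move=> /measurable_int /measurable_EFinP. Qed.

Lemma itg_le f g : measurable_fun setT f -> (forall x, `|f x| <= g x) ->
  itg P g -> itg P f.
Proof.
move=> mf fg; apply: le_integrable => //; first exact/measurable_EFinP.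
by move=> x _ /=; rewrite lee_fin (le_trans (fg x))// ler_norm.
Qed.

Lemma itg_lty f : measurable_fun setT f -> (forall x, 0 <= f x) ->
  (\int[P]_x (f x)%:E < +oo)%E -> itg P f.
Proof.
move=> mf f0 fy; apply/integrableP; split; first exact/measurable_EFinP.
by under eq_integral do rewrite /= ger0_norm//.
Qed.

Lemma itg_cst (c : R) : itg P (fun=> c).
Proof. exact: finite_measure_integrable_cst. Qed.

Lemma itgD f g : itg P f -> itg P g -> itg P (fun x => f x + g x).
Proof. by move=> fi gi; exact: (integrableD measurableT fi gi). Qed.

Lemma itgZ (c : R) f : itg P f -> itg P (fun x => c * f x).
Proof. by move=> fi; exact: (integrableZl measurableT c fi). Qed.

Lemma itgN f : itg P f -> itg P (fun x => - f x).
Proof. by move=> fi; exact: (integrableN fi). Qed.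

Lemma itgB f g : itg P f -> itg P g -> itg P (fun x => f x - g x).
Proof. by move=> fi gi; apply: itgD => //; exact: itgN. Qed.

Lemma itg_sum (I : finType) (F : I -> X -> R) : (forall i, itg P (F i)) ->
  itg P (fun x => \sum_i F i x).
Proof.
move=> Fi; rewrite (_ : EFin \o _ = fun x => (\sum_i (F i x)%:E)%E).
  by apply: integrable_sum => // i _; exact: Fi.
by apply/funext => x /=; rewrite sumEFin.
Qed.

Lemma Rint_fine f : itg P f -> (\int[P]_x (f x)%:E)%E = (\int[P]_x f x)%:E.
Proof. by move=> fi; rewrite /Rintegral fineK//; exact: integrable_fin_num. Qed.

Lemma Rint_cst (c : R) : \int[P]_x c = c.
Proof.
rewrite Rintegral_cst// [X in fine X](_ : _ = 1%E) ?mulr1//.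
exact: probability_setT.
Qed.

Lemma le_Rint f g : itg P f -> itg P g -> (forall x, f x <= g x) ->
  \int[P]_x f x <= \int[P]_x g x.
Proof. by move=> fi gi fg; apply: le_Rintegral. Qed.

Lemma RintD f g : itg P f -> itg P g ->
  \int[P]_x (f x + g x) = \int[P]_x f x + \int[P]_x g x.
Proof. by move=> fi gi; rewrite RintegralD. Qed.

Lemma RintB f g : itg P f -> itg P g ->
  \int[P]_x (f x - g x) = \int[P]_x f x - \int[P]_x g x.
Proof. by move=> fi gi; rewrite RintegralB. Qed.

Lemma RintZ (c : R) f : itg P f -> \int[P]_x (c * f x) = c * \int[P]_x f x.
Proof. by move=> fi; rewrite RintegralZl. Qed.

Lemma Rint_sum (I : finType) (F : I -> X -> R) : (forall i, itg P (F i)) ->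
  \int[P]_x (\sum_i F i x) = \sum_i \int[P]_x F i x.
Proof.
move=> Fi; apply: EFin_inj; rewrite -Rint_fine; last exact: itg_sum.
under eq_integral do rewrite -sumEFin.
rewrite integral_sum//.
by rewrite -sumEFin; apply: eq_bigr => i _; rewrite Rint_fine.
Qed.

Lemma Rint_normr f : itg P f -> `|\int[P]_x f x| <= \int[P]_x `|f x|.
Proof. by move=> fi; apply: le_normr_Rintegral. Qed.

Lemma itg_norm f : itg P f -> itg P (fun x => `|f x|).
Proof. exact: integrable_norm. Qed.

Lemma Rint_norm_le f g : itg P f -> itg P g -> (forall x, `|f x| <= g x) ->
  `|\int[P]_x f x| <= \int[P]_x g x.
Proof.
move=> fi gi fg; apply: le_trans (Rint_normr fi) _.
by apply: le_Rint => //; exact: itg_norm.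
Qed.

(** Jensen for the square: integrate the tangent bound 2 c f - c^2 <= f^2 taken at the mean c. *)
Lemma sqr_Rint_le f : itg P f -> itg P (fun x => f x ^+ 2) ->
  (\int[P]_x f x) ^+ 2 <= \int[P]_x (f x ^+ 2).
Proof.
move=> fi f2i; set c := \int[P]_x f x.
have : \int[P]_x (2 * c * f x - c ^+ 2) <= \int[P]_x (f x ^+ 2).
  apply: le_Rint => //; first by apply: itgB; [exact: itgZ|exact: itg_cst].
  by move=> x; have := sqr_ge0 (f x - c); lra.
have ci : itg P (fun x => 2 * c * f x) by exact: itgZ.
rewrite RintB//; last exact: itg_cst.
by rewrite RintZ// Rint_cst -/c; lra.
Qed.

End ProbabilityIntegrals.

(** * Change of variables along a law given set by set *)

Section Law.
Context dX dY (X : measurableType dX) (Y : measurableType dY) (R : realType).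
Context (P : probability X R) (Q : probability Y R) (f : X -> Y).
Hypothesis mf : measurable_fun setT f.
Hypothesis law : forall A, measurable A -> Q A = P (f @^-1` A).

(** Stated for any [Q] that agrees with the image measure on measurable sets, so that it serves both
    the marginals of a coupling and pushforwards. *)
Lemma law_ge0_integral (g : Y -> \bar R) : measurable_fun setT g ->
  (forall y, (0 <= g y)%E) -> (\int[Q]_y g y = \int[P]_x g (f x))%E.
Proof.
move=> mg g0; pose F : {mfun X >-> Y} := mfun_Sub (mem_set mf).
rewrite (eq_measure_integral (pushforward P F)); last by move=> A mA _; exact: law.
by rewrite ge0_integral_pushforward.
Qed.

Lemma law_itg (g : Y -> R) : measurable_fun setT g ->
  itg Q g <-> itg P (fun x => g (f x)).
Proof.
move=> mg; have mg' : measurable_fun setT (EFin \o g) by exact/measurable_EFinP.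
split=> /integrableP[_ gi]; apply/integrableP; split => //.
- by apply/measurable_EFinP; exact: measurableT_comp.
- rewrite (law_ge0_integral (g := fun y => `|(EFin \o g) y|%E)) in gi => //.
  exact: measurableT_comp.
- rewrite (law_ge0_integral (g := fun y => `|(EFin \o g) y|%E))//.
  exact: measurableT_comp.
Qed.

Lemma law_Rint (g : Y -> R) : itg Q g ->
  \int[Q]_y g y = \int[P]_x g (f x).
Proof.
move=> gi; pose F : {mfun X >-> Y} := mfun_Sub (mem_set mf).
have mg := measurable_int _ gi.
have gi' := (law_itg (itg_measurable gi)).1 gi.
rewrite /Rintegral (eq_measure_integral (pushforward P F)); last first.
  by move=> A mA _; exact: law.
by congr fine; rewrite integral_pushforward.
Qed.

End Law.

(** * Fubini under a product bound *)

Section ProductBoundFubini.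
Context dX dY (X : measurableType dX) (Y : measurableType dY) (R : realType).
Context (P : probability X R) (Q : probability Y R).
Context (F : X * Y -> R) (g : X -> R) (h : Y -> R).
Hypothesis mF : measurable_fun setT F.
Hypothesis Fgh : forall x y, `|F (x, y)| <= g x * h y.
Hypothesis gi : itg P g.
Hypothesis hi : itg Q h.

(** The product bound makes every section integrable, not merely almost every one, so inner
    integrals can be rewritten pointwise and remain real-valued. *)
Lemma pfubini_section1 x : itg Q (fun y => F (x, y)).
Proof.
apply: itg_le (Fgh x) (itgZ _ hi).
exact: (measurableT_comp mF (measurable_pair1 x)).
Qed.

Lemma pfubini_section2 y : itg P (fun x => F (x, y)).
Proof.
apply: itg_le _ _ (itgZ (h y) gi).
  exact: (measurableT_comp mF (measurable_pair2 y)).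
by move=> x /=; rewrite mulrC.
Qed.

Let mFE : measurable_fun setT (EFin \o F).
Proof. exact/measurable_EFinP. Qed.

Lemma pfubini_prod_itg : (P \x Q)%E.-integrable setT (EFin \o F).
Proof.
apply/integrable12ltyP => //=.
apply: (@le_lt_trans _ _ (\int[P]_x (`|g x| * \int[Q]_y `|h y|)%:E)%E).
  apply: ge0_le_integral => //=.
  - by move=> x _; exact: integral_ge0.
  - apply: (measurable_fun_fubini_tonelli_F (fun z => `|(F z)%:E|%E)) => //.
    exact: measurableT_comp.
  - apply/measurable_EFinP/measurable_funM => //; apply: measurableT_comp => //.
    exact: itg_measurable gi.
  - move=> x _; rewrite EFinM -Rint_fine; last exact: itg_norm.
    rewrite -integralZl//; last exact: itg_norm.
    apply: ge0_le_integral => //=.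
    + apply/measurable_EFinP; apply: measurableT_comp => //.
      exact: (measurableT_comp mF (measurable_pair1 x)).
    + apply/measurable_EFinP/measurable_funM => //; apply: measurableT_comp => //.
      exact: itg_measurable hi.
    + move=> y _; rewrite -EFinM lee_fin (le_trans (Fgh x y))// -normrM.
      exact: ler_norm.
rewrite Rint_fine ?ltry//.
under eq_fun do rewrite mulrC.
by apply: itgZ; exact: itg_norm.
Qed.

Lemma pfubini_measurable : measurable_fun setT (fun x => \int[Q]_y F (x, y)).
Proof.
apply/measurable_EFinP.
rewrite (_ : _ \o _ = fubini_F Q (EFin \o F)); first exact: (measurable_fubini_F pfubini_prod_itg).
apply/funext => x; rewrite /fubini_F /= Rint_fine//.
exact: pfubini_section1.
Qed.

Lemma pfubini : \int[P]_x (\int[Q]_y F (x, y)) = \int[Q]_y (\int[P]_x F (x, y)).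
Proof.
rewrite {1 3}/Rintegral; congr fine.
transitivity (\int[P]_x \int[Q]_y (EFin \o F) (x, y))%E.
  by apply: eq_integral => x _; rewrite -Rint_fine//; exact: pfubini_section1.
rewrite (Fubini pfubini_prod_itg).
by apply: eq_integral => y _; rewrite -Rint_fine//; exact: pfubini_section2.
Qed.

Lemma pfubini_itg : itg P (fun x => \int[Q]_y F (x, y)).
Proof.
apply: itg_le pfubini_measurable _ (itgZ (\int[Q]_y h y) gi) => x.
rewrite mulrC -RintZ//; apply: Rint_norm_le => //; first exact: pfubini_section1.
exact: itgZ.
Qed.

End ProductBoundFubini.

(** * The Gaussian law on the line and on R^d *)

Section Normal.
Context {R : realType} (s : R).
Hypothesis s0 : s != 0.
Local Notation mu := (@lebesgue_measure R).

(** The Radon-Nikodym derivative of [normal_prob] equals [normal_pdf] almost everywhere, since both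
    have the same integral over every measurable set. *)
Lemma ge0_integral_normal (f : R -> \bar R) : measurable_fun setT f ->
  (forall x, (0 <= f x)%E) ->
  (\int[normal_prob 0 s]_x f x = \int[mu]_x (f x * (normal_pdf 0 s x)%:E))%E.
Proof.
move=> mf f0; have dom := normal_prob_dominates 0 s.
rewrite -(Radon_Nikodym_SigmaFinite.change_of_variables dom)//.
apply: ae_eq_integral => //.
- apply: emeasurable_funM => //.
  exact: measurable_int (Radon_Nikodym_SigmaFinite.f_integrable dom).
- apply: emeasurable_funM => //; apply/measurable_EFinP.
  exact: measurable_normal_pdf.
- apply: ae_eqe_mul2l; apply: integral_ae_eq => //=.
  + exact: Radon_Nikodym_SigmaFinite.f_integrable dom.
  + by apply/measurable_EFinP; exact: measurable_normal_pdf.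
  + by move=> A _ mA; rewrite -Radon_Nikodym_SigmaFinite.f_integral.
Qed.

Lemma integral_normal (f : R -> R) : itg (normal_prob 0 s) f ->
  (\int[normal_prob 0 s]_x (f x)%:E = \int[mu]_x (f x * normal_pdf 0 s x)%:E)%E.
Proof.
move=> fi; have mf := itg_measurable fi.
have mp := @measurable_normal_pdf R 0 s.
have p0 x : 0 <= normal_pdf 0 s x by exact: normal_pdf_ge0.
have E : (normal_prob 0 s).-integrable setT (EFin \o f) by [].
rewrite integralE [RHS]integralE; congr (_ - _)%E.
- rewrite ge0_integral_normal//; last exact: measurable_funepos (measurable_int _ E).
  apply: eq_integral => x _; rewrite !funeposE /=.
  have [h|h] := leP 0 (f x).
    by rewrite !max_l ?lee_fin ?mulr_ge0//.
  have h' := ltW h.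
  by rewrite !max_r ?mul0e ?lee_fin ?mulr_le0_ge0.
- rewrite ge0_integral_normal//; last exact: measurable_funeneg (measurable_int _ E).
  apply: eq_integral => x _; rewrite !funenegE /=.
  have [h|h] := leP 0 (f x).
    by rewrite !max_r ?mul0e ?lee_fin ?oppr_le0 ?mulr_ge0.
  have h' := ltW h.
  by rewrite !max_l ?lee_fin ?oppr_ge0 ?mulr_le0_ge0// -EFinM mulNr.
Qed.

End Normal.

(** exp(k x^2) times the N(0, T) density is a multiple of the centred Gaussian density of variance
    u^2 = 1 / (1/T - 2 k), which is positive exactly when k < 1 / (2 T). *)
Lemma itg_normal_expR {R : realType} (T k : R) : 0 < T -> k < (2 * T)^-1 ->
  itg (normal_prob 0 (Num.sqrt T)) (fun x => expR (k * x ^+ 2)).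
Proof.
move=> T0 kT; set s := Num.sqrt T.
have s0 : s != 0 by rewrite gt_eqF// sqrtr_gt0.
have me : measurable_fun setT (fun x : R => expR (k * x ^+ 2)).
  by apply: measurableT_comp => //; apply: measurable_funM => //; exact: measurable_funX.
apply: itg_lty => //.
rewrite ge0_integral_normal//; last exact/measurable_EFinP.
have c0 : 0 < T^-1 - 2 * k.
  by rewrite subr_gt0 -ltr_pdivlMl// -invfM.
pose u := Num.sqrt (T^-1 - 2 * k)^-1.
have u0 : u != 0 by rewrite gt_eqF// sqrtr_gt0 invr_gt0.
have u2 : u ^+ 2 = (T^-1 - 2 * k)^-1 by rewrite sqr_sqrtr// invr_ge0 ltW.
pose c := normal_peak s / normal_peak u.
have := @integrable_normal_pdf R 0 u.
move=> /(integrableZl measurableT c) /integrableP[_].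
congr (_ < _)%E; apply: eq_integral => x _ /=.
rewrite ger0_norm; last first.
  by rewrite !mulr_ge0 ?invr_ge0 ?normal_pdf_ge0 ?normal_peak_ge0.
rewrite !normal_pdfE//= /c mulrA divfK ?gt_eqF ?normal_peak_gt0// -EFinM [in RHS]mulrCA; congr (_ * _)%:E.
rewrite /normal_fun !subr0 u2 -expRD sqr_sqrtr ?ltW//; congr expR.
rewrite -(mulr_natr T) -(mulr_natr _^-1) invfM invrK (invfM T).
by move: (x ^+ 2) (T^-1) => a b; field.
Qed.

(* [normal_prob] lives on [measurableTypeR R], whose display differs from that of
   the canonical sigma-algebra on [R]; the two sigma-algebras are the same. *)
Lemma gauss1 {R : realType} (T : R) : 0 < T ->
  exists nrm : probability R R, [/\
    forall f : R -> \bar R, measurable_fun setT f -> (forall x, (0 <= f x)%E) ->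
      (\int[nrm]_x f x = \int[@lebesgue_measure R]_x
        (f x * (normal_pdf 0 (Num.sqrt T) x)%:E))%E,
    forall f : R -> R, itg nrm f ->
      (\int[nrm]_x (f x)%:E = \int[@lebesgue_measure R]_x
        (f x * normal_pdf 0 (Num.sqrt T) x)%:E)%E &
    forall k, k < (2 * T)^-1 -> itg nrm (fun x => expR (k * x ^+ 2))].
Proof.
move=> T0; have s0 : Num.sqrt T != 0 by rewrite gt_eqF// sqrtr_gt0.
pose idTR : measurableTypeR R -> R := idfun.
have mid : measurable_fun setT idTR by exact: measurable_id.
pose F : {mfun (measurableTypeR R) >-> R} := mfun_Sub (mem_set mid).
pose N : probability (measurableTypeR R) R := normal_prob 0 (Num.sqrt T).
pose nrm : probability R R := distribution N F.
have law A : measurable A -> nrm A = N (idTR @^-1` A) by [].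
exists nrm; split=> [f mf f0|f fi|k kT].
- by rewrite (law_ge0_integral mid law)// ge0_integral_normal.
- have fi' := (law_itg mid law (itg_measurable fi)).1 fi.
  by rewrite (Rint_fine fi) (law_Rint mid law fi) -(Rint_fine fi') integral_normal.
- apply/(law_itg mid law); last exact: itg_normal_expR.
  by apply: measurableT_comp => //; apply: measurable_funM => //; exact: measurable_funX.
Qed.

Lemma measurable_cons_tuple {R : realType} n :
  measurable_fun setT (fun z : R * n.-tuple R => cons_tuple z.1 z.2 : n.+1.-tuple R).
Proof.
apply: (eq_measurable_fun (fun z : R * n.-tuple R => [the n.+1.-tuple R of z.1 :: z.2])).
  by move=> z _; apply/val_inj.
exact: measurable_cons.
Qed.

Lemma sqnorm2_cons {R : realType} n (x : R) (t : n.-tuple R) :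
  sqnorm2 (vec (cons_tuple x t)) = x ^+ 2 + sqnorm2 (vec t).
Proof.
rewrite /sqnorm2 big_ord_recl !mxE tnth0; congr (_ + _).
by apply: eq_bigr => i _; rewrite !mxE tnthS.
Qed.

Lemma phiT_cons {R : realType} n (T x : R) (t : n.-tuple R) : 0 < T ->
  phiT T (cons_tuple x t) = normal_pdf 0 (Num.sqrt T) x * phiT T t.
Proof.
move=> T0; have s0 : Num.sqrt T != 0 by rewrite gt_eqF// sqrtr_gt0.
rewrite /phiT sqnorm2_cons normal_pdfE// /normal_peak /normal_fun subr0.
rewrite sqr_sqrtr ?ltW// exprS invfM.
rewrite (_ : - (x ^+ 2 + sqnorm2 (vec t)) / (T *+ 2) =
  - x ^+ 2 / (T *+ 2) + - sqnorm2 (vec t) / (T *+ 2)); last by rewrite opprD mulrDl.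
rewrite expRD.
rewrite (_ : T * pi *+ 2 = pi *+ 2 * T); last by rewrite mulrnAl mulrC.
by rewrite mulrACA.
Qed.

Lemma measurable_vec {R : realType} n (i : 'I_n) :
  measurable_fun setT (fun y : n.-tuple R => vec y i 0).
Proof.
by apply: (eq_measurable_fun (fun y => tnth y i)) (measurable_tnth _) => y _; rewrite mxE.
Qed.

Lemma measurable_sqnorm2_vec {R : realType} n :
  measurable_fun setT (fun y : n.-tuple R => sqnorm2 (vec y)).
Proof.
by apply: measurable_sum => i; apply: measurable_funX; exact: measurable_vec.
Qed.

(* In each coordinate the hypotheses are inherited by all sections, not only by
   almost all of them; this is why the integrand is bounded pointwise. *)
Lemma gauss_tuple {R : realType} (T : R) n : 0 < T ->
  exists gam : probability (n.-tuple R) R, [/\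
    forall g : n.-tuple R -> R, measurable_fun setT g -> (forall y, 0 <= g y) ->
      lebint (fun y => (g y * phiT T y)%:E) = (\int[gam]_y (g y)%:E)%E,
    forall k, k < (2 * T)^-1 -> itg gam (fun y => expR (k * sqnorm2 (vec y))) &
    forall (g : n.-tuple R -> R) k C, k < (2 * T)^-1 -> measurable_fun setT g ->
      (forall y, `|g y| <= C * expR (k * sqnorm2 (vec y))) ->
      lebint (fun y => (g y * phiT T y)%:E) = (\int[gam]_y (g y)%:E)%E].
Proof.
move=> T0; elim: n => [|n [gam [IHge0 IHexp IHbnd]]].
  exists (\d_[tuple]) => /=.
  have phi1 : phiT T ([tuple] : 0.-tuple R) = 1.
    by rewrite /phiT expr0 invr1 mul1r /sqnorm2 big_ord0 oppr0 mul0r expR0.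
  split => [g mg g0|k kT|g k C kT mg gC] /=.
  - by rewrite integral_dirac ?phi1 ?mulr1 ?diracT ?mul1e//; exact/measurable_EFinP.
  - apply: itg_lty => //.
      by apply: measurableT_comp => //; apply: measurable_funM => //;
        exact: measurable_sqnorm2_vec.
    rewrite integral_dirac ?diracT ?mul1e ?ltry//.
    apply/measurable_EFinP; apply: measurableT_comp => //; apply: measurable_funM => //.
    exact: measurable_sqnorm2_vec.
  - by rewrite integral_dirac ?phi1 ?mulr1 ?diracT ?mul1e//; exact/measurable_EFinP.
set s := Num.sqrt T; have s0 : s != 0 by rewrite gt_eqF// sqrtr_gt0.
pose F : {mfun (R * n.-tuple R)%type >-> n.+1.-tuple R} :=
  mfun_Sub (mem_set (@measurable_cons_tuple R n)).
(* In dimension n + 1 the law is the image under [cons_tuple] of the product of the one-dimensional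
   law with the law in dimension n. *)
have [nrm [nrm0 nrmi nrmE]] := gauss1 T0; rewrite -/s in nrm0 nrmi.
pose prod : probability (R * n.-tuple R)%type R := (nrm \x gam)%E.
pose gam' : probability (n.+1.-tuple R) R := distribution prod F.
have law A : measurable A -> gam' A = prod (F @^-1` A) by [].
have mcons x : measurable_fun setT (fun t : n.-tuple R => cons_tuple x t : n.+1.-tuple R).
  exact: (measurableT_comp (@measurable_cons_tuple R n) (measurable_pair1 x)).
have p0 x : 0 <= normal_pdf 0 s x by exact: normal_pdf_ge0.
have me k : measurable_fun setT (fun y : n.+1.-tuple R => expR (k * sqnorm2 (vec y))).
  apply: measurableT_comp => //; apply: measurable_funM => //.
  exact: measurable_sqnorm2_vec.
have ge0I (g : n.+1.-tuple R -> R) : measurable_fun setT g -> (forall y, 0 <= g y) ->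
    (\int[gam']_y (g y)%:E = \int[nrm]_x \int[gam]_t (g (cons_tuple x t))%:E)%E.
  move=> mg g0; have mgE : measurable_fun setT (EFin \o g) by exact/measurable_EFinP.
  have gE0 y : (0 <= (EFin \o g) y)%E by rewrite lee_fin.
  rewrite [LHS](law_ge0_integral (@measurable_cons_tuple R n) law mgE gE0).
  rewrite (fubini_tonelli1 (fun z => (g (cons_tuple z.1 z.2))%:E))//.
    exact: (measurableT_comp mgE (@measurable_cons_tuple R n)).
  by move=> z; rewrite lee_fin.
exists gam'; split => [g mg g0|k kT|g k C kT mg gC].
- have mgE : measurable_fun setT (EFin \o g) by exact/measurable_EFinP.
  have mI : measurable_fun setT (fun x => \int[gam]_t (g (cons_tuple x t))%:E)%E.
    apply: (measurable_fun_fubini_tonelli_F (fun z => (g (cons_tuple z.1 z.2))%:E)).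
      exact: (measurableT_comp mgE (@measurable_cons_tuple R n)).
    by move=> z; rewrite lee_fin.
  have I0 x : (0 <= \int[gam]_t (g (cons_tuple x t))%:E)%E.
    by apply: integral_ge0 => t _; rewrite lee_fin.
  rewrite ge0I// (nrm0 _ mI I0); apply: eq_integral => x _ /=.
  have mgx := measurableT_comp mgE (mcons x).
  have px : (0 <= (normal_pdf 0 s x)%:E)%E by rewrite lee_fin.
  rewrite muleC -(ge0_integralZl gam measurableT mgx _ px); last first.
    by move=> t _; rewrite lee_fin.
  have mgp : measurable_fun setT (fun t => normal_pdf 0 s x * g (cons_tuple x t)).
    by apply: measurable_funM => //; exact: (measurableT_comp mg (mcons x)).
  have gp0 t : 0 <= normal_pdf 0 s x * g (cons_tuple x t) by exact: mulr_ge0.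
  rewrite -[RHS](IHge0 _ mgp gp0).
  by congr lebint; apply/funext => t; rewrite phiT_cons// mulrCA mulrA.
- apply: itg_lty => //; rewrite ge0I//.
  under eq_integral => x _.
    under eq_integral => t _ do rewrite sqnorm2_cons mulrDr expRD EFinM.
    rewrite integralZl//; last exact: IHexp.
    rewrite Rint_fine; last exact: IHexp.
    rewrite -EFinM mulrC; over.
  by rewrite Rint_fine ?ltry//; apply: itgZ; exact: nrmE.
- have C0 : 0 <= C.
    have := le_trans (normr_ge0 (g _)) (gC [tuple of nseq n.+1 0]).
    by rewrite pmulr_lge0// expR_gt0.
  have hi := IHexp _ kT; have gi := itgZ C (nrmE _ kT).
  pose G z := g (cons_tuple z.1 z.2).
  have mG : measurable_fun setT G by exact: (measurableT_comp mg (@measurable_cons_tuple R n)).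
  (* The Gaussian bound splits over head and tail, which makes it a product bound as Fubini
     requires. *)
  have bG x t : `|G (x, t)| <= C * expR (k * x ^+ 2) * expR (k * sqnorm2 (vec t)).
    by rewrite -mulrA -expRD -mulrDr -sqnorm2_cons; exact: gC.
  have gi' : itg gam' g.
    apply/(law_itg (@measurable_cons_tuple R n) law mg).
    exact: (pfubini_prod_itg mG bG gi hi).
  rewrite Rint_fine// (law_Rint (@measurable_cons_tuple R n) law gi').
  rewrite -(Rint_fine (P := prod)); last exact: (pfubini_prod_itg mG bG gi hi).
  rewrite -(integral12_prod_meas1 (pfubini_prod_itg mG bG gi hi)).
  have FE x : fubini_F gam (EFin \o G) x = (\int[gam]_t G (x, t))%:E.
    by rewrite /fubini_F /= Rint_fine//; exact: (pfubini_section1 mG bG hi).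
  under eq_integral do rewrite FE.
  rewrite [RHS]nrmi; last exact: (pfubini_itg mG bG gi hi).
  apply: eq_integral => x _ /=.
  have bx t : `|normal_pdf 0 s x * G (x, t)| <=
      normal_pdf 0 s x * (C * expR (k * x ^+ 2)) * expR (k * sqnorm2 (vec t)).
    by rewrite normrM ger0_norm// -[leRHS]mulrA ler_wpM2l.
  have mGx : measurable_fun setT (fun t => normal_pdf 0 s x * G (x, t)).
    by apply: measurable_funM => //; exact: (measurableT_comp mg (mcons x)).
  rewrite mulrC -RintZ; last exact: (pfubini_section1 mG bG hi).
  rewrite -Rint_fine; last by apply: itgZ; exact: (pfubini_section1 mG bG hi).
  rewrite -(IHbnd _ _ _ kT mGx bx).
  by congr lebint; apply/funext => t; rewrite phiT_cons// mulrCA mulrA.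
Qed.

(** * Tangent, Lipschitz and Taylor inequalities for exponentials and powers *)

Section PowerTangent.
Context {R : realType}.
Implicit Types x y t p q b u : R.

Lemma expR_subr1_le u : expR u - 1 <= u * expR u.
Proof.
have := expR_ge1Dx (- u); rewrite expRN => h.
have e0 := expR_gt0 u.
have : (1 - u) * expR u <= 1 by rewrite -ler_pdivlMr// div1r.
by rewrite mulrBl mul1r; lra.
Qed.

Lemma expR_sub1_norm u : `|expR u - 1| <= `|u| * (1 + expR u).
Proof.
have e0 := expR_gt0 u; have h1 := expR_ge1Dx u; have h2 := expR_subr1_le u.
have [u0|u0] := leP 0 u.
  rewrite !ger0_norm//; first by nra.
  by rewrite subr_ge0; lra.
rewrite (ltr0_norm u0) ler0_norm; first by nra.
by nra.
Qed.

(** The left side is at most u (e^u - 1). The coarse factor 1 + e^u is convenient: with u a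
    log-likelihood ratio, multiplying by L(x, y) gives L(x, y) + L(x', y), and both are bounded
    alike. *)
Lemma expR_taylor2 u : `|expR u - 1 - u| <= u ^+ 2 * (1 + expR u).
Proof.
have h1 := expR_ge1Dx u; have h2 := expR_subr1_le u.
have h3 := expR_sub1_norm u.
rewrite ger0_norm; last by lra.
apply: (@le_trans _ _ (u * (expR u - 1))); first by lra.
apply: (le_trans (ler_norm _)).
rewrite normrM; apply: le_trans (ler_wpM2l (normr_ge0 u) h3) _.
by rewrite mulrA -expr2 real_normK ?num_real.
Qed.

Lemma le_expR k u : 0 < k -> u <= k^-1 * expR (k * u).
Proof.
move=> k0; rewrite ler_pdivlMl//.
by apply: le_trans (expR_ge1Dx _); rewrite lerDr.
Qed.

(** With u = ln t, average 1 + (1 - q) u <= e^((1 - q) u) and 1 - q u <= e^(- q u) with weights q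
    and 1 - q: the left sides add up to 1. Then multiply by e^(q u). *)
Lemma bernoulli_le t q : 0 < t -> 0 <= q <= 1 -> t `^ q <= 1 + q * (t - 1).
Proof.
move=> t0 /andP[q0 q1]; rewrite /powR gt_eqF//.
set u := ln t; have -> : t = expR u by rewrite lnK// posrE.
have A := expR_ge1Dx (u - q * u); have B := expR_ge1Dx (- (q * u)).
have e0 := expR_gt0 (q * u).
have E1 : expR (u - q * u) * expR (q * u) = expR u by rewrite -expRD subrK.
have E2 : expR (- (q * u)) * expR (q * u) = 1 by rewrite -expRD addNr expR0.
have : (q * (1 + (u - q * u)) + (1 - q) * (1 - q * u)) * expR (q * u) <=
       (q * expR (u - q * u) + (1 - q) * expR (- (q * u))) * expR (q * u).
  by rewrite ler_pM2r// lerD// ler_wpM2l// subr_ge0.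
rewrite !mulrDl -!mulrA E1 E2; lra.
Qed.

(** This is the concave case applied to t^q with exponent 1/q. *)
Lemma bernoulli_ge t q : 0 < t -> 1 <= q -> 1 + q * (t - 1) <= t `^ q.
Proof.
move=> t0 q1; have q0 : 0 < q by lra.
have qV : 0 <= q^-1 <= 1 by rewrite invr_ge0 ltW//= invf_le1.
have := bernoulli_le (powR_gt0 q t0) qV.
rewrite -powRrM mulfV ?gt_eqF// (powRr1 (ltW t0)) => h.
have {h} : q * t <= q * (1 + q^-1 * (t `^ q - 1)) by rewrite ler_pM2l.
rewrite mulrDr mulr1 (mulrA q) mulfV ?gt_eqF// mul1r => h.
lra.
Qed.

(** 1 + q ln t <= t^q, and q <= 0 reverses ln t <= t - 1. *)
Lemma bernoulli_ge_neg t q : 0 < t -> q <= 0 -> 1 + q * (t - 1) <= t `^ q.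
Proof.
move=> t0 q0; rewrite /powR gt_eqF//.
have := expR_ge1Dx (q * ln t); have := expR_ge1Dx (ln t).
by rewrite lnK ?posrE//; nra.
Qed.

Let powR_ratio x y p : 0 < x -> 0 < y -> y `^ p = x `^ p * (y / x) `^ p.
Proof.
by move=> x0 y0; rewrite -powRM ?divr_ge0 ?ltW// mulrCA mulfV ?gt_eqF// mulr1.
Qed.

Let powR_slope x y p : 0 < x ->
  p * x `^ (p - 1) * (y - x) = x `^ p * (p * (y / x - 1)).
Proof.
move=> x0; have xn0 : x != 0 by rewrite gt_eqF.
rewrite powRD; last by rewrite xn0 implybT.
by rewrite powR_inv1 ?ltW//; field.
Qed.

(** By homogeneity the tangent at x reduces to Bernoulli's inequality for y / x. *)
Lemma powR_tangent_ge x y p : 0 < x -> 0 < y -> 1 <= p \/ p <= 0 ->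
  x `^ p + p * x `^ (p - 1) * (y - x) <= y `^ p.
Proof.
move=> x0 y0 p1; rewrite powR_slope// (powR_ratio p x0 y0).
rewrite -[X in X + _]mulr1 -mulrDr ler_wpM2l ?powR_ge0//.
by case: p1 => p1; [apply: bernoulli_ge|apply: bernoulli_ge_neg]; rewrite ?divr_gt0.
Qed.

Lemma powR_tangent_le x y p : 0 < x -> 0 < y -> 0 <= p <= 1 ->
  y `^ p <= x `^ p + p * x `^ (p - 1) * (y - x).
Proof.
move=> x0 y0 p1; rewrite powR_slope// (powR_ratio p x0 y0).
rewrite -[X in X + _]mulr1 -mulrDr ler_wpM2l ?powR_ge0//.
by apply: bernoulli_le; rewrite ?divr_gt0.
Qed.

(** The tangents at x and at y enclose the increment, in an order that depends on convexity; adding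
    the two slopes covers both cases. *)
Lemma powR_lipschitz x y b : 0 < x -> 0 < y ->
  `|y `^ b - x `^ b| <= `|b| * `|y - x| * (x `^ (b - 1) + y `^ (b - 1)).
Proof.
move=> x0 y0; set A := x `^ (b - 1); set B := y `^ (b - 1).
have A0 : 0 <= A by exact: powR_ge0.
have B0 : 0 <= B by exact: powR_ge0.
have n0 : 0 <= `|b| * `|y - x| by rewrite mulr_ge0.
have hA : `|b * A * (y - x)| = `|b| * `|y - x| * A.
  by rewrite !normrM (ger0_norm A0) mulrAC.
have hB : `|b * B * (x - y)| = `|b| * `|y - x| * B.
  by rewrite !normrM (ger0_norm B0) (distrC x) mulrAC.
move: (ler_norm (b * A * (y - x))) (ler_norm (- (b * A * (y - x)))).
move: (ler_norm (b * B * (x - y))) (ler_norm (- (b * B * (x - y)))).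
rewrite !normrN hA hB => h1 h2 h3 h4.
have [nA nB] : 0 <= `|b| * `|y - x| * A /\ 0 <= `|b| * `|y - x| * B.
  by split; exact: mulr_ge0.
have [/andP[b0 b1]|b01] := boolP (0 <= b <= 1).
  have := @powR_tangent_le x y b x0 y0; have := @powR_tangent_le y x b y0 x0.
  rewrite b0 b1 -/A -/B => /(_ isT) t1 /(_ isT) t2.
  by rewrite mulrDr ler_norml; apply/andP; split; lra.
have bb : 1 <= b \/ b <= 0.
  by move: b01; rewrite negb_and -!ltNge => /orP[/ltW|/ltW]; [right|left].
have := @powR_tangent_ge x y b x0 y0 bb; have := @powR_tangent_ge y x b y0 x0 bb.
rewrite -/A -/B => t1 t2.
by rewrite mulrDr ler_norml; apply/andP; split; lra.
Qed.

(** The remainder of the tangent at x lies between 0 and p (y^(p-1) - x^(p-1)) (y - x), the gap left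
    by the tangent at y; the Lipschitz bound for exponent p - 1 concludes. *)
Lemma powR_taylor2 x y p : 0 < x -> 0 < y -> 0 < p ->
  `|y `^ p - x `^ p - p * x `^ (p - 1) * (y - x)| <=
  p * `|p - 1| * (y - x) ^+ 2 * (x `^ (p - 1 - 1) + y `^ (p - 1 - 1)).
Proof.
move=> x0 y0 p0; have L := powR_lipschitz (p - 1) x0 y0.
set A := x `^ (p - 1) in L *; set B := y `^ (p - 1) in L *.
set C := x `^ (p - 1 - 1) + _ in L *.
have H : `|p * (B - A) * (y - x)| <= p * `|p - 1| * (y - x) ^+ 2 * C.
  rewrite !normrM (gtr0_norm p0) -(real_normK (num_real (y - x))).
  have {}L := ler_wpM2l (ltW p0) (ler_wpM2r (normr_ge0 (y - x)) L).
  by lra.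
move: (ler_norm (p * (B - A) * (y - x))) (ler_norm (- (p * (B - A) * (y - x)))).
rewrite normrN => h1 h2; apply: le_trans H.
rewrite ler_norml; have [p1|/ltW p1] := leP 1 p.
  have := powR_tangent_ge x0 y0 (or_introl p1).
  have := powR_tangent_ge y0 x0 (or_introl p1).
  by rewrite -/A -/B => t1 t2; apply/andP; split; lra.
have p01 : 0 <= p <= 1 by rewrite ltW.
have := powR_tangent_le x0 y0 p01; have := powR_tangent_le y0 x0 p01.
by rewrite -/A -/B => t1 t2; apply/andP; split; lra.
Qed.

End PowerTangent.

(** * Euclidean vectors and the Frobenius norm *)

Section Vectors.
Context {R : realType} {d : nat}.
Implicit Types u v : 'cV[R]_d.

Lemma sqnorm2_ge0 v : 0 <= sqnorm2 v.
Proof. by apply: sumr_ge0 => i _; exact: sqr_ge0. Qed.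

Lemma dotvv v : dotv v v = sqnorm2 v.
Proof. by apply: eq_bigr => i _; rewrite expr2. Qed.

Lemma dotvDl u u' v : dotv (u + u') v = dotv u v + dotv u' v.
Proof. by rewrite -big_split; apply: eq_bigr => i _; rewrite mxE mulrDl. Qed.

Lemma dotvBr u v v' : dotv u (v - v') = dotv u v - dotv u v'.
Proof.
by rewrite /dotv -sumrB; apply: eq_bigr => i _; rewrite !mxE mulrBr.
Qed.

Lemma dotvZl c u v : dotv (c *: u) v = c * dotv u v.
Proof. by rewrite /dotv mulr_sumr; apply: eq_bigr => i _; rewrite mxE mulrA. Qed.

Lemma dotvZr c u v : dotv u (c *: v) = c * dotv u v.
Proof. by rewrite /dotv mulr_sumr; apply: eq_bigr => i _; rewrite mxE; ring. Qed.

Lemma dotvC u v : dotv u v = dotv v u.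
Proof. by apply: eq_bigr => i _; rewrite mulrC. Qed.

Lemma dotvDr u v v' : dotv u (v + v') = dotv u v + dotv u v'.
Proof. by rewrite dotvC dotvDl !(dotvC u). Qed.

Lemma sqnorm2Z c v : sqnorm2 (c *: v) = c ^+ 2 * sqnorm2 v.
Proof. by rewrite -!dotvv dotvZl dotvZr mulrA. Qed.

Lemma sqnorm2D u v : sqnorm2 (u + v) = sqnorm2 u + 2 * dotv u v + sqnorm2 v.
Proof. by rewrite -!dotvv dotvDl !dotvDr (dotvC v u); ring. Qed.

Lemma dotv_amgm c u v : 0 < c -> 2 * dotv u v <= c * sqnorm2 u + c^-1 * sqnorm2 v.
Proof.
move=> c0; have := sqnorm2_ge0 (c *: u + (- 1) *: v).
rewrite sqnorm2D !sqnorm2Z dotvZl dotvZr => h.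
rewrite -(ler_pM2l c0) mulrDr [X in _ <= _ + X]mulrA mulfV ?gt_eqF//; lra.
Qed.

Lemma dotv_cauchy u v : dotv u v ^+ 2 <= sqnorm2 u * sqnorm2 v.
Proof.
have [v0|v0] := ltP 0 (sqnorm2 v).
  have := sqnorm2_ge0 (sqnorm2 v *: u + (- dotv u v) *: v).
  rewrite sqnorm2D !sqnorm2Z dotvZl dotvZr => h.
  by rewrite -(ler_pM2l v0); nra.
have {}v0 : sqnorm2 v = 0 by apply/eqP; rewrite eq_le v0 sqnorm2_ge0.
have vz i : v i 0 = 0.
  have := sqnorm2_ge0 v; move: v0 => /eqP; rewrite psumr_eq0; last first.
    by move=> j _; exact: sqr_ge0.
  by move=> /allP/(_ i); rewrite mem_index_enum sqrf_eq0 => /(_ isT)/eqP.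
rewrite v0 mulr0 /dotv big1 ?expr0n//.
by move=> i _; rewrite vz mulr0.
Qed.

Lemma sqnorm2_mulmx (A : 'M[R]_d) v : sqnorm2 (A *m v) <= sqfrob A * sqnorm2 v.
Proof.
rewrite /sqfrob mulr_suml; apply: ler_sum => i _.
have := dotv_cauchy (row i A)^T v; rewrite /dotv /sqnorm2 => h.
apply: le_trans (le_trans _ h) _.
  by rewrite mxE le_eqVlt; apply/orP; left; apply/eqP; congr (_ ^+ 2);
    apply: eq_bigr => j _; rewrite !mxE.
by rewrite le_eqVlt; apply/orP; left; apply/eqP; congr (_ * _);
  apply: eq_bigr => j _; rewrite !mxE.
Qed.

Lemma sqnorm2D_le c u v : 0 < c ->
  sqnorm2 (u + v) <= (1 + c) * sqnorm2 u + (1 + c^-1) * sqnorm2 v.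
Proof. by move=> c0; rewrite sqnorm2D; have := dotv_amgm u v c0; lra. Qed.

End Vectors.

(** * The likelihood as a function of the drift: pointwise bounds *)

(** The market price of risk of the drift x, the only way in which x enters the likelihood. *)
Definition mpr {R : realType} {d : nat} (r : R) (sigma : 'M[R]_d)
  (x : d.-tuple R) : 'cV[R]_d := invmx sigma *m (vec x - const_mx r).

(* Locked, because unification would otherwise compare exponentials by
   unfolding them down to limits of power series. *)
HB.lock Definition like {R : realType} {d : nat} (T r : R) (sigma : 'M[R]_d)
  (x y : d.-tuple R) : R := LT T r sigma (vec x) (vec y).
HB.lock Definition expm {R : realType} {d : nat} (T r : R) (sigma : 'M[R]_d) (k : R)
  (x : d.-tuple R) : R := expR (k * (T * sqnorm2 (mpr r sigma x))).
HB.lock Definition expy {R : realType} {d : nat} (T : R) (k : R)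
  (y : d.-tuple R) : R := expR (k * (sqnorm2 (vec y) / T)).
HB.lock Definition expk {R : realType} (k z : R) : R := expR (k * z).

Section Likelihood.
Context {R : realType} {d : nat} (T r : R) (sigma : 'M[R]_d).
Hypothesis T0 : 0 < T.
Local Notation V := (d.-tuple R).
Implicit Types (x y : V) (k c : R).

Local Notation mpr := (mpr r sigma).
Local Notation mpr2 x := (T * sqnorm2 (mpr x)).
Local Notation like := (like T r sigma).
Local Notation expm := (expm T r sigma).
Local Notation expy := (expy T).

Lemma mprE x : mpr x = invmx sigma *m (vec x - const_mx r). Proof. by []. Qed.
Lemma expmE k x : expm k x = expR (k * mpr2 x). Proof. by rewrite expm.unlock. Qed.
Lemma expyE k y : expy k y = expR (k * (sqnorm2 (vec y) / T)).
Proof. by rewrite expy.unlock. Qed.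
Lemma expkE k z : expk k z = expR (k * z) :> R. Proof. by rewrite expk.unlock. Qed.

Lemma mpr2_ge0 x : 0 <= mpr2 x.
Proof. by apply: mulr_ge0; [exact: ltW|exact: sqnorm2_ge0]. Qed.

Let S0 y : 0 <= sqnorm2 (vec y) / T.
Proof. by apply: divr_ge0; [exact: sqnorm2_ge0|exact: ltW]. Qed.

Lemma expmD k k' x : expm (k + k') x = expm k x * expm k' x.
Proof. by rewrite !expmE mulrDl expRD. Qed.

Lemma expyD k k' y : expy (k + k') y = expy k y * expy k' y.
Proof. by rewrite !expyE mulrDl expRD. Qed.

Lemma expm_gt0 k x : 0 < expm k x. Proof. by rewrite expmE expR_gt0. Qed.
Lemma expy_gt0 k y : 0 < expy k y. Proof. by rewrite expyE expR_gt0. Qed.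
Lemma expm_ge0 k x : 0 <= expm k x. Proof. by rewrite ltW// expm_gt0. Qed.
Lemma expy_ge0 k y : 0 <= expy k y. Proof. by rewrite ltW// expy_gt0. Qed.
Lemma expk_gt0 k z : 0 < expk k z :> R. Proof. by rewrite expkE expR_gt0. Qed.
Lemma expk_ge0 k z : 0 <= expk k z :> R. Proof. by rewrite ltW// expk_gt0. Qed.
Lemma expk_ge1 k z : 0 <= k -> 0 <= z -> 1 <= expk k z :> R.
Proof. by move=> k0 z0; rewrite expkE -expR0 ler_expR mulr_ge0. Qed.

Lemma expm_le k k' x : k <= k' -> expm k x <= expm k' x.
Proof. by move=> kk'; rewrite !expmE ler_expR ler_wpM2r// mpr2_ge0. Qed.

Lemma expy_le k k' y : k <= k' -> expy k y <= expy k' y.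
Proof. by move=> kk'; rewrite !expyE ler_expR ler_wpM2r. Qed.

Lemma expm_ge1 k x : 0 <= k -> 1 <= expm k x.
Proof. by move=> k0; rewrite expmE -expR0 ler_expR mulr_ge0// mpr2_ge0. Qed.

Lemma expy_ge1 k y : 0 <= k -> 1 <= expy k y.
Proof. by move=> k0; rewrite expyE -expR0 ler_expR mulr_ge0. Qed.

Lemma likeE x y :
  like x y = expR (dotv (mpr x) (vec y) - 2^-1 * mpr2 x).
Proof. by rewrite like.unlock /LT -mulrA (mulrC _ T). Qed.

Lemma like_gt0 x y : 0 < like x y.
Proof. by rewrite likeE expR_gt0. Qed.

(** AM-GM with weight c T on <m, y>. The parameter c trades Gaussian integrability in y against
    moments of the drift: a larger c lowers the exponent in y. *)
Lemma like_le c x y : 0 < c -> like x y <= expm (2^-1 * (c - 1)) x * expy (2^-1 * c^-1) y.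
Proof.
move=> c0; rewrite likeE expmE expyE -expRD ler_expR.
have cT : 0 < c * T by rewrite mulr_gt0.
have := dotv_amgm (mpr x) (vec y) cT; rewrite invfM.
set a := dotv _ _; set b := sqnorm2 (mpr x); set e := sqnorm2 (vec y).
by move: (c^-1) (T^-1) => ci Ti h; lra.
Qed.

(** AM-GM on <-m, y> with weight T / (2 k), chosen so that the exponent in y is exactly -k. *)
Lemma like_ge k x y : 0 < k ->
  expy (- k) y * expm (- ((4 * k)^-1 + 2^-1)) x <= like x y.
Proof.
move=> k0; rewrite likeE expmE expyE -expRD ler_expR.
have k2 : (4 * k)^-1 = 2^-1 * (2 * k)^-1.
  by rewrite -invfM mulrA; congr (_ * _)^-1; lra.
have c0 : 0 < (2 * k)^-1 by rewrite invr_gt0 mulr_gt0.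
have cK : ((2 * k)^-1)^-1 = 2 * k by rewrite invrK.
rewrite k2; move: ((2 * k)^-1) c0 cK => c c0 cK.
have := dotv_amgm ((- 1) *: mpr x) (vec y) (mulr_gt0 c0 T0).
rewrite invfM cK sqnorm2Z dotvZl.
set a := dotv _ _; set b := sqnorm2 (mpr x); set e := sqnorm2 (vec y).
by move: (T^-1) => Ti h; lra.
Qed.

(** * Increments of the likelihood between two drifts *)

Section Increment.
Variables (x' x y : V) (n : 'cV[R]_d) (nu D U P : R).
Hypothesis nE : n = mpr x' - mpr x.
Hypothesis nuE : nu = sqnorm2 n.
Hypothesis DE : D = dotv n (vec y - T *: mpr x).
Hypothesis UE : U = D - 2^-1 * (T * nu).
Hypothesis PE : P = expy 16^-1 y * expm 16^-1 x * expk (16^-1) (T * nu).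

Let nu0 : 0 <= nu. Proof. by rewrite nuE; exact: sqnorm2_ge0. Qed.
Let Tnu0 : 0 <= T * nu. Proof. by apply: mulr_ge0 => //; exact: ltW. Qed.

(** [U] is the exact log-likelihood ratio: the exponent is quadratic in the market price of risk,
    with linear part [D] (displacement against score) and quadratic part - T nu / 2. *)
Lemma like_incr : like x' y = like x y * expR U.
Proof.
have E : mpr x' = mpr x + n by rewrite nE addrC subrK.
rewrite !likeE -expRD; congr expR; rewrite UE DE nuE {}E.
move: (n) (mpr x) (vec y) => w m v.
by rewrite sqnorm2D dotvDl dotvBr dotvZr (dotvC w m); lra.
Qed.

Lemma mpr2_incr c : 0 < c -> mpr2 x' <= (1 + c) * mpr2 x + (1 + c^-1) * (T * nu).
Proof.
move=> c0; rewrite nuE; have -> : mpr x' = mpr x + n by rewrite nE addrC subrK.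
by rewrite !(mulrCA _ T) -mulrDr ler_pM2l// sqnorm2D_le.
Qed.

(** [P] absorbs all polynomial factors at the price of 1/16 in each exponent: each summand is at
    most 16 times one factor of [P], and the other two factors are at least 1. *)
Let sum_le : sqnorm2 (vec y) / T + mpr2 x + T * nu <= 48 * P.
Proof.
have k0 : 0 < 16^-1 :> R by rewrite invr_gt0.
have h1 := le_expR (sqnorm2 (vec y) / T) k0.
have h2 := le_expR (mpr2 x) k0.
have h3 := le_expR (T * nu) k0.
rewrite invrK -expyE -expmE -expkE in h1 h2 h3.
have g1 : 1 <= expy 16^-1 y by rewrite expy_ge1// ltW.
have g2 : 1 <= expm 16^-1 x by rewrite expm_ge1// ltW.
have g3 : 1 <= expk (16^-1) (T * nu) by rewrite expk_ge1// ltW.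
rewrite PE; move: (expy _ _) (expm _ _) (expk _ _) => a b c in h1 h2 h3 g1 g2 g3 *.
have ab : 1 <= a * b by nra.
have ac : 1 <= a * c by nra.
have bc : 1 <= b * c by nra.
have A : a <= a * b * c by rewrite -mulrA ler_peMr//; lra.
have B : b <= a * b * c by rewrite (mulrC a) -mulrA ler_peMr//; lra.
have C : c <= a * b * c by rewrite ler_peMl//; lra.
by lra.
Qed.

Lemma sqnorm2_score_le : sqnorm2 (vec y - T *: mpr x) <= 96 * T * P.
Proof.
have h := @sqnorm2D_le R d 1 (vec y) ((- T) *: mpr x) ltr01.
rewrite sqnorm2Z invr1 in h; rewrite -scaleNr; apply: le_trans h _.
have := sum_le; rewrite -(ler_pM2l T0) !mulrDr mulrCA mulfV ?gt_eqF//.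
have h0 : 0 <= T * (T * nu) by apply: mulr_ge0 => //; exact: ltW.
by lra.
Qed.

Let U2_le : U ^+ 2 <= 400 * (T * nu) * P.
Proof.
have h := dotv_cauchy n (vec y - T *: mpr x); rewrite -DE -nuE in h.
have h' := ler_wpM2l nu0 sqnorm2_score_le.
have s := sum_le.
have hs : 0 <= sqnorm2 (vec y) / T + mpr2 x by rewrite addr_ge0// mpr2_ge0.
have q : (T * nu) * (T * nu) <= (T * nu) * (48 * P) by rewrite ler_wpM2l//; lra.
have : U ^+ 2 <= 2 * D ^+ 2 + 2^-1 * ((T * nu) * (T * nu)).
  by rewrite UE; have := sqr_ge0 (D + 2^-1 * (T * nu)); lra.
have P0 : 0 <= (T * nu) * P.
  by rewrite mulr_ge0// PE !mulr_ge0 ?expm_ge0 ?expy_ge0 ?expk_ge0.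
by lra.
Qed.

Let P1 : 1 <= P.
Proof.
rewrite PE !mulr_ege1//; first by rewrite expy_ge1// invr_ge0.
- by rewrite expm_ge1// invr_ge0.
- by rewrite expk_ge1// invr_ge0.
Qed.

(** Here z is either x or x', so one bound serves both ends of the increment; [like_le] is used with
    c = 2. *)
Let exB z : mpr2 z <= 2 * mpr2 x + 2 * (T * nu) ->
  like z y <= expm 1 x * expk 1 (T * nu) * expy 4^-1 y.
Proof.
move=> h; have c2 : 0 < 2 :> R by [].
apply: le_trans (like_le z y c2) _; rewrite !expmE !expyE !expkE -!expRD ler_expR.
by move: (_ / T) => q; lra.
Qed.

(** With c = 8 in [like_le] the squared likelihood has drift order 7. The triangle weight 1/14
    raises it by 1/2 only, and [P] will add 1/16, so the total stays below 8; the price is the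
    factor 7 * 15 = 105 on T nu. *)
Let exB2 z : mpr2 z <= (1 + 14^-1) * mpr2 x + 15 * (T * nu) ->
  like z y ^+ 2 <= expm (15 / 2) x * expk (105) (T * nu) * expy 8^-1 y.
Proof.
move=> h; have c8 : 0 < 8 :> R by [].
apply: (@le_trans _ _ ((expm (2^-1 * (8 - 1)) z * expy (2^-1 * 8^-1) y) ^+ 2)).
  rewrite ler_pXn2r// ?nnegrE ?mulr_ge0 ?expm_ge0 ?expy_ge0//; [exact: like_le|exact/ltW/like_gt0].
rewrite expr2 !expmE !expyE !expkE -!expRD ler_expR.
by move: (_ / T) => q; lra.
Qed.

Let PB : P * (expm 1 x * expk 1 (T * nu) * expy 4^-1 y) <=
  expm (3 / 2) x * expk (5 / 4) (T * nu) * expy (5 / 16) y.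
Proof.
have := mpr2_ge0 x; have := Tnu0; rewrite PE !expmE !expyE !expkE -!expRD ler_expR.
by move: (_ / T) (T * nu) (mpr2 x) => q u v; lra.
Qed.

Let PB2 : P * (expm (15 / 2) x * expk (105) (T * nu) * expy 8^-1 y) <=
  expm 8 x * expk (106) (T * nu) * expy (3 / 16) y.
Proof.
have := mpr2_ge0 x; have := Tnu0; rewrite PE !expmE !expyE !expkE -!expRD ler_expR.
by move: (_ / T) (T * nu) (mpr2 x) => q u v; lra.
Qed.

Let mpr2x : mpr2 x <= 2 * mpr2 x + 2 * (T * nu).
Proof.
by have := mpr2_ge0 x; have := Tnu0; move: (mpr2 x) (T * nu) => u v; lra.
Qed.

Let mpr2x' : mpr2 x' <= 2 * mpr2 x + 2 * (T * nu).
Proof. by have := mpr2_incr ltr01; rewrite invr1 -natr1 -[1%:R]/1. Qed.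

Let mpr2x2 : mpr2 x <= (1 + 14^-1) * mpr2 x + 15 * (T * nu).
Proof.
by have := mpr2_ge0 x; have := Tnu0; move: (mpr2 x) (T * nu) => u v; lra.
Qed.

Let mpr2x2' : mpr2 x' <= (1 + 14^-1) * mpr2 x + 15 * (T * nu).
Proof.
have k14 : 0 < 14^-1 :> R by rewrite invr_gt0.
have := mpr2_incr k14; rewrite invrK.
by move: (mpr2 x) (mpr2 x') (T * nu) => u w v; lra.
Qed.

(** Since D = U + T nu / 2, the remainder is L (e^U - 1 - U) - T nu L / 2. The first term is at most
    U^2 (L + L'), and U^2 is O(T nu) up to [P], so both terms are of order T nu. *)
Lemma like_taylor_subproof :
  `|like x' y - like x y - like x y * D| <=
  (1000 * T) * (nu * expk (5 / 4) (T * nu) * expm (3 / 2) x) * expy (5 / 16) y.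
Proof.
have L0 := like_gt0 x y.
have E : like x' y - like x y - like x y * D =
    like x y * (expR U - 1 - U) - 2^-1 * (T * nu) * like x y.
  by rewrite like_incr UE; ring.
have h1 : `|like x y * (expR U - 1 - U)| <= U ^+ 2 * (like x y + like x' y).
  rewrite normrM (gtr0_norm L0) like_incr.
  have := ler_wpM2l (ltW L0) (expR_taylor2 U); congr (_ <= _).
  by rewrite mulrCA mulrDr mulr1.
set B := expm 1 x * expk 1 (T * nu) * expy 4^-1 y.
have b1 : like x y <= B := exB mpr2x.
have b2 : like x' y <= B := exB mpr2x'.
have B0 : 0 <= B by rewrite !mulr_ge0 ?expm_ge0 ?expy_ge0 ?expk_ge0.
have h2 : U ^+ 2 * (like x y + like x' y) <= 400 * (T * nu) * P * (B + B).
  by apply: ler_pM; rewrite ?sqr_ge0 ?addr_ge0 ?lerD// ltW// like_gt0.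
have Tn2 : 0 <= 2^-1 * (T * nu) by rewrite mulr_ge0 ?invr_ge0.
have h3 : 2^-1 * (T * nu) * like x y <= 2^-1 * (T * nu) * (P * B).
  by apply: ler_wpM2l => //; apply: le_trans b1 _; rewrite ler_peMl.
have h4 := ler_wpM2l Tnu0 PB; rewrite -/B in h4.
have h5 : 0 <= 2^-1 * (T * nu) * like x y by apply: mulr_ge0 => //; exact: ltW.
have h6 : 0 <= (T * nu) * (P * B).
  by do 2 (apply: mulr_ge0 => //); exact: le_trans ler01 P1.
rewrite E; apply: le_trans (ler_normB _ _) _; rewrite (ger0_norm h5).
apply: le_trans (lerD (le_trans h1 h2) h3) _.
rewrite [X in X + _](_ : _ = 800 * (T * nu * (P * B))); last by ring.
rewrite -[X in _ + X](mulrA 2^-1).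
rewrite [leRHS](_ : _ = 1000 * (T * nu * (expm (3 / 2) x *
  expk (5 / 4) (T * nu) * expy (5 / 16) y))); last by ring.
move: h4 h6; move: (T * nu * (P * B)) => X; move: (T * nu * (expm (3 / 2) x *
  expk (5 / 4) (T * nu) * expy (5 / 16) y)) => Y.
by lra.
Qed.

(** |L' - L| = L |e^U - 1| is at most |U| (L + L'). The square of the increment feeds the
    second-order term of the power t^p. *)
Lemma like_incr_sqr_subproof :
  (like x' y - like x y) ^+ 2 <=
  (1600 * T) * (nu * expk (106) (T * nu) * expm 8 x) * expy (3 / 16) y.
Proof.
have L0 := like_gt0 x y.
have h1 : (like x' y - like x y) ^+ 2 <= U ^+ 2 * (like x y + like x' y) ^+ 2.
  rewrite -exprMn -[leLHS]real_normK ?num_real// -[leRHS]real_normK ?num_real//.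
  rewrite ler_pXn2r ?nnegrE// like_incr.
  rewrite -[X in _ - X]mulr1 -mulrBr !normrM (gtr0_norm L0).
  rewrite [X in _ <= _ * `|X|](_ : _ = like x y * (1 + expR U)); last by ring.
  rewrite normrM (gtr0_norm L0) (@gtr0_norm _ (1 + _)); last by rewrite ltr_wpDl// expR_gt0.
  by rewrite mulrCA ler_pM2l// expR_sub1_norm.
set B := expm (15 / 2) x * expk (105) (T * nu) * expy 8^-1 y.
have q1 : like x y ^+ 2 <= B := exB2 mpr2x2.
have q2 : like x' y ^+ 2 <= B := exB2 mpr2x2'.
have h2 : (like x y + like x' y) ^+ 2 <= 4 * B.
  have := sqr_ge0 (like x y - like x' y); move: q1 q2.
  by move: (like x y) (like x' y) B => u v w; lra.
have h3 : U ^+ 2 * (like x y + like x' y) ^+ 2 <= 400 * (T * nu) * P * (4 * B).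
  by apply: ler_pM; rewrite ?sqr_ge0.
have h4 := ler_wpM2l Tnu0 PB2.
apply: le_trans h1 _; apply: le_trans h3 _.
rewrite [leLHS](_ : _ = 1600 * (T * nu * (P * B))); last by ring.
rewrite [leRHS](_ : _ = 1600 * (T * nu * (expm 8 x *
  expk (106) (T * nu) * expy (3 / 16) y))); last by ring.
by apply: ler_wpM2l; [exact: ler0n|exact: h4].
Qed.

End Increment.

Definition tnu (x' x : V) : R := T * sqnorm2 (mpr x' - mpr x).

Lemma tnuE x' x : tnu x' x = T * sqnorm2 (mpr x' - mpr x). Proof. by []. Qed.

Lemma tnu_ge0 x' x : 0 <= tnu x' x.
Proof. by apply: mulr_ge0; [exact: ltW|exact: sqnorm2_ge0]. Qed.

Lemma like_taylor x' x y :
  `|like x' y - like x y - like x y * dotv (mpr x' - mpr x) (vec y - T *: mpr x)| <=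
  1000 * (tnu x' x * expk (5 / 4) (tnu x' x) * expm (3 / 2) x) * expy (5 / 16) y.
Proof.
apply: le_trans (like_taylor_subproof erefl erefl erefl erefl erefl) _.
by rewrite le_eqVlt; apply/orP; left; apply/eqP; rewrite /tnu; ring.
Qed.

Lemma like_incr_sqr x' x y :
  (like x' y - like x y) ^+ 2 <=
  1600 * (tnu x' x * expk 106 (tnu x' x) * expm 8 x) * expy (3 / 16) y.
Proof.
apply: le_trans (like_incr_sqr_subproof erefl erefl erefl erefl erefl) _.
by rewrite le_eqVlt; apply/orP; left; apply/eqP; rewrite /tnu; ring.
Qed.

Lemma mpr2_triangle c x' x : 0 < c ->
  mpr2 x' <= (1 + c) * mpr2 x + (1 + c^-1) * tnu x' x.
Proof. by move=> c0; exact: mpr2_incr. Qed.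

Lemma score_le (n : 'cV[R]_d) x y :
  `|dotv n (vec y - T *: mpr x)| <=
  (sqnorm2 n + 96 * T) * (expy 16^-1 y * expm 16^-1 x).
Proof.
have h : sqnorm2 (vec y - T *: mpr x) <= 96 * T * (expy 16^-1 y * expm 16^-1 x).
  (* The score bound is reused with zero displacement, for which the [expk] factor of [P] equals
     1. *)
  have n0 : (0 : R) = sqnorm2 (0 : 'cV[R]_d).
    by rewrite /sqnorm2 big1// => i _; rewrite mxE expr0n.
  have := sqnorm2_score_le n0 (erefl (expy 16^-1 y * expm 16^-1 x * expk 16^-1 (T * 0))).
  by rewrite expkE !mulr0 expR0 mulr1.
have P1 : 1 <= expy 16^-1 y * expm 16^-1 x.
  by rewrite mulr_ege1// ?expy_ge1 ?expm_ge1 ?invr_ge0.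
have n0 := sqnorm2_ge0 n; have w0 := sqnorm2_ge0 (vec y - T *: mpr x).
have a1 := dotv_amgm n (vec y - T *: mpr x) ltr01.
have := dotv_amgm ((- 1) *: n) (vec y - T *: mpr x) ltr01.
rewrite sqnorm2Z dotvZl invr1 in a1 * => a2.
move: h P1 n0 w0 a1 a2; move: (_ * expm _ _) (sqnorm2 n) (sqnorm2 _) (dotv _ _).
move=> p a b c h P1 n0 w0 a1 a2.
have ap : a <= a * p by rewrite ler_peMr.
by rewrite ler_norml; apply/andP; split; lra.
Qed.

End Likelihood.

(** * Measurability of the likelihood and its bounds *)

Section Measurability.
Context {R : realType} {d : nat} (T r : R) (sigma : 'M[R]_d).
Local Notation V := (d.-tuple R).
Context dX (X : measurableType dX).
Implicit Types f g : X -> V.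
Local Notation mpr := (mpr r sigma).

Lemma measurable_vec_comp f i : measurable_fun setT f ->
  measurable_fun setT (fun x => vec (f x) i 0).
Proof. by move=> mf; exact: (measurableT_comp (measurable_vec i) mf). Qed.

Lemma measurable_mpr f i : measurable_fun setT f ->
  measurable_fun setT (fun x => mpr (f x) i 0).
Proof.
move=> mf; apply: (eq_measurable_fun (fun x =>
    \sum_j invmx sigma i j * (vec (f x) j 0 - r))).
  by move=> x _; rewrite mxE; apply: eq_bigr => j _; rewrite !mxE.
apply: measurable_sum => j; apply: measurable_funM => //; apply: measurable_funB => //.
exact: measurable_vec_comp.
Qed.

Lemma measurable_dotv (u v : X -> 'cV[R]_d) :
  (forall i, measurable_fun setT (fun x => u x i 0)) ->
  (forall i, measurable_fun setT (fun x => v x i 0)) ->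
  measurable_fun setT (fun x => dotv (u x) (v x)).
Proof. by move=> mu mv; apply: measurable_sum => i; exact: measurable_funM. Qed.

Lemma measurable_sqnorm2 (u : X -> 'cV[R]_d) :
  (forall i, measurable_fun setT (fun x => u x i 0)) ->
  measurable_fun setT (fun x => sqnorm2 (u x)).
Proof. by move=> mu; apply: measurable_sum => i; exact: measurable_funX. Qed.

Lemma measurable_expR_comp (h : X -> R) : measurable_fun setT h ->
  measurable_fun setT (fun x => expR (h x)).
Proof. by move=> mh; exact: measurableT_comp. Qed.

Lemma measurable_expm k f : measurable_fun setT f ->
  measurable_fun setT (fun x => expm T r sigma k (f x)).
Proof.
move=> mf; rewrite expm.unlock; apply: measurable_expR_comp.
do 2 (apply: measurable_funM => //); apply: measurable_sqnorm2 => i.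
exact: measurable_mpr.
Qed.

Lemma measurable_expk k (h : X -> R) : measurable_fun setT h ->
  measurable_fun setT (fun x => expk k (h x)).
Proof.
by move=> mh; rewrite expk.unlock; apply: measurable_expR_comp; exact: measurable_funM.
Qed.

Lemma measurable_tnu f g : measurable_fun setT f -> measurable_fun setT g ->
  measurable_fun setT (fun x => tnu T r sigma (f x) (g x)).
Proof.
move=> mf mg; apply: measurable_funM => //; apply: measurable_sqnorm2 => i.
apply: (eq_measurable_fun (fun x => mpr (f x) i 0 - mpr (g x) i 0)).
  by move=> x _; rewrite !mxE.
by apply: measurable_funB; exact: measurable_mpr.
Qed.

Lemma measurable_like f g : measurable_fun setT f -> measurable_fun setT g ->
  measurable_fun setT (fun x => like T r sigma (f x) (g x)).
Proof.
move=> mf mg; rewrite like.unlock /LT; apply: measurable_expR_comp.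
apply: measurable_funB.
  by apply: measurable_dotv => i; [exact: measurable_mpr|exact: measurable_vec_comp].
do 2 (apply: measurable_funM => //); apply: measurable_sqnorm2 => i.
exact: measurable_mpr.
Qed.

Lemma measurable_powR_comp (p : R) (h : X -> R) : measurable_fun setT h ->
  measurable_fun setT (fun x => h x `^ p).
Proof. by move=> mh; exact: (measurableT_comp (measurable_powR p) mh). Qed.

End Measurability.

(** * The averaged likelihood and its powers *)

Section Average.
Context {R : realType} {d : nat} (T r : R) (sigma : 'M[R]_d).
Hypothesis T0 : 0 < T.
Local Notation V := (d.-tuple R).
Local Notation like := (like T r sigma).
Local Notation expm := (expm T r sigma).
Local Notation expy := (expy T).
Local Notation mpr := (mpr r sigma).
Implicit Types (Q : probability V R) (y : V).

Definition avg Q y := \int[Q]_x like x y.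

Lemma avgE Q y : avg Q y = \int[Q]_x like x y. Proof. by []. Qed.

(** For c = 1 the terms in |m|^2 cancel, so L(., y) is bounded for fixed y and its mean is finite
    under every law of the drift. *)
Lemma like_bounded x y : `|like x y| <= expy 2^-1 y.
Proof.
rewrite gtr0_norm ?like_gt0//; apply: le_trans (like_le r sigma T0 x y ltr01) _.
by rewrite subrr mulr0 expmE mul0r expR0 mul1r invr1 mulr1.
Qed.

Lemma itg_like_comp dX (X : measurableType dX) (P : probability X R) (f : X -> V) y :
  measurable_fun setT f -> itg P (fun x => like (f x) y).
Proof.
move=> mf; apply: itg_le _ (itg_cst P (expy 2^-1 y)).
  exact: measurable_like.
by move=> x; exact: like_bounded.
Qed.

Lemma itg_like Q y : itg Q (like ^~ y).
Proof. by apply: (itg_like_comp Q (f := id)); exact: measurable_id. Qed.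

Lemma ELT_avg Q y : ELT T r sigma Q y = (avg Q y)%:E.
Proof. by rewrite -(Rint_fine (itg_like Q y)) /ELT like.unlock. Qed.

Lemma measurable_avg Q : measurable_fun setT (avg Q).
Proof.
apply/measurable_EFinP.
rewrite (_ : _ \o _ = fun y => (\int[Q]_x (like x y)%:E)%E); last first.
  by apply/funext => y /=; rewrite -Rint_fine//; exact: itg_like.
apply: (measurable_fun_fubini_tonelli_G (fun z : V * V => (like z.1 z.2)%:E)).
  by apply/measurable_EFinP; exact: measurable_like.
by move=> z; rewrite lee_fin ltW// like_gt0.
Qed.

Lemma avg_ge0 Q y : 0 <= avg Q y.
Proof. by apply: Rintegral_ge0 => x _; rewrite ltW// like_gt0. Qed.

(** The weight c = 1 + 2 t makes the drift exponent equal to t: a higher moment gives slower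
    Gaussian growth in y. *)
Lemma avg_le Q t K y : 0 <= t -> itg Q (expm t) -> \int[Q]_x expm t x <= K ->
  avg Q y <= K * expy (2^-1 * (1 + 2 * t)^-1) y.
Proof.
move=> t0 ti tK; have c0 : 0 < 1 + 2 * t by lra.
set k := 2^-1 * _; apply: le_trans (_ : \int[Q]_x (expy k y * expm t x) <= _).
  apply: le_Rint; [exact: itg_like|exact: itgZ|] => x.
  have := like_le r sigma T0 x y c0; rewrite -/k.
  have -> : 2^-1 * (1 + 2 * t - 1) = t by lra.
  by rewrite mulrC.
by rewrite RintZ// mulrC ler_wpM2r// expy_ge0.
Qed.

(** Jensen: after [like_ge], the mean of exp(- c s) with s = T |m|^2 is bounded below through the
    tangent of the exponential at the mean [I] of s, and s <= [expm t] gives I <= K. *)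
Lemma avg_ge Q t K k y : 1 <= t -> 0 < k -> itg Q (expm t) -> \int[Q]_x expm t x <= K ->
  expR (- (((4 * k)^-1 + 2^-1) * K)) * expy (- k) y <= avg Q y.
Proof.
move=> t1 k0 ti tK; set c := (4 * k)^-1 + 2^-1.
have c0 : 0 < c by rewrite addr_gt0// invr_gt0// mulr_gt0.
pose s x := T * sqnorm2 (mpr x).
have ms : measurable_fun setT s.
  apply: measurable_funM => //; apply: measurable_sqnorm2 => i.
  by apply: measurable_mpr; exact: measurable_id.
have s_le x : s x <= expm t x.
  apply: le_trans (expm_le r sigma T0 x t1); rewrite expmE mul1r.
  by apply: le_trans (expR_ge1Dx _); rewrite lerDr.
have si : itg Q s.
  by apply: itg_le ms _ ti => x; rewrite ger0_norm//; exact: mpr2_ge0.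
set I := \int[Q]_x s x.
have IK : I <= K by apply: le_trans tK; exact: le_Rint.
apply: le_trans (_ : expy (- k) y * expR (- (c * I)) <= _).
  by rewrite mulrC ler_wpM2l ?expy_ge0// ler_expR lerN2 ler_wpM2l// ltW.
have lin x : expy (- k) y * expR (- (c * I)) * (1 + c * I) -
    expy (- k) y * expR (- (c * I)) * c * s x <= like x y.
  apply: le_trans (like_ge r sigma T0 x y k0).
  rewrite -/c expmE -!mulrA -mulrBr ler_wpM2l ?expy_ge0//.
  rewrite (_ : - c * (T * sqnorm2 (mpr x)) = - (c * I) + (c * I - c * s x)); last first.
    by rewrite /s; ring.
  by rewrite expRD -mulrBr ler_wpM2l ?expR_ge0//; have := expR_ge1Dx (c * I - c * s x); lra.
set A := expy (- k) y * expR (- (c * I)) in lin *.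
have i1 : itg Q (fun=> A * (1 + c * I)) by exact: itg_cst.
have i2 : itg Q (fun x => A * c * s x) by exact: itgZ.
have := le_Rint (itgB i1 i2) (itg_like Q y) lin.
rewrite RintB// Rint_cst RintZ// -/I; apply: le_trans.
by rewrite le_eqVlt; apply/orP; left; apply/eqP; ring.
Qed.

(** The constant depends on Q only through the moment bound K. For beta >= 0 the power has exponent
    beta / (2 (1 + 2 t)), at most 1/8 because t >= 2 beta; for -1 < beta < 0 it is the power - beta
    < 1 of the inverse, so 1/32 already suffices. *)
Lemma avg_bounds (beta t K : R) : -1 < beta -> 8 <= t -> 2 * beta <= t -> 0 <= K ->
  exists2 C, 0 < C & forall Q, itg Q (expm t) -> \int[Q]_x expm t x <= K ->
    forall y, [/\ 0 < avg Q y, avg Q y <= C * expy 32^-1 y,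
      (avg Q y)^-1 <= C * expy 32^-1 y & avg Q y `^ beta <= C * expy 8^-1 y].
Proof.
move=> b1 t8 bt K0.
pose c := expR (((4 * 32^-1)^-1 + 2^-1) * K).
pose C := K + c + K `^ beta + c `^ (- beta).
have c0 : 0 < c by exact: expR_gt0.
have p1 : 0 <= K `^ beta by exact: powR_ge0.
have p2 : 0 <= c `^ (- beta) by exact: powR_ge0.
exists C; first by rewrite /C; lra.
move=> Q ti tK y.
have t0 : 0 <= t by lra.
have t1 : 1 <= t by lra.
have u := avg_le y t0 ti tK.
have k32 : 0 < 32^-1 :> R by rewrite invr_gt0.
have := avg_ge y t1 k32 ti tK; rewrite expRN -/c => l.
have a0 : 0 < avg Q y.
  by apply: lt_le_trans l; rewrite mulr_gt0 ?invr_gt0// expy_gt0.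
have gN k : expy (- k) y = (expy k y)^-1 by rewrite !expyE mulNr expRN.
have li : (avg Q y)^-1 <= c * expy 32^-1 y.
  rewrite -[leRHS]invrK lef_pV2 ?posrE ?invr_gt0 ?mulr_gt0 ?expy_gt0//.
  by rewrite invfM -gN.
have g0 k := expy_ge0 T k y.
split => //.
- apply: le_trans u _; apply: (@le_trans _ _ (K * expy 32^-1 y)).
    rewrite ler_wpM2l// expy_le//.
    rewrite -invfM lef_pV2 ?posrE ?mulr_gt0//; lra.
  by rewrite ler_wpM2r// /C; lra.
- by apply: le_trans li _; rewrite ler_wpM2r// /C; lra.
have gP k q : expy k y `^ q = expy (k * q) y.
  by rewrite /powR !expyE gt_eqF ?expR_gt0// expRK; congr expR; ring.
have [b0|b0] := leP 0 beta.
- apply: (@le_trans _ _ (K `^ beta * expy 8^-1 y)); last first.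
    by rewrite ler_wpM2r// /C; lra.
  apply: (le_trans (ge0_ler_powR b0 _ _ u)); rewrite ?nnegrE ?(ltW a0) ?mulr_ge0//.
  rewrite powRM// gP ler_wpM2l// expy_le//.
  rewrite -invfM mulrC ler_pdivrMr ?mulr_gt0//; lra.
- apply: (@le_trans _ _ (c `^ (- beta) * expy 8^-1 y)); last first.
    by rewrite ler_wpM2r// /C; lra.
  have nb0 : 0 <= - beta by lra.
  have -> : avg Q y `^ beta = (avg Q y)^-1 `^ (- beta).
    by rewrite -powR_inv1 ?(ltW a0)// -powRrM mulrNN mul1r.
  apply: (le_trans (ge0_ler_powR nb0 _ _ li)).
  + by rewrite nnegrE invr_ge0 ltW.
  + by rewrite nnegrE mulr_ge0// ltW.
  rewrite powRM ?(ltW c0)// gP ler_wpM2l// expy_le//.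
  lra.
Qed.

End Average.

(** * First variation of the weighted average of the likelihood *)

Section FirstOrder.
Context {R : realType} {d : nat} (T r : R) (sigma : 'M[R]_d).
Hypothesis T0 : 0 < T.
Local Notation V := (d.-tuple R).
Local Notation like := (like T r sigma).
Local Notation expm := (expm T r sigma).
Local Notation expy := (expy T).
Local Notation mpr := (mpr r sigma).
Local Notation tnu := (tnu T r sigma).
Local Notation avg := (avg T r sigma).
Context (gam : probability V R) (w : V -> R) (Cw : R).
Hypothesis gam_gy : forall k, k < 2^-1 -> itg gam (expy k).
Hypothesis mw : measurable_fun setT w.
Hypothesis w0 : forall y, 0 <= w y.
Hypothesis w_le : forall y, w y <= Cw * expy 8^-1 y.

Let g7 : itg gam (expy (7 / 16)).
Proof. by apply: gam_gy; lra. Qed.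

Let G7 := \int[gam]_y expy (7 / 16) y.

Let mid dX (X : measurableType dX) : measurable_fun setT (@idfun X).
Proof. exact: measurable_id. Qed.

Lemma Cw_ge0 : 0 <= Cw.
Proof.
have := le_trans (w0 (unvec 0)) (w_le (unvec 0)).
by rewrite pmulr_lge0// expy_gt0.
Qed.

Definition score_comp i x y := like x y * (vec y - T *: mpr x) i 0 * w y.
(** The gradient of psi(x) = E[w(Y) L(x, Y)], Y of law [gam], in the coordinate [mpr x] rather than
    x; transporting it by the transpose of sigma^-1 and multiplying by 1 / (1 - alpha) gives H. *)
Definition gradv x : 'cV[R]_d := \col_i \int[gam]_y score_comp i x y.

Definition gradC := Cw * (1 + 96 * T).

Lemma gradC_ge0 : 0 <= gradC.
Proof. by rewrite mulr_ge0 ?Cw_ge0// addr_ge0// mulr_ge0// ltW. Qed.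

(** The exponents in y add up to 1/4 for the likelihood, 1/16 for the score and 1/8 for the weight,
    that is 7/16 < 1/2. *)
Lemma score_comp_le i x y :
  `|score_comp i x y| <= gradC * expm 1 x * expy (7 / 16) y.
Proof.
rewrite !normrM (ger0_norm (w0 y)) (gtr0_norm (like_gt0 _ _ _ _ _)).
have -> : (vec y - T *: mpr x) i 0 = dotv (delta_mx i 0) (vec y - T *: mpr x).
  rewrite /dotv (bigD1 i)//= big1 => [|j ji].
    by rewrite [delta_mx i 0 i 0]mxE !eqxx mul1r addr0.
  by rewrite [delta_mx i 0 j 0]mxE (negbTE ji) mul0r.
have := score_le r sigma T0 (delta_mx i 0) x y.
rewrite (_ : sqnorm2 (delta_mx i 0) = 1); last first.
  rewrite /sqnorm2 (bigD1 i)//= big1 => [|j ji].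
    by rewrite mxE !eqxx expr1n addr0.
  by rewrite mxE (negbTE ji) expr0n.
set D := `|dotv _ _| => D_le.
have c2 : 0 < 2 :> R by [].
have L_le := like_le r sigma T0 x y c2.
have p1 : 0 <= like x y by rewrite ltW// like_gt0.
apply: le_trans (ler_pM _ (w0 y) (ler_pM p1 (normr_ge0 _) L_le D_le) (w_le y)) _.
  by rewrite mulr_ge0.
rewrite [leLHS](_ : _ = gradC * ((expm (2^-1 * (2 - 1)) x * expm 16^-1 x) *
   (expy (2^-1 * 2^-1) y * expy 16^-1 y * expy 8^-1 y))); last first.
  by rewrite /gradC; ring.
rewrite -expmD -!expyD -mulrA ler_wpM2l ?gradC_ge0//.
rewrite ler_pM ?expm_ge0 ?expy_ge0//.
  by apply: expm_le => //; lra.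
by apply: expy_le => //; lra.
Qed.

Lemma measurable_score_comp i :
  measurable_fun setT (fun z : V * V => score_comp i z.1 z.2).
Proof.
apply: measurable_funM; last exact: measurableT_comp.
apply: measurable_funM; first exact: measurable_like.
apply: (eq_measurable_fun (fun z => vec z.2 i 0 - T * mpr z.1 i 0)).
  by move=> z _; rewrite !mxE.
apply: measurable_funB; first exact: measurable_vec_comp.
by apply: measurable_funM => //; exact: measurable_mpr.
Qed.

Lemma itg_score_comp i x : itg gam (score_comp i x).
Proof.
exact: (pfubini_section1 (measurable_score_comp i) (score_comp_le i) g7 x).
Qed.

Lemma measurable_gradv (P : probability V R) i : itg P (expm 1) ->
  measurable_fun setT (fun x => gradv x i 0).
Proof.
move=> Pi; have := pfubini_measurable (measurable_score_comp i) (score_comp_le i)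
  (itgZ gradC Pi) g7.
by congr (measurable_fun _ _); apply/funext => x; rewrite mxE.
Qed.

Lemma gradv_le i x : `|gradv x i 0| <= gradC * G7 * expm 1 x.
Proof.
rewrite mxE mulrAC -RintZ//.
by apply: Rint_norm_le; [exact: itg_score_comp|exact: itgZ|exact: score_comp_le].
Qed.

Lemma dotv_gradvE (n : 'cV[R]_d) x :
  itg gam (fun y => like x y * dotv n (vec y - T *: mpr x) * w y) /\
  dotv n (gradv x) = \int[gam]_y (like x y * dotv n (vec y - T *: mpr x) * w y).
Proof.
have E : (fun y => like x y * dotv n (vec y - T *: mpr x) * w y) =
         (fun y => \sum_i n i 0 * score_comp i x y).
  apply/funext => y; rewrite /dotv mulr_sumr mulr_suml.
  by apply: eq_bigr => i _; rewrite /score_comp; ring.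
have I i : itg gam (fun y => n i 0 * score_comp i x y).
  by apply: itgZ; exact: itg_score_comp.
rewrite E; split; first exact: itg_sum.
rewrite Rint_sum//; apply: eq_bigr => i _.
by rewrite RintZ ?mxE//; exact: itg_score_comp.
Qed.

(** * Expansion along a pair of random drifts *)

Section Coupling.
Context dO (O : measurableType dO) (mu : probability O R) (X' X : O -> V).
Hypothesis mX' : measurable_fun setT X'.
Hypothesis mX : measurable_fun setT X.
Hypothesis iX' : itg mu (fun o => expm 2^-1 (X' o)).
Hypothesis iX : itg mu (fun o => expm 1 (X o)).
Let Bd o := tnu (X' o) (X o) * expk (5 / 4) (tnu (X' o) (X o)) * expm (3 / 2) (X o).
Hypothesis iBd : itg mu Bd.
Hypothesis mgradv : forall i, measurable_fun setT (fun x => gradv x i 0).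
Let dn o := dotv (mpr (X' o) - mpr (X o)) (gradv (X o)).

Let F (z : O * V) := w z.2 * (like (X' z.1) z.2 - like (X z.1) z.2).
Let mF : measurable_fun setT F.
Proof.
apply: measurable_funM; first exact: measurableT_comp.
by apply: measurable_funB; apply: measurable_like => //; exact: measurableT_comp.
Qed.

Let like2 x y : like x y <= expm 2^-1 x * expy 4^-1 y.
Proof.
have c2 : 0 < 2 :> R by [].
apply: le_trans (like_le r sigma T0 x y c2) _.
rewrite (_ : 2^-1 * (2 - 1) = 2^-1); last by lra.
by rewrite (_ : 2^-1 * 2^-1 = 4^-1)//; lra.
Qed.

Let F_le o y : `|F (o, y)| <= (expm 2^-1 (X' o) + expm 1 (X o)) * (Cw * expy (3 / 8) y).
Proof.
rewrite /F /= normrM (ger0_norm (w0 y)) mulrC.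
have L := like2 (X o) y; have L' := like2 (X' o) y.
have e1 : expm 2^-1 (X o) <= expm 1 (X o) by apply: expm_le => //; lra.
have g0 := expy_ge0 T 4^-1 y.
have -> : expy (3 / 8) y = expy 4^-1 y * expy 8^-1 y by rewrite -expyD; congr expy; lra.
rewrite [leRHS](_ : _ = ((expm 2^-1 (X' o) + expm 1 (X o)) * expy 4^-1 y) *
  (Cw * expy 8^-1 y)); last by ring.
rewrite ler_pM//.
rewrite mulrDl; apply: le_trans (ler_normB _ _) _.
rewrite !gtr0_norm ?like_gt0// lerD//.
by apply: le_trans L _; rewrite ler_wpM2r.
Qed.

Let gF : itg mu (fun o => expm 2^-1 (X' o) + expm 1 (X o)). Proof. exact: itgD. Qed.
Let hF : itg gam (fun y => Cw * expy (3 / 8) y).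
Proof. by apply: itgZ; apply: gam_gy; lra. Qed.

Let mdn : measurable_fun setT dn.
Proof.
apply: measurable_dotv => i; last exact: (measurableT_comp (mgradv i) mX).
apply: (eq_measurable_fun (fun o => mpr (X' o) i 0 - mpr (X o) i 0)).
  by move=> o _; rewrite !mxE.
by apply: measurable_funB; exact: measurable_mpr.
Qed.

Let I o := \int[gam]_y F (o, y).

Let I_dn o : `|I o - dn o| <= 1000 * Cw * G7 * Bd o.
Proof.
have [i1 E] := dotv_gradvE (mpr (X' o) - mpr (X o)) (X o).
rewrite /I /dn E -RintB//; last exact: (pfubini_section1 mF F_le hF).
rewrite -[leRHS]mulrA (mulrC G7) mulrA -RintZ//.
apply: Rint_norm_le.
- by apply: itgB => //; exact: (pfubini_section1 mF F_le hF).
- exact: itgZ.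
move=> y; rewrite /F /=.
rewrite (_ : _ - _ = w y * (like (X' o) y - like (X o) y - like (X o) y *
   dotv (mpr (X' o) - mpr (X o)) (vec y - T *: mpr (X o)))); last by ring.
rewrite normrM (ger0_norm (w0 y)).
apply: le_trans (ler_pM (w0 y) (normr_ge0 _) (w_le y) (like_taylor r sigma T0 _ _ _)) _.
rewrite -/(Bd o) (_ : 7 / 16 = 8^-1 + 5 / 16); last by lra.
by rewrite expyD le_eqVlt; apply/orP; left; apply/eqP; ring.
Qed.

Let iI : itg mu I. Proof. exact: (pfubini_itg mF F_le gF hF). Qed.

Let iIdn : itg mu (fun o => I o - dn o).
Proof.
apply: itg_le I_dn (itgZ _ iBd).
by apply: measurable_funB => //; exact: itg_measurable iI.
Qed.

(** Integrability comes by difference: [I] is integrable by Fubini, and [I - dn] is dominated by the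
    Taylor remainder. *)
Lemma itg_first_order : itg mu dn.
Proof.
rewrite (_ : dn = fun o => I o - (I o - dn o)); first exact: itgB.
by apply/funext => o; rewrite subKr.
Qed.

(** Exchanging the two integrals leaves the expectation of the pointwise Taylor remainder of psi.
    The pair (X', X) lives on an abstract space so as to cover both couplings (the two projections)
    and pushforwards (the map and the identity). *)
Lemma first_order :
  `|\int[gam]_y (w y * (\int[mu]_o like (X' o) y - \int[mu]_o like (X o) y)) -
    \int[mu]_o dotv (mpr (X' o) - mpr (X o)) (gradv (X o))| <=
  1000 * Cw * G7 * \int[mu]_o Bd o.
Proof.
have -> : \int[gam]_y (w y * (\int[mu]_o like (X' o) y - \int[mu]_o like (X o) y)) =
    \int[mu]_o I o.
  rewrite (pfubini mF F_le gF hF); apply: eq_Rintegral => y _.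
  rewrite /F /= RintZ; last by apply: itgB; exact: itg_like_comp.
  by rewrite RintB//; exact: itg_like_comp.
rewrite -RintB//; last exact: itg_first_order.
by rewrite -RintZ//; apply: Rint_norm_le => //; exact: itgZ.
Qed.

Lemma itg_first_order_gam :
  itg gam (fun y => w y * (\int[mu]_o like (X' o) y - \int[mu]_o like (X o) y)).
Proof.
have E y : w y * (\int[mu]_o like (X' o) y - \int[mu]_o like (X o) y) =
    \int[mu]_o F (o, y).
  rewrite /F /= RintZ; last by apply: itgB; exact: itg_like_comp.
  by rewrite RintB//; exact: itg_like_comp.
under eq_fun do rewrite E.
pose F' (z : V * O) := F (z.2, z.1).
have mF' : measurable_fun setT F'.
  exact: (measurableT_comp mF (measurable_fun_pair measurable_snd measurable_fst)).
apply: (@pfubini_itg _ _ _ _ _ gam mu F' (fun y => Cw * expy (3 / 8) y)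
  (fun o => expm 2^-1 (X' o) + expm 1 (X o)) mF') => //.
by move=> y o; rewrite mulrC; exact: F_le.
Qed.

End Coupling.

End FirstOrder.

(** * The functionals J and H under the Gaussian law *)

(** The value y = 0 is included because [avg_ge0] only gives nonnegativity for a general Q; there
    the tangent equals (1 - p) x^p. *)
Lemma powR_tangent_ge0 {R : realType} (x y p : R) : 0 < x -> 0 <= y -> 1 <= p ->
  x `^ p + p * x `^ (p - 1) * (y - x) <= y `^ p.
Proof.
move=> x0; rewrite le_eqVlt => /predU1P[<-|y0] p1; last exact: powR_tangent_ge (or_introl p1).
rewrite powR0 ?gt_eqF//; last by lra.
have := mulr_powRB1 (ltW x0) (lt_le_trans ltr01 p1); have := powR_ge0 x p.
by nra.
Qed.

Lemma powR_tangent_le0 {R : realType} (x y p : R) : 0 < x -> 0 <= y -> 0 < p <= 1 ->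
  y `^ p <= x `^ p + p * x `^ (p - 1) * (y - x).
Proof.
move=> x0; rewrite le_eqVlt => /predU1P[<-|y0] /andP[p0 p1]; last first.
  by apply: powR_tangent_le => //; rewrite p1 ltW.
rewrite powR0 ?gt_eqF//.
have := mulr_powRB1 (ltW x0) p0; have := powR_ge0 x p.
by nra.
Qed.

(** Along the line b + h u the exponent is a quadratic polynomial in h, so the directional
    derivative is that of a function of one real variable. *)
Lemma derive_LT {R : realType} {d : nat} (T r : R) (sigma : 'M[R]_d) (u b y : 'cV[R]_d) :
  'D_u (fun v => LT T r sigma v y) b =
  LT T r sigma b y * dotv (invmx sigma *m u)
    (y - T *: (invmx sigma *m (b - const_mx r))).
Proof.
set n := invmx sigma *m u; set M := invmx sigma *m _.
pose A := dotv M y - 2^-1 * sqnorm2 M * T.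
pose B := dotv n (y - T *: M).
pose C := - (2^-1 * sqnorm2 n * T).
pose g (h : R) := expR (A + B * h + C * (h * h)).
have gE h : LT T r sigma (h *: u + b) y = g h.
  rewrite /LT /g -addrA mulmxDr -scalemxAr -/n -/M; congr expR.
  rewrite /A /B /C sqnorm2D sqnorm2Z !dotvDl !dotvZl dotvBr dotvZr.
  by lra.
have -> : 'D_u (fun v => LT T r sigma v y) b = 'D_1 g 0.
  rewrite /derive; set F := fun h : R => _; set G := fun h : R => _.
  suff -> : F = G by [].
  apply/funext => h; rewrite /F /G /= gE.
  by rewrite -[X in _ - LT _ _ _ X _]add0r -(scale0r u) gE [h%:A]mulr1 addr0.
have dg : is_derive (0 : R) 1 g (expR (A + B * 0 + C * (0 * 0)) * B).
  apply: is_derive_eq.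
  by rewrite /GRing.scale/=; ring.
rewrite derive_val !mulr0 !addr0; congr (_ * _).
Qed.

Section GaussianFunctionals.
Context {R : realType} {d : nat} (T r : R) (sigma : 'M[R]_d) (alpha : R).
Hypothesis T0 : 0 < T.
Hypothesis alpha1 : alpha < 1.
Local Notation V := (d.-tuple R).
Local Notation like := (like T r sigma).
Local Notation expm := (expm T r sigma).
Local Notation expy := (expy T).
Local Notation mpr := (mpr r sigma).
Local Notation tnu := (tnu T r sigma).
Local Notation avg := (avg T r sigma).
Local Notation p := ((1 - alpha)^-1).
Local Notation beta := (alpha / (1 - alpha)).
Context (gam : probability V R).
Hypothesis gam_gy : forall k, k < 2^-1 -> itg gam (expy k).
Hypothesis gam_ge0 : forall g : V -> R, measurable_fun setT g ->
  (forall y, 0 <= g y) ->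
  lebint (fun y => (g y * phiT T y)%:E) = (\int[gam]_y (g y)%:E)%E.
Hypothesis gam_bnd : forall (g : V -> R) k C, k < 2^-1 ->
  measurable_fun setT g -> (forall y, `|g y| <= C * expy k y) ->
  lebint (fun y => (g y * phiT T y)%:E) = (\int[gam]_y (g y)%:E)%E.

Lemma onem_inv_gt0 : 0 < p. Proof. by rewrite invr_gt0 subr_gt0. Qed.

Lemma onem_invB1 : p - 1 = beta.
Proof. by field; rewrite subr_eq0 eq_sym lt_eqF. Qed.

Lemma JfunE (Q : probability V R) :
  Jfun alpha T r sigma Q = (\int[gam]_y (avg Q y `^ p)%:E)%E.
Proof.
rewrite -gam_ge0 => [||y]; last exact: powR_ge0.
  by rewrite /Jfun; congr lebint; apply/funext => y; rewrite (ELT_avg r sigma T0).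
by apply: measurable_powR_comp; exact: measurable_avg.
Qed.

Section Hfun.
Variables (P0 : probability V R) (Cw : R).
Local Notation w := (fun y => avg P0 y `^ beta).
Hypothesis w_le : forall y, w y <= Cw * expy 8^-1 y.
Local Notation gradv := (gradv T r sigma gam w).

(** The integrand is signed, so passing from the iterated Lebesgue integral to [gam] needs a
    pointwise Gaussian bound; the exponent 7/16 provides it. *)
Lemma HfunE x i : Hfun alpha T r sigma P0 (vec x) i 0 =
  p * dotv (invmx sigma *m delta_mx i 0) (gradv x).
Proof.
have mw : measurable_fun setT w by apply: measurable_powR_comp; exact: measurable_avg.
have w0 y : 0 <= w y by exact: powR_ge0.
have [i1 ->] := dotv_gradvE r sigma T0 gam_gy mw w0 w_le (invmx sigma *m delta_mx i 0) x.
have E y : 'D_(delta_mx i 0) (fun v : 'cV[R]_d => LT T r sigma v (vec y)) (vec x) *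
    fine (ELT T r sigma P0 y) `^ beta =
    like x y * dotv (invmx sigma *m delta_mx i 0) (vec y - T *: mpr x) * w y.
  by rewrite derive_LT (ELT_avg r sigma T0) like.unlock.
rewrite mxE; under [X in lebint X]eq_fun do rewrite E.
congr (_ * _); rewrite (@gam_bnd _ (7 / 16)
  (Cw * ((sqnorm2 (invmx sigma *m delta_mx i 0) + 96 * T) * expm 1 x)))//.
- by lra.
- exact: itg_measurable i1.
move=> y; rewrite normrM (ger0_norm (w0 y)) normrM (gtr0_norm (like_gt0 _ _ _ _ _)).
have c2 : 0 < 2 :> R by [].
have L_le := like_le r sigma T0 x y c2.
have p1 : 0 <= like x y by rewrite ltW// like_gt0.
have D_le := score_le r sigma T0 (invmx sigma *m delta_mx i 0) x y.
apply: le_trans (ler_pM _ (w0 y) (ler_pM p1 (normr_ge0 _) L_le D_le) (w_le y)) _.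
  by rewrite mulr_ge0.
set S := sqnorm2 _ + _.
have S0 : 0 <= S by rewrite addr_ge0 ?sqnorm2_ge0// mulr_ge0// ltW.
rewrite [leLHS](_ : _ = Cw * (S * (expm (2^-1 * (2 - 1)) x * expm 16^-1 x)) *
   (expy (2^-1 * 2^-1) y * expy 16^-1 y * expy 8^-1 y)); last by ring.
have C0 := Cw_ge0 w0 w_le.
rewrite -expmD -!expyD ler_pM ?mulr_ge0 ?expm_ge0 ?expy_ge0//.
  by do 2 (apply: ler_wpM2l => //); apply: expm_le => //; lra.
by apply: expy_le => //; lra.
Qed.

Lemma dotv_Hfun x (v : 'cV[R]_d) : dotv (Hfun alpha T r sigma P0 (vec x)) v =
  p * dotv (invmx sigma *m v) (gradv x).
Proof.
rewrite /dotv; under eq_bigr do rewrite HfunE.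
under [in RHS]eq_bigr do rewrite mxE mulr_suml.
rewrite exchange_big/= mulr_sumr; apply: eq_bigr => i _.
rewrite -mulrA; congr (_ * _); rewrite mulr_suml; apply: eq_bigr => j _.
rewrite mxE (bigD1 i)//= big1 ?addr0 => [|k ki].
  by rewrite mxE !eqxx mulr1 mulrAC.
by rewrite mxE (negbTE ki) mulr0.
Qed.

End Hfun.

Section Tangent.
Variables (P0 Q : probability V R).
Local Notation w := (fun y => avg P0 y `^ beta).
Hypothesis a0 : forall y, 0 < avg P0 y.
Hypothesis J0i : itg gam (fun y => avg P0 y `^ p).
Hypothesis Di : itg gam (fun y => w y * (avg Q y - avg P0 y)).
Local Notation lin := (\int[gam]_y (avg P0 y `^ p) +
   p * \int[gam]_y (w y * (avg Q y - avg P0 y))).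

Let Li : itg gam (fun y => avg P0 y `^ p + p * (w y * (avg Q y - avg P0 y))).
Proof. by apply: itgD => //; exact: itgZ. Qed.

Let linE : \int[gam]_y (avg P0 y `^ p + p * (w y * (avg Q y - avg P0 y))) = lin.
Proof. by rewrite RintD// ?RintZ//; exact: itgZ. Qed.

Let mJ : measurable_fun setT (fun y => avg Q y `^ p).
Proof. by apply: measurable_powR_comp; exact: measurable_avg. Qed.

(** If J(Q) = +oo the bound is trivial; otherwise the power is integrable and the tangent inequality
    can be integrated. *)
Lemma Jfun_ge : 1 <= p -> (lin%:E <= Jfun alpha T r sigma Q)%E.
Proof.
move=> p1; rewrite JfunE.
have [Ji|] := pselect (\int[gam]_y (avg Q y `^ p)%:E < +oo)%E; last first.
  by move/negP; rewrite ltey negbK => /eqP ->; rewrite leey.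
have {}Ji : itg gam (fun y => avg Q y `^ p).
  by apply: itg_lty => // y; exact: powR_ge0.
rewrite (Rint_fine Ji) lee_fin -linE; apply: le_Rint => // y.
by have := powR_tangent_ge0 (a0 y) (avg_ge0 T r sigma Q y) p1; rewrite onem_invB1 -mulrA.
Qed.

(** A nonnegative integrand below an integrable tangent: finiteness of J(Q) is a consequence and
    need not be known beforehand. *)
Lemma Jfun_le : p <= 1 -> (Jfun alpha T r sigma Q <= lin%:E)%E.
Proof.
move=> p1; rewrite JfunE -linE -(Rint_fine Li); apply: ge0_le_integral => //.
- by move=> y _; rewrite lee_fin powR_ge0.
- exact/measurable_EFinP.
- exact: measurable_int Li.
move=> y _; rewrite lee_fin.
have p01 : 0 < p <= 1 by rewrite onem_inv_gt0.
by have := powR_tangent_le0 (a0 y) (avg_ge0 T r sigma Q y) p01; rewrite onem_invB1 -mulrA.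
Qed.

End Tangent.

Section SecondOrder.
Variables (a : bool -> V -> R) (C e : R).
Hypothesis C0 : 0 < C.
Hypothesis ma : forall b, measurable_fun setT (a b).
Hypothesis aC : forall b y, [/\ 0 < a b y, a b y <= C * expy 32^-1 y,
  (a b y)^-1 <= C * expy 32^-1 y & a b y `^ beta <= C * expy 8^-1 y].
Hypothesis a_sqr : forall y, (a true y - a false y) ^+ 2 <= e * expy (3 / 16) y.

Lemma itg_powR b : itg gam (fun y => a b y `^ p).
Proof.
have i : itg gam (expy (5 / 32)) by apply: gam_gy; lra.
apply: itg_le _ (itgZ (C * C) i); first exact: measurable_powR_comp.
move=> y; rewrite ger0_norm ?powR_ge0//; have [b0 b1 b2 b3] := aC b y.
rewrite -(mulr_powRB1 (ltW b0) onem_inv_gt0) onem_invB1.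
apply: le_trans (ler_pM (ltW b0) (powR_ge0 _ _) b1 b3) _.
have CC : 0 <= C * C by rewrite mulr_ge0// ltW.
by rewrite mulrACA -expyD; apply: (ler_wpM2l CC); apply: expy_le => //; lra.
Qed.

Lemma powR_pred b y : a b y `^ (beta - 1) <= C * C * expy (5 / 32) y.
Proof.
have [b0 b1 b2 b3] := aC b y.
rewrite powRB; last by rewrite (gt_eqF b0) implybT.
rewrite powRr1 ?(ltW b0)//.
have h := ler_pM (powR_ge0 _ _) _ b3 b2.
apply: le_trans (h _) _; first by rewrite invr_ge0 ltW.
have CC : 0 <= C * C by rewrite mulr_ge0// ltW.
by rewrite mulrACA -expyD; apply: (ler_wpM2l CC); apply: expy_le => //; lra.
Qed.

(** [a false] is the reference and [a true] the perturbed average. The tangent inequality bounds J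
    on one side only; this gives the other side for the candidate optimiser. Exponents in y: 3/16
    for the squared increment and 5/32 for a^(beta - 1). *)
Lemma second_order : itg gam (fun y => a false y `^ beta * (a true y - a false y)) ->
  `|\int[gam]_y (a true y `^ p) - \int[gam]_y (a false y `^ p) -
    p * \int[gam]_y (a false y `^ beta * (a true y - a false y))| <=
  p * `|beta| * (2 * C * C) * \int[gam]_y expy (11 / 32) y * e.
Proof.
move=> Di; have i : itg gam (expy (11 / 32)) by apply: gam_gy; lra.
have pDi := itgZ p Di; have J1 := itg_powR true; have J0 := itg_powR false.
rewrite -RintZ// -RintB// -RintB//; last exact: itgB.
rewrite mulrAC -RintZ//; apply: Rint_norm_le.
- by apply: itgB => //; exact: itgB.
- exact: itgZ.
move=> y; have [b0 _ _ _] := aC true y; have [b0' _ _ _] := aC false y.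
have h := powR_taylor2 b0' b0 onem_inv_gt0; rewrite onem_invB1 in h.
rewrite (mulrA p (a false y `^ beta)); apply: le_trans h _.
set K := p * `|beta|.
have K0 : 0 <= K by rewrite mulr_ge0// ltW// onem_inv_gt0.
have h1 := ler_pM (sqr_ge0 _) (addr_ge0 (powR_ge0 _ _) (powR_ge0 _ _)) (a_sqr y)
  (lerD (powR_pred false y) (powR_pred true y)).
rewrite -(mulrA K); apply: le_trans (ler_wpM2l K0 h1) _.
rewrite (_ : 11 / 32 = 3 / 16 + 5 / 32); last by lra.
by rewrite expyD le_eqVlt; apply/orP; left; apply/eqP; rewrite /K; ring.
Qed.

End SecondOrder.

End GaussianFunctionals.

(** * Scalar inequalities for the exponential cost *)

Lemma expR_sub1_ge {R : realType} (s : R) : 0 <= s -> s / 2 * expR (s / 2) <= expR s - 1.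
Proof.
move=> s0; have := expR_ge1Dx (s / 2); have e0 := expR_gt0 (s / 2).
have -> : expR s = expR (s / 2) * expR (s / 2) by rewrite -expRD; congr expR; lra.
by nra.
Qed.

(* A Young inequality with exponents 4 and 4/3, stated without roots. *)
Lemma young34 {R : realType} (B a c q : R) : 0 <= B -> 0 <= a -> 0 <= c -> 0 < q ->
  B ^+ 4 <= c ^+ 3 -> B * a <= q ^+ 3 * (a ^+ 4 + c / q ^+ 4).
Proof.
move=> B0 a0 c0 q0 Bc; have q4 : 0 < q ^+ 4 by exact: exprn_gt0.
have q3 : 0 < q ^+ 3 by exact: exprn_gt0.
set x := c / q ^+ 4; have x0 : 0 <= x by rewrite divr_ge0// ltW.
have cE : c = x * q ^+ 4 by rewrite divfK// gt_eqF.
have a40 : 0 <= a ^+ 4 by exact: exprn_ge0.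
(* Any z above both terms will do, by comparing fourth powers; their sum is such a z. *)
have M (z : R) : 0 <= z -> a ^+ 4 <= z -> x <= z -> B * a <= q ^+ 3 * z.
  move=> z0 az xz.
  have qz0 : 0 <= q ^+ 3 * z by rewrite mulr_ge0// ltW.
  have Ba0 : 0 <= B * a by exact: mulr_ge0.
  suff : (B * a) ^+ 4 <= (q ^+ 3 * z) ^+ 4 by rewrite ler_pXn2r// nnegrE.
  rewrite [leLHS]exprMn [leRHS]exprMn; apply: (@le_trans _ _ (c ^+ 3 * z)).
    by rewrite ler_pM ?exprn_ge0.
  have -> : c ^+ 3 * z = (q ^+ 3) ^+ 4 * (x ^+ 3 * z) by rewrite cE; ring.
  have q12 : 0 <= (q ^+ 3) ^+ 4 by rewrite exprn_ge0// ltW.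
  rewrite (exprSr z 3); apply/(ler_wpM2l q12)/(ler_wpM2r z0).
  by rewrite ler_pXn2r// nnegrE.
by apply: M; rewrite ?addr_ge0// ?lerDl ?lerDr.
Qed.

(** Optimise over l: l = sqrt b / sqrt h balances the two terms. If h = 0 and e > 0, then l = b / e
    gives 2 e <= e, which is absurd. *)
Lemma le_sqrtM_of_amgm {R : realType} (e h b : R) : 0 <= h -> 0 < b ->
  (forall l, 0 < l -> 2 * e <= l * h + l^-1 * b) -> e <= Num.sqrt b * Num.sqrt h.
Proof.
move=> h0 b0 H; have [h1|h1] := ltP 0 h; last first.
  have hE : h = 0 by apply/eqP; rewrite eq_le h1.
  rewrite hE sqrtr0 mulr0; rewrite leNgt; apply/negP => e0.
  have := H (b / e) (divr_gt0 b0 e0).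
  by rewrite hE mulr0 add0r invfM invrK mulrAC mulVf ?gt_eqF// mul1r; lra.
have sb : 0 < Num.sqrt b by rewrite sqrtr_gt0.
have sh : 0 < Num.sqrt h by rewrite sqrtr_gt0.
have hE : h = Num.sqrt h ^+ 2 by rewrite sqr_sqrtr// ltW.
have bE : b = Num.sqrt b ^+ 2 by rewrite sqr_sqrtr// ltW.
have := H _ (divr_gt0 sb sh); move: bE hE sb sh; clear.
move: (Num.sqrt b) (Num.sqrt h) => u v -> -> u0 v0; rewrite invf_div.
have -> : v / u * u ^+ 2 = u * v by field; rewrite gt_eqF.
have -> : u / v * v ^+ 2 = u * v by field; rewrite gt_eqF.
by lra.
Qed.

(** * Expansion of J around P0 *)

Section Expansion.
Context {R : realType} {d : nat} (T r : R) (sigma : 'M[R]_d) (alpha tau : R).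
Hypothesis T0 : 0 < T.
Hypothesis alpha1 : alpha < 1.
Local Notation V := (d.-tuple R).
Local Notation like := (like T r sigma).
Local Notation expm := (expm T r sigma).
Local Notation expy := (expy T).
Local Notation mpr := (mpr r sigma).
Local Notation tnu := (tnu T r sigma).
Local Notation avg := (avg T r sigma).
Local Notation p := ((1 - alpha)^-1).
Local Notation beta := (alpha / (1 - alpha)).
Local Notation F2 := (sqfrob (invmx sigma)).
Context (gam : probability V R).
Hypothesis gam_gy : forall k, k < 2^-1 -> itg gam (expy k).
Hypothesis gam_bnd : forall (g : V -> R) k C, k < 2^-1 ->
  measurable_fun setT g -> (forall y, `|g y| <= C * expy k y) ->
  lebint (fun y => (g y * phiT T y)%:E) = (\int[gam]_y (g y)%:E)%E.
Context (P0 : probability V R) (t c C : R).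
Hypothesis t8 : 8 <= t.
Hypothesis c0 : 0 < c.
Hypothesis C0 : 0 < C.
Hypothesis iex : itg P0 (expm (t * (1 + c))).
(** Bounds the moment of order t of P0 and of all its pushforwards by shifts with [tnu] at most 1,
    so that the constant [C] is uniform in delta; the margin c pays for the triangle inequality. *)
Let K := \int[P0]_x expm (t * (1 + c)) x * expR (t * (1 + c^-1)).
Hypothesis HC : forall Q : probability V R, itg Q (expm t) -> \int[Q]_x expm t x <= K ->
  forall y, [/\ 0 < avg Q y, avg Q y <= C * expy 32^-1 y,
    (avg Q y)^-1 <= C * expy 32^-1 y & avg Q y `^ beta <= C * expy 8^-1 y].
Local Notation h := (fun x : V => Hfun alpha T r sigma P0 (vec x)).
Local Notation Hn := (HnormL2 alpha T r sigma P0).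
Local Notation w := (fun y => avg P0 y `^ beta).
Local Notation gradv := (gradv T r sigma gam w).
Local Notation D Q := (\int[gam]_y (w y * (avg Q y - avg P0 y))).

Let mid : measurable_fun setT (@idfun V).
Proof. exact: measurable_id. Qed.

Let p0 : 0 < p. Proof. exact: onem_inv_gt0. Qed.

Let mw : measurable_fun setT w.
Proof. by apply: measurable_powR_comp; exact: measurable_avg. Qed.

Let w0 y : 0 <= w y. Proof. exact: powR_ge0. Qed.

Let ttc : t <= t * (1 + c).
Proof. by have h8 := t8; rewrite ler_peMr ?lerDl ?ltW//; lra. Qed.

Lemma itg_ex k : k <= t -> itg P0 (expm k).
Proof.
move=> kt; apply: itg_le _ _ iex; first exact: measurable_expm.
by move=> x; rewrite ger0_norm ?expm_ge0//; apply: expm_le => //; exact: le_trans ttc.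
Qed.

Lemma avg_P0_bounds y : [/\ 0 < avg P0 y, avg P0 y <= C * expy 32^-1 y,
  (avg P0 y)^-1 <= C * expy 32^-1 y & avg P0 y `^ beta <= C * expy 8^-1 y].
Proof.
apply: HC; first exact: itg_ex.
apply: (@le_trans _ _ (\int[P0]_x expm (t * (1 + c)) x)).
  apply: le_Rint => //; first exact: itg_ex.
  by move=> x; exact: expm_le.
rewrite /K ler_peMr ?Rintegral_ge0// => [x _|]; first exact: expm_ge0.
have h8 := t8; rewrite -expR0 ler_expR mulr_ge0 ?addr_ge0 ?invr_ge0 ?(ltW c0)//; lra.
Qed.

Let w_le y : w y <= C * expy 8^-1 y.
Proof. by have [] := avg_P0_bounds y. Qed.

Let mgradv i : measurable_fun setT (fun x => gradv x i 0).
Proof.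
have h8 := t8; apply: (measurable_gradv T0 gam_gy mw w0 w_le (P := P0)).
by apply: itg_ex; lra.
Qed.

Lemma dotv_h x v : dotv (h x) v = p * dotv (invmx sigma *m v) (gradv x).
Proof. by rewrite (dotv_Hfun T0 gam_gy gam_bnd w_le). Qed.

Lemma measurable_h i : measurable_fun setT (fun x => h x i 0).
Proof.
rewrite (_ : (fun x => h x i 0) = fun x => p * dotv (invmx sigma *m delta_mx i 0) (gradv x)).
  by apply: measurable_funM => //; exact: measurable_dotv.
by apply/funext => x; rewrite (HfunE T0 gam_gy gam_bnd w_le).
Qed.

(** Each component of [gradv] is O([expm 1]). Consequently |H|^4 is O([expm 4]), and H has the
    fourth moment that the truncation error requires. *)
Lemma sqnorm2_h_le : exists2 Ch, 0 <= Ch & forall x, sqnorm2 (h x) <= Ch * expm 2 x.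
Proof.
pose G := gradC T C * \int[gam]_y expy (7 / 16) y.
pose S := \sum_(i < d) sqnorm2 (invmx sigma *m delta_mx i 0).
have S0 : 0 <= S by apply: sumr_ge0 => i _; exact: sqnorm2_ge0.
have S1 : 0 <= \sum_(i < d) G ^+ 2 by apply: sumr_ge0 => i _; exact: sqr_ge0.
exists (p ^+ 2 * S * \sum_(i < d) G ^+ 2); first by rewrite mulr_ge0// mulr_ge0// sqr_ge0.
move=> x.
have g2 : sqnorm2 (gradv x) <= (\sum_(i < d) G ^+ 2) * expm 2 x.
  rewrite mulr_suml; apply: ler_sum => i _.
  have gl := gradv_le r sigma T0 gam_gy mw w0 w_le i x.
  rewrite -[leLHS]real_normK ?num_real// (_ : 2 = 1 + 1)// expmD -expr2 -exprMn.
  by rewrite ler_pXn2r// nnegrE; exact: le_trans gl.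
rewrite [leRHS](_ : _ = S * (p ^+ 2 * ((\sum_(i < d) G ^+ 2) * expm 2 x))); last by ring.
rewrite /S [leRHS]mulr_suml; apply: ler_sum => i _.
rewrite (HfunE T0 gam_gy gam_bnd w_le) exprMn [leRHS]mulrCA.
apply/(ler_wpM2l (sqr_ge0 p)).
apply: le_trans (dotv_cauchy _ _) _.
exact: (ler_wpM2l (sqnorm2_ge0 _)).
Qed.

Let msqh : measurable_fun setT (fun x => sqnorm2 (h x)).
Proof. by apply: measurable_sqnorm2; exact: measurable_h. Qed.

Lemma itg_sqnorm2_h : itg P0 (fun x => sqnorm2 (h x)).
Proof.
have [Ch Ch0 hCh] := sqnorm2_h_le; have h8 := t8.
have i : itg P0 (expm 2) by apply: itg_ex; lra.
by apply: itg_le msqh _ (itgZ Ch i) => x; rewrite ger0_norm ?sqnorm2_ge0.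
Qed.

Lemma itg_sqnorm2_h_sqr : itg P0 (fun x => sqnorm2 (h x) ^+ 2).
Proof.
have [Ch Ch0 hCh] := sqnorm2_h_le; have h8 := t8.
have i : itg P0 (expm 4) by apply: itg_ex; lra.
apply: itg_le _ _ (itgZ (Ch ^+ 2) i) => [|x]; first exact: measurable_funX.
rewrite ger0_norm ?sqr_ge0// (_ : 4 = 2 + 2)//; last by lra.
rewrite expmD -expr2 -exprMn ler_pXn2r// nnegrE ?sqnorm2_ge0//.
by rewrite mulr_ge0 ?expm_ge0.
Qed.

Lemma Hn_ge0 : 0 <= Hn. Proof. exact: sqrtr_ge0. Qed.

Lemma Hn_sqr : Hn ^+ 2 = \int[P0]_x sqnorm2 (h x).
Proof.
rewrite sqr_sqrtr//; apply: fine_ge0; apply: integral_ge0 => x _.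
by rewrite lee_fin sqnorm2_ge0.
Qed.

Lemma mprB x' x : mpr x' - mpr x = invmx sigma *m (vec x' - vec x).
Proof. by rewrite !mprE -mulmxBr opprB addrA subrK. Qed.

Lemma tnu_le x' x : tnu x' x <= T * F2 * sqnorm2 (vec x' - vec x).
Proof. by rewrite tnuE mprB -mulrA ler_pM2l// sqnorm2_mulmx. Qed.

(** * The first-order term along a coupling of small cost *)

Section CouplingBound.
Variables (Q : probability V R) (pi : probability (V * V)%type R) (q : R).
Hypothesis q0 : 0 < q.
Hypothesis cpl : coupling Q P0 pi.
Hypothesis tau0 : 0 < tau.
Hypothesis tauF : 4 * T * F2 <= tau.
Hypothesis cost : (\int[pi]_z ctau tau z.1 z.2 <= (q ^+ 4)%:E)%E.
Let v (z : V * V) := vec z.1 - vec z.2.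
Let s z := tau * sqnorm2 (v z).
Let cst z := expR (s z) - 1.
Let u (z : V * V) := tnu z.1 z.2.

Let law1 A : measurable A -> Q A = pi (fst @^-1` A).
Proof. by move=> mA; rewrite -cpl.1//; congr (pi _); apply/seteqP; split => -[a b] //= []. Qed.

Let law2 A : measurable A -> P0 A = pi (snd @^-1` A).
Proof. by move=> mA; rewrite -cpl.2//; congr (pi _); apply/seteqP; split => -[a b] //= []. Qed.

Let s0 z : 0 <= s z.
Proof. by apply: mulr_ge0; [exact: ltW|exact: sqnorm2_ge0]. Qed.

(** The lower bound 4 T |sigma^-1|^2 on tau enters here, the Frobenius norm dominating the operator
    norm. [B4] uses the full factor 4, [iX'] only half of it. *)
Let us z : 4 * u z <= s z.
Proof.
have h1 := tnu_le z.1 z.2; have h2 := ler_wpM2r (sqnorm2_ge0 (v z)) tauF.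
by rewrite /u /s; apply: le_trans h2; move: h1; rewrite /v; lra.
Qed.

Let cst_ge z : s z <= cst z.
Proof. by rewrite /cst; have := expR_ge1Dx (s z); lra. Qed.

Let cst0 z : 0 <= cst z.
Proof. exact: le_trans (cst_ge z). Qed.

Let mv i : measurable_fun setT (fun z => v z i 0).
Proof.
apply: (eq_measurable_fun (fun z => vec z.1 i 0 - vec z.2 i 0)).
  by move=> z _; rewrite !mxE.
by apply: measurable_funB; exact: measurable_vec_comp.
Qed.

Let ms : measurable_fun setT s.
Proof. by apply: measurable_funM => //; exact: measurable_sqnorm2. Qed.

Let icst : itg pi cst.
Proof.
apply: itg_lty => //; last by apply: le_lt_trans cost (ltry _).
by apply: measurable_funB => //; exact: measurable_expR_comp.
Qed.

Let Rcst : \int[pi]_z cst z <= q ^+ 4.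
Proof. by rewrite -lee_fin -Rint_fine. Qed.

Let iex2 k : k <= t -> itg pi (fun z => expm k z.2).
Proof.
move=> kt; apply/(law_itg measurable_snd law2); last exact: itg_ex.
exact: measurable_expm.
Qed.

(** The moment of the first marginal is borrowed from P0 and the cost: it is at most [expm 1 z.2]
    times e^u, a product bounded by the sum of squares, and e^(2 u) <= e^s. *)
Let iX' : itg pi (fun z => expm 2^-1 z.1).
Proof.
have h8 := t8; have t2 : 2 <= t by lra.
have i := itgD (iex2 t2) (itgD icst (itg_cst pi 1)).
apply: itg_le _ _ i => [|z]; first exact: measurable_expm.
rewrite ger0_norm ?expm_ge0//.
have h1 := mpr2_triangle r sigma T0 z.1 z.2 ltr01; rewrite invr1 -/(u z) in h1.
have e1 : expm 2^-1 z.1 <= expm 1 z.2 * expR (u z).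
  by rewrite !expmE -expRD ler_expR; move: h1; rewrite -[1 + 1]/2; lra.
have e2 : expR (u z) ^+ 2 <= cst z + 1.
  rewrite /cst subrK expr2 -expRD ler_expR.
  by have := us z; have := tnu_ge0 r sigma T0 z.1 z.2; rewrite -/(u z); lra.
have e3 : expm 1 z.2 ^+ 2 = expm 2 z.2 by rewrite expr2 -expmD.
apply: le_trans e1 _; rewrite -e3.
apply: le_trans (_ : expm 1 z.2 ^+ 2 + expR (u z) ^+ 2 <= _); last by rewrite lerD2l.
have := sqr_ge0 (expm 1 z.2 - expR (u z)); have := sqr_ge0 (expm 1 z.2).
have := sqr_ge0 (expR (u z)).
by move: (expm _ _) (expR _) => a b; lra.
Qed.

Let B z := u z * expk (5 / 4) (u z).

Let u0 z : 0 <= u z. Proof. exact: tnu_ge0. Qed.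

(** The cost dominates 2 u e^(2 u), whose cube is 8 u^3 e^(6 u), while B^4 = u^4 e^(5 u) and u <=
    e^u. Powers 4 and 3 are matched to [young34]. *)
Let B4 z : B z ^+ 4 <= cst z ^+ 3.
Proof.
have h1 := expR_sub1_ge (s0 z); have h2 := us z; have h3 := u0 z.
have h4 : 2 * u z * expR (2 * u z) <= cst z.
  have h5 : 2 * u z <= s z / 2 by lra.
  have h6 : 0 <= 2 * u z by lra.
  by apply: le_trans h1; rewrite ler_pM ?expR_ge0 ?ler_expR.
have h5 := mulr_ge0 (mulr_ge0 (ler0n R 2) h3) (expR_ge0 (2 * u z)).
apply: (@le_trans _ _ ((2 * u z * expR (2 * u z)) ^+ 3)); last first.
  by rewrite ler_pXn2r// nnegrE.
have h6 : u z <= expR (u z) by apply: le_trans (expR_ge1Dx _); rewrite lerDr.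
have E1 : B z ^+ 4 = u z ^+ 3 * expR (5 * u z) * u z.
  rewrite /B exprMn expkE -expRM_natl (_ : 4%:R * (5 / 4 * u z) = 5 * u z); last by lra.
  by rewrite exprSr mulrAC.
have E2 : (2 * u z * expR (2 * u z)) ^+ 3 = 8 * (u z ^+ 3 * expR (5 * u z) * expR (u z)).
  rewrite [LHS]exprMn -expRM_natl (_ : 3%:R * (2 * u z) = 5 * u z + u z); last by lra.
  by rewrite expRD; ring.
rewrite E1 E2; have a0 : 0 <= u z ^+ 3 * expR (5 * u z).
  by rewrite mulr_ge0 ?exprn_ge0 ?expR_ge0.
have := ler_wpM2l a0 h6; have := mulr_ge0 a0 h3.
by move: (_ * u z) (_ * expR (u z)) => a b; lra.
Qed.

Let Bd z := u z * expk (5 / 4) (u z) * expm (3 / 2) z.2.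

(** The fourth power of [expm (3 / 2)] has order 6, within the available moments. Since the mean
    cost is at most q^4, the expectation is at most q^3 (E6 + 1). *)
Let Bd_le z : Bd z <= q ^+ 3 * (expm 6 z.2 + cst z / q ^+ 4).
Proof.
have B0 : 0 <= B z by rewrite mulr_ge0 ?expk_ge0.
apply: le_trans (young34 B0 (expm_ge0 T r sigma (3 / 2) z.2) (cst0 z) q0 (B4 z)) _.
rewrite (_ : expm (3 / 2) z.2 ^+ 4 = expm 6 z.2)//.
by rewrite !expmE -expRM_natl; congr expR; lra.
Qed.

Let iBd_ub : itg pi (fun z => q ^+ 3 * (expm 6 z.2 + cst z / q ^+ 4)).
Proof.
have h8 := t8; have t6 : 6 <= t by lra.
apply: itgZ; apply: itgD; first exact: iex2.
by under eq_fun do rewrite mulrC; exact: itgZ.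
Qed.

Let mu_ : measurable_fun setT u.
Proof. exact: measurable_tnu. Qed.

Let iBd : itg pi Bd.
Proof.
apply: itg_le _ _ iBd_ub => [|z].
  apply: measurable_funM; last exact: measurable_expm.
  by apply: measurable_funM => //; exact: measurable_expk.
by rewrite ger0_norm ?Bd_le//; exact: (mulr_ge0 (mulr_ge0 (u0 z) (expk_ge0 _ _)) (expm_ge0 _ _ _ _ _)).
Qed.

Let E6 := \int[P0]_x expm 6 x.

Let RBd : \int[pi]_z Bd z <= q ^+ 3 * (E6 + 1).
Proof.
apply: le_trans (le_Rint iBd iBd_ub Bd_le) _.
have h8 := t8; have t6 : 6 <= t by lra.
have i1 : itg pi (fun z => cst z / q ^+ 4).
  by under eq_fun do rewrite mulrC; exact: itgZ.
have i6 := iex2 t6.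
rewrite RintZ; last exact: itgD.
have q3 : 0 <= q ^+ 3 by rewrite exprn_ge0// ltW.
apply: (ler_wpM2l q3); rewrite RintD//.
rewrite /E6 (law_Rint measurable_snd law2 (itg_ex t6)) lerD2l.
under eq_Rintegral do rewrite mulrC.
by rewrite RintZ// ler_pdivrMl ?exprn_gt0// mulr1.
Qed.

Let avgQ y : avg Q y = \int[pi]_z like z.1 y.
Proof. by rewrite avgE (law_Rint measurable_fst law1)//; exact: itg_like. Qed.

Let avgP y : avg P0 y = \int[pi]_z like z.2 y.
Proof. by rewrite avgE (law_Rint measurable_snd law2)//; exact: itg_like. Qed.

Let iX : itg pi (fun z => expm 1 z.2).
Proof. by have h8 := t8; apply: iex2; lra. Qed.

Lemma coupling_itg : itg gam (fun y => w y * (avg Q y - avg P0 y)).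
Proof.
under eq_fun do rewrite avgQ [X in _ * (_ - X)]avgP.
exact: (itg_first_order_gam T0 gam_gy mw w0 w_le measurable_fst measurable_snd iX' iX).
Qed.

Let dn z := dotv (mpr z.1 - mpr z.2) (gradv z.2).
Let pdn z : p * dn z = dotv (h z.2) (v z).
Proof. by rewrite dotv_h /dn mprB. Qed.

Let idn : itg pi dn.
Proof.
exact: (itg_first_order T0 gam_gy mw w0 w_le measurable_fst measurable_snd iX' iX iBd mgradv).
Qed.

(** AM-GM with a free weight l is integrated using e^s - 1 >= s, that is |v|^2 <= cost / tau;
    optimising l restores Cauchy-Schwarz with the sharp constant. *)
Let pdn_le : `|p * \int[pi]_z dn z| <= Num.sqrt (q ^+ 4 / tau) * Num.sqrt (Hn ^+ 2).
Proof.
apply: le_sqrtM_of_amgm; [exact: sqr_ge0|by rewrite divr_gt0// exprn_gt0|move=> l l0].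
rewrite -RintZ//; have ip := itgZ p idn.
apply: le_trans (ler_wpM2l (ler0n _ 2) (Rint_normr ip)) _.
rewrite -RintZ; last exact: itg_norm.
have ih := (law_itg measurable_snd law2 msqh).1 itg_sqnorm2_h.
have i1 := itgZ l ih; have i2 := itgZ (l^-1 * tau^-1) icst.
apply: le_trans (le_Rint _ (itgD i1 i2) _) _.
- by apply: itgZ; exact: itg_norm.
- move=> z; rewrite pdn.
  have := dotv_amgm (h z.2) (v z) l0.
  have := dotv_amgm ((- 1) *: h z.2) (v z) l0; rewrite sqnorm2Z dotvZl.
  have hv : l^-1 * sqnorm2 (v z) <= l^-1 / tau * cst z.
    rewrite -mulrA ler_pM2l ?invr_gt0// ler_pdivlMl//; exact: cst_ge.
  move: hv; set a := l^-1 * sqnorm2 (v z); set b := _ * cst z.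
  set e := sqnorm2 (h z.2); set f := dotv _ _.
  clearbody a b e f; move=> ab h1 h2.
  have [f0|f0] := leP 0 f; [rewrite ger0_norm//|rewrite ltr0_norm//]; lra.
rewrite RintD// !RintZ// Hn_sqr (law_Rint measurable_snd law2 itg_sqnorm2_h) lerD2l.
have lt0 : 0 <= l^-1 / tau by rewrite divr_ge0 ?invr_ge0// ltW.
by apply: le_trans (ler_wpM2l lt0 Rcst) _; rewrite -mulrA (mulrC tau^-1).
Qed.

Lemma coupling_bound : `|p * D Q| <= Num.sqrt (q ^+ 4 / tau) * Hn +
  p * (1000 * C * \int[gam]_y expy (7 / 16) y) * (E6 + 1) * q ^+ 3.
Proof.
have g70 : 0 <= \int[gam]_y expy (7 / 16) y.
  by apply: Rintegral_ge0 => y _; exact: expy_ge0.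
have G0 := mulr_ge0 (mulr_ge0 (ler0n R 1000) (ltW C0)) g70.
have fo := first_order T0 gam_gy mw w0 w_le measurable_fst measurable_snd
  iX' iX iBd mgradv.
have DE : D Q = \int[gam]_y (w y * (\int[pi]_z like z.1 y - \int[pi]_z like z.2 y)).
  by apply: eq_Rintegral => y _; rewrite avgQ [X in _ * (_ - X)]avgP.
rewrite -DE in fo.
have -> : p * D Q = p * \int[pi]_z dn z + p * (D Q - \int[pi]_z dn z).
  by rewrite mulrBr [RHS]addrC subrK.
apply: le_trans (ler_normD _ _) _; apply: lerD.
  by apply: le_trans pdn_le _; rewrite (sqrtr_sqr Hn) ger0_norm ?Hn_ge0.
rewrite normrM (gtr0_norm p0) -!(mulrA p); apply: (ler_wpM2l (ltW p0)).
apply: le_trans fo _; rewrite -[leRHS]mulrA; apply: (ler_wpM2l G0).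
by rewrite [leRHS]mulrC; exact: RBd.
Qed.

End CouplingBound.

(** A uniform bound e <= 1 on the displacement keeps the moment of order t below [K], so the
    two-sided estimates apply to Q. The error is the second-order term of the power plus p times the
    Taylor remainder of the likelihood, both O(e). *)
Lemma push_expansion : exists2 K2, 0 <= K2 &
  forall (Dl : V -> 'cV[R]_d) (Q : probability V R) (e : R),
    (forall i, measurable_fun setT (fun x => Dl x i 0)) ->
    measurable_fun setT (fun x => unvec (vec x + Dl x)) ->
    (forall A, measurable A -> Q A = P0 ((fun x => unvec (vec x + Dl x)) @^-1` A)) ->
    e <= 1 -> (forall x, T * F2 * sqnorm2 (Dl x) <= e) ->
    itg gam (fun y => avg Q y `^ p) /\
    `|\int[gam]_y (avg Q y `^ p) - \int[gam]_y (avg P0 y `^ p) -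
      \int[P0]_x dotv (h x) (Dl x)| <= K2 * e.
Proof.
pose K3 := 1600 * expk 106 1 * \int[P0]_x expm 8 x.
pose K4 := p * `|beta| * (2 * C * C) * \int[gam]_y expy (11 / 32) y.
pose K5 := 1000 * C * (\int[gam]_y expy (7 / 16) y) * (expk (5 / 4) 1 * \int[P0]_x expm (3 / 2) x).
have h8 := t8; have n0 := ltW p0; have C0' := ltW C0.
have g70 : 0 <= \int[gam]_y expy (7 / 16) y.
  by apply: Rintegral_ge0 => y _; exact: expy_ge0.
have g11 : 0 <= \int[gam]_y expy (11 / 32) y.
  by apply: Rintegral_ge0 => y _; exact: expy_ge0.
have E0 k : 0 <= \int[P0]_x expm k x by apply: Rintegral_ge0 => x _; exact: expm_ge0.
have G0 := mulr_ge0 (mulr_ge0 (ler0n R 1000) C0') g70.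
have K30 : 0 <= K3 := mulr_ge0 (mulr_ge0 (ler0n R 1600) (expk_ge0 106 1)) (E0 8).
have K50 : 0 <= K5 := mulr_ge0 G0 (mulr_ge0 (expk_ge0 (5 / 4) 1) (E0 (3 / 2))).
have K40 : 0 <= K4.
  exact: (mulr_ge0 (mulr_ge0 (mulr_ge0 n0 (normr_ge0 _))
    (mulr_ge0 (mulr_ge0 (ler0n R 2) C0') C0')) g11).
exists (K4 * K3 + p * K5); first by rewrite addr_ge0// mulr_ge0.
move=> Dl Q e mDl mg law e1 De.
pose g x := unvec (vec x + Dl x).
have gE x : vec (g x) = vec x + Dl x.
  by apply/colP => i; rewrite !mxE tnth_mktuple !mxE.
have ue x : tnu (g x) x <= e.
  apply: le_trans (tnu_le _ _) _; apply: le_trans (De x).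
  by rewrite gE addrAC subrr add0r.
have u0 x : 0 <= tnu (g x) x by exact: tnu_ge0.
have u1 x : tnu (g x) x <= 1 by exact: le_trans e1.
have e0 : 0 <= e by exact: le_trans (u0 [tuple of nseq d 0]) (ue _).
have exg x : expm t (g x) <= expm (t * (1 + c)) x * expR (t * (1 + c^-1)).
  have t0 : 0 <= t by lra.
  have c10 : 0 <= 1 + c^-1 by rewrite addr_ge0// invr_ge0 ltW.
  have h1 := mpr2_triangle r sigma T0 (g x) x c0.
  have h2 := ler_wpM2l c10 (u1 x); rewrite mulr1 in h2.
  have h3 := ler_wpM2l t0 (le_trans h1 (lerD (lexx _) h2)).
  rewrite !expmE -expRD ler_expR; apply: le_trans h3 _.
  by rewrite le_eqVlt; apply/orP; left; apply/eqP; ring.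
have mex : measurable_fun setT (expm t) by exact: measurable_expm.
have iub : itg P0 (fun x => expm (t * (1 + c)) x * expR (t * (1 + c^-1))).
  by under eq_fun do rewrite mulrC; exact: itgZ.
have ig : itg P0 (fun x => expm t (g x)).
  apply: itg_le _ _ iub => [|x]; first exact: measurable_expm.
  by rewrite ger0_norm ?expm_ge0.
have iQ : itg Q (expm t) by apply/(law_itg mg law mex).
have QK : \int[Q]_x expm t x <= K.
  rewrite (law_Rint mg law iQ); apply: le_trans (le_Rint ig iub exg) _.
  under eq_Rintegral do rewrite mulrC.
  by rewrite RintZ// mulrC.
have avgQ y : avg Q y = \int[P0]_x like (g x) y.
  by rewrite avgE (law_Rint mg law)//; exact: itg_like.
have i8 : itg P0 (expm 8) by exact: itg_ex.
(* Jensen moves the square inside the average; the full moment of order 8 is used at this point. *)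
have a_sqr y : (avg Q y - avg P0 y) ^+ 2 <= K3 * e * expy (3 / 16) y.
  have L1 : itg P0 (fun x => like (g x) y) by exact: itg_like_comp.
  have L2 : itg P0 (fun x => like x y) by exact: itg_like.
  rewrite avgQ avgE -RintB//.
  pose G := 1600 * expk 106 1 * e * expy (3 / 16) y.
  have G_le x : (like (g x) y - like x y) ^+ 2 <= G * expm 8 x.
    apply: le_trans (like_incr_sqr r sigma T0 _ _ _) _.
    rewrite (_ : G * expm 8 x = 1600 * (e * expk 106 1 * expm 8 x) * expy (3 / 16) y); last first.
      by rewrite /G; ring.
    apply: (ler_wpM2r (expy_ge0 _ _ _)); apply: (ler_wpM2l (ler0n _ 1600)).
    apply: (ler_wpM2r (expm_ge0 _ _ _ _ _)).
    rewrite ler_pM ?expk_ge0// !expkE ler_expR.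
    by apply: (ler_wpM2l (ler0n _ 106)).
  have iG := itgZ G i8.
  have isq : itg P0 (fun x => (like (g x) y - like x y) ^+ 2).
    apply: itg_le _ _ iG => [|x]; last by rewrite ger0_norm ?sqr_ge0.
    by apply: measurable_funX; apply: measurable_funB; exact: measurable_like.
  apply: le_trans (sqr_Rint_le (itgB L1 L2) isq) _.
  apply: le_trans (le_Rint isq iG G_le) _.
  by rewrite RintZ// /G /K3 le_eqVlt; apply/orP; left; apply/eqP; ring.
pose Bd x := tnu (g x) x * expk (5 / 4) (tnu (g x) x) * expm (3 / 2) x.
have i32 : itg P0 (expm (3 / 2)) by apply: itg_ex; lra.
have Bd_le x : Bd x <= e * expk (5 / 4) 1 * expm (3 / 2) x.
  apply: (ler_wpM2r (expm_ge0 _ _ _ _ _)); rewrite ler_pM ?expk_ge0// !expkE ler_expR.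
  by apply: ler_wpM2l (u1 x); lra.
have iBu := itgZ (e * expk (5 / 4) 1) i32.
have mtnu : measurable_fun setT (fun x => tnu (g x) x) by exact: measurable_tnu.
have iBd : itg P0 Bd.
  apply: itg_le _ _ iBu => [|x].
    apply: measurable_funM; last exact: measurable_expm.
    by apply: measurable_funM => //; exact: measurable_expk.
  rewrite ger0_norm ?Bd_le//.
  exact: (mulr_ge0 (mulr_ge0 (u0 x) (expk_ge0 _ _)) (expm_ge0 _ _ _ _ _)).
have RBd : \int[P0]_x Bd x <= e * (expk (5 / 4) 1 * \int[P0]_x expm (3 / 2) x).
  by apply: le_trans (le_Rint iBd iBu Bd_le) _; rewrite RintZ// -mulrA.
have iX' : itg P0 (fun x => expm 2^-1 (g x)).
  apply: itg_le _ _ ig => [|x]; first exact: measurable_expm.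
  by rewrite ger0_norm ?expm_ge0//; apply: expm_le => //; lra.
have iX : itg P0 (expm 1) by apply: itg_ex; lra.
have fo := first_order T0 gam_gy mw w0 w_le mg mid iX' iX iBd mgradv.
have Di := itg_first_order_gam T0 gam_gy mw w0 w_le mg mid iX' iX.
have DE : D Q = \int[gam]_y (w y * (\int[P0]_x like (g x) y - \int[P0]_x like x y)).
  by apply: eq_Rintegral => y _; rewrite avgQ.
rewrite -DE in fo.
have Di' : itg gam (fun y => w y * (avg Q y - avg P0 y)).
  by under eq_fun do rewrite avgQ.
have idn := itg_first_order T0 gam_gy mw w0 w_le mg mid iX' iX iBd mgradv.
have dnE : p * \int[P0]_x dotv (mpr (g x) - mpr x) (gradv x) =
    \int[P0]_x dotv (h x) (Dl x).
  rewrite -RintZ//; apply: eq_Rintegral => x _.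
  by rewrite dotv_h mprB gE addrAC subrr add0r.
pose a b := avg (if b then Q else P0).
have ma b : measurable_fun setT (a b) by exact: measurable_avg.
have aC b y : [/\ 0 < a b y, a b y <= C * expy 32^-1 y,
    (a b y)^-1 <= C * expy 32^-1 y & a b y `^ beta <= C * expy 8^-1 y].
  by case: b; [exact: HC|exact: avg_P0_bounds].
have JQ := itg_powR T0 alpha1 gam_gy C0 ma aC true.
split; first exact: JQ.
have so := second_order T0 alpha1 gam_gy C0 ma aC a_sqr Di'.
rewrite /a -/K4 in so.
have E (a1 a2 q x pp : R) : a1 - a2 - pp * x = (a1 - a2 - pp * q) + pp * (q - x).
  by rewrite mulrBr addrA subrK.
rewrite -dnE (E _ _ (D Q)).
apply: le_trans (ler_normD _ _) _; rewrite mulrDl; apply: lerD.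
  by apply: le_trans so _; rewrite (mulrA K4).
rewrite normrM (gtr0_norm p0) -(mulrA p); apply: (ler_wpM2l n0).
apply: le_trans fo _.
apply: le_trans (ler_wpM2l G0 RBd) _.
by rewrite mulrCA [leLHS]mulrC.
Qed.

End Expansion.

(** * Moments of the market price of risk from those of the drift *)

Section Moments.
Context {R : realType} {d : nat} (T r : R) (sigma : 'M[R]_d) (gamma0 t : R).
Local Notation V := (d.-tuple R).
Local Notation F2 := (sqfrob (invmx sigma)).
Context (P0 : probability V R).

Lemma sqfrob_ge0 (A : 'M[R]_d) : 0 <= sqfrob A.
Proof. by apply: sumr_ge0 => i _; apply: sumr_ge0 => j _; exact: sqr_ge0. Qed.

(** The strict inequality leaves room for a factor (1 + c)^2: one 1 + c is the announced margin, the
    other absorbs the translation by r 1. *)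
Lemma itg_ex_of_moments : 0 < T -> 8 <= t -> 0 < gamma0 ->
  (forall g : R, 0 <= g < gamma0 ->
     (\int[P0]_x (expR (g ^+ 2 * sqnorm2 (vec x)))%:E < +oo)%E) ->
  T * t < gamma0 ^+ 2 / F2 ->
  exists2 c, 0 < c & itg P0 (expm T r sigma (t * (1 + c))).
Proof.
move=> T0 t8 g0 mom ht.
have t0 : 0 < t by lra.
have Tt : 0 < T * t by rewrite mulr_gt0.
(* If F2 = 0 the quotient gamma0^2 / F2 is 0 by convention, which contradicts [ht]. *)
have F0 : 0 < F2.
  rewrite lt_neqAle sqfrob_ge0 andbT; apply/eqP => F0.
  by move: ht; rewrite -F0 invr0 mulr0; lra.
set X := T * t * F2; have X0 : 0 < X by rewrite mulr_gt0.
have Xg : X < gamma0 ^+ 2 by rewrite -ltr_pdivlMr.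
pose rho := gamma0 ^+ 2 / X - 1.
have rho0 : 0 < rho by rewrite subr_gt0 ltr_pdivlMr// mul1r.
(* As c <= 1, (1 + c)^2 <= 1 + 3 c <= 1 + 3 rho / 4 < 1 + rho. *)
pose c := Num.min 1 (rho / 4).
have c0 : 0 < c by rewrite lt_min ltr01 divr_gt0.
have c1 : c <= 1 by rewrite ge_min lexx.
have c2 : c <= rho / 4 by rewrite ge_min lexx orbT.
exists c => //.
have Xc : X * (1 + c) ^+ 2 < gamma0 ^+ 2.
  have -> : gamma0 ^+ 2 = X * (1 + rho) by rewrite /rho addrC subrK mulrC divfK// gt_eqF.
  rewrite ltr_pM2l//; have : c * c <= c by rewrite ler_piMr// ltW.
  by rewrite expr2; lra.
have Xc0 : 0 <= X * (1 + c) ^+ 2 by rewrite mulr_ge0 ?sqr_ge0// ltW.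
pose g := Num.sqrt (X * (1 + c) ^+ 2).
have gg : 0 <= g < gamma0.
  by rewrite sqrtr_ge0/= -(ger0_norm (ltW g0)) -sqrtr_sqr ltr_sqrt// exprn_gt0.
have g2 : g ^+ 2 = X * (1 + c) ^+ 2 by rewrite sqr_sqrtr.
have me : measurable_fun setT (fun x : V => expR (g ^+ 2 * sqnorm2 (vec x))).
  by apply: measurable_expR_comp; apply: measurable_funM => //; exact: measurable_sqnorm2_vec.
have ie := itg_lty me (fun x => expR_ge0 _) (mom g gg).
pose A := t * (1 + c) * (T * (F2 * ((1 + c^-1) * sqnorm2 (- const_mx r : 'cV[R]_d)))).
apply: itg_le _ _ (itgZ (expR A) ie) => [|x].
  by apply: measurable_expm; exact: measurable_id.
rewrite ger0_norm ?expm_ge0// expmE -expRD ler_expR g2.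
have h1 : sqnorm2 (mpr r sigma x) <= F2 * ((1 + c) * sqnorm2 (vec x) +
    (1 + c^-1) * sqnorm2 (- const_mx r : 'cV[R]_d)).
  apply: le_trans (sqnorm2_mulmx _ _) _.
  by apply: (ler_wpM2l (ltW F0)); exact: sqnorm2D_le.
have tc : 0 <= t * (1 + c) * T by rewrite !mulr_ge0 ?addr_ge0// ltW.
apply: (@le_trans _ _ (t * (1 + c) * T * (F2 * ((1 + c) * sqnorm2 (vec x) +
    (1 + c^-1) * sqnorm2 (- const_mx r : 'cV[R]_d))))).
  by rewrite mulrA; apply: (ler_wpM2l tc).
by rewrite /A /X le_eqVlt; apply/orP; left; apply/eqP; ring.
Qed.

End Moments.

(** * Deterministic shifts and their transport cost *)

Lemma measurable_unvec {R : realType} {d : nat} (f : d.-tuple R -> 'cV[R]_d) :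
  (forall i, measurable_fun setT (fun x => f x i 0)) ->
  measurable_fun setT (fun x => unvec (f x)).
Proof.
move=> mf; apply/measurable_fun_tnthP => i.
by apply: (eq_measurable_fun (fun x => f x i 0)) (mf i) => x _ /=; rewrite tnth_mktuple.
Qed.

(** The law of (g x, x) under P is a coupling, and its cost bounds the infimum. *)
Lemma Dcost_pushforward {R : realType} {d : nat} (P Q : probability (d.-tuple R) R)
    (g : d.-tuple R -> d.-tuple R) (c : d.-tuple R -> d.-tuple R -> \bar R) :
  is_pushforward P Q g ->
  measurable_fun setT (fun z : d.-tuple R * d.-tuple R => c z.1 z.2) ->
  (forall x y, (0 <= c x y)%E) ->
  (Dcost c Q P <= \int[P]_x c (g x) x)%E.
Proof.
move=> [mg lawQ] mc c0.
have mG : measurable_fun setT (fun x => (g x, x)).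
  by apply: measurable_fun_pair => //; exact: measurable_id.
pose F : {mfun (d.-tuple R) >-> (d.-tuple R * d.-tuple R)%type} := mfun_Sub (mem_set mG).
pose pi : probability (d.-tuple R * d.-tuple R)%type R := distribution P F.
have lawpi A : measurable A -> pi A = P ((fun x => (g x, x)) @^-1` A) by [].
rewrite -(law_ge0_integral mG lawpi mc) => [|z]; last exact: c0.
apply: ereal_inf_lbound; exists pi => //; split => A mA.
- rewrite lawQ// lawpi; last exact: measurableX.
  by congr (P _); apply/seteqP; split => x //= [].
- rewrite lawpi; last exact: measurableX.
  by congr (P _); apply/seteqP; split => x //= [].
Qed.

(** * Rates in the fourth root of delta *)

Section FourthRoot.
Context {R : realType}.
Implicit Types (x : R) (f : R -> R).

Definition root4 x : R := Num.sqrt (Num.sqrt x).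

Lemma root4_gt0 x : 0 < x -> 0 < root4 x.
Proof. by move=> x0; rewrite !sqrtr_gt0. Qed.

Lemma root4_sqr x : root4 x ^+ 2 = Num.sqrt x.
Proof. by rewrite sqr_sqrtr ?sqrtr_ge0. Qed.

Lemma root4K x : 0 <= x -> root4 x ^+ 4 = x.
Proof. by move=> x0; rewrite (exprM _ 2 2) root4_sqr sqr_sqrtr. Qed.

Lemma cvg_root4 : root4 x @[x --> 0^'+] --> (0 : R).
Proof.
apply: cvg_at_right_filter.
have : root4 x @[x --> 0] --> root4 0.
  by apply: (@continuous_comp _ _ _ (@Num.sqrt R) (@Num.sqrt R)); exact: sqrt_continuous.
by rewrite /root4 !sqrtr0.
Qed.

Lemma root4_near (P : R -> Prop) : (\forall q \near (0 : R), P q) ->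
  \forall x \near 0^'+, P (root4 x).
Proof. by move=> nP; exact: (cvg_root4 nP). Qed.

Lemma near0_powM_le1 (k : R) n : \forall q \near (0 : R), k * q ^+ n.+1 <= 1.
Proof.
have c : (fun q : R => k * q ^+ n.+1) q @[q --> 0] --> k * 0 ^+ n.+1.
  by apply: cvgMl_tmp; exact: exprn_continuous.
have e0 : k * 0 ^+ n.+1 = 0 by rewrite expr0n mulr0.
by rewrite e0 in c; exact: (cvgr_le _ c _ ltr01).
Qed.

Lemma cvg_div_sqrt f k : (\forall x \near 0^'+, `|f x| <= k * root4 x ^+ 3) ->
  f x / Num.sqrt x @[x --> 0^'+] --> 0.
Proof.
move=> fk; apply: norm_cvg0.
have kc : k * root4 x @[x --> 0^'+] --> k * 0.
  by apply: cvgMl_tmp; exact: cvg_root4.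
rewrite mulr0 in kc.
apply: (squeeze_cvgr _ (cvg_cst (0 : R)) kc).
near=> x; have x0 : 0 < x by near: x; exact: nbhs_right_gt.
have sx : 0 < Num.sqrt x by rewrite sqrtr_gt0.
rewrite normr_ge0/= normrM normfV (gtr0_norm sx) ler_pdivrMr//.
rewrite -root4_sqr -mulrA -exprS.
by near: x.
Unshelve. all: by end_near. Qed.

End FourthRoot.

(** * Uniform first-order bound over the ambiguity ball *)

Section Robust.
Context {R : realType} {d : nat} (T r : R) (sigma : 'M[R]_d) (alpha tau : R).
Hypothesis T0 : 0 < T.
Hypothesis alpha1 : alpha < 1.
Hypothesis tau0 : 0 < tau.
Local Notation V := (d.-tuple R).
Local Notation expm := (expm T r sigma).
Local Notation expy := (expy T).
Local Notation avg := (avg T r sigma).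
Local Notation p := ((1 - alpha)^-1).
Local Notation beta := (alpha / (1 - alpha)).
Local Notation F2 := (sqfrob (invmx sigma)).
Hypothesis tauF : 4 * T * F2 <= tau.
Context (gam : probability V R).
Hypothesis gam_gy : forall k, k < 2^-1 -> itg gam (expy k).
Hypothesis gam_ge0 : forall g : V -> R, measurable_fun setT g ->
  (forall y, 0 <= g y) ->
  lebint (fun y => (g y * phiT T y)%:E) = (\int[gam]_y (g y)%:E)%E.
Hypothesis gam_bnd : forall (g : V -> R) k C, k < 2^-1 ->
  measurable_fun setT g -> (forall y, `|g y| <= C * expy k y) ->
  lebint (fun y => (g y * phiT T y)%:E) = (\int[gam]_y (g y)%:E)%E.
Context (P0 : probability V R) (t c C : R).
Hypothesis t8 : 8 <= t.
Hypothesis c0 : 0 < c.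
Hypothesis C0 : 0 < C.
Hypothesis iex : itg P0 (expm (t * (1 + c))).
Hypothesis HC : forall Q : probability V R, itg Q (expm t) ->
  \int[Q]_x expm t x <=
    \int[P0]_x expm (t * (1 + c)) x * expR (t * (1 + c^-1)) ->
  forall y, [/\ 0 < avg Q y, avg Q y <= C * expy 32^-1 y,
    (avg Q y)^-1 <= C * expy 32^-1 y & avg Q y `^ beta <= C * expy 8^-1 y].
Local Notation H := (Hfun alpha T r sigma P0).
Local Notation h := (fun x : V => H (vec x)).
Local Notation Hn := (HnormL2 alpha T r sigma P0).
Local Notation w := (fun y => avg P0 y `^ beta).
Local Notation J := (Jfun alpha T r sigma).
Local Notation D Q := (\int[gam]_y (w y * (avg Q y - avg P0 y))).
Local Notation J0 := (\int[gam]_y (avg P0 y `^ p)).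

Let Hn0 : 0 <= Hn. Proof. exact: Hn_ge0. Qed.

Let a0 y : 0 < avg P0 y.
Proof. by have [] := avg_P0_bounds T0 t8 c0 iex HC y. Qed.

Lemma itg_J0 : itg gam (fun y => avg P0 y `^ p).
Proof.
pose a (b : bool) := avg P0.
have ma b : measurable_fun setT (a b) by exact: measurable_avg.
exact: (itg_powR T0 alpha1 gam_gy C0 ma
  (fun b => avg_P0_bounds T0 t8 c0 iex HC) true).
Qed.

Lemma J_P0 : J P0 = J0%:E.
Proof. by rewrite (JfunE r sigma alpha T0 gam_ge0) Rint_fine//; exact: itg_J0. Qed.

Lemma ctau_ge0 (x y : V) : (0 <= ctau tau x y)%E.
Proof.
rewrite lee_fin subr_ge0 -expR0 ler_expR mulr_ge0 ?sqnorm2_ge0//.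
exact: ltW.
Qed.

Lemma Uset_bound : exists2 K, 0 <= K & forall q (Q : probability V R),
  0 < q <= 1 -> Uset tau (q ^+ 4) P0 Q ->
  itg gam (fun y => w y * (avg Q y - avg P0 y)) /\
  `|p * D Q| <= q ^+ 2 / Num.sqrt tau * Hn + K * q ^+ 3.
Proof.
pose K1 := p * (1000 * C * \int[gam]_y expy (7 / 16) y) * (\int[P0]_x expm 6 x + 1).
have g70 : 0 <= \int[gam]_y expy (7 / 16) y.
  by apply: Rintegral_ge0 => y _; exact: expy_ge0.
have E60 : 0 <= \int[P0]_x expm 6 x by apply: Rintegral_ge0 => x _; exact: expm_ge0.
have K10 : 0 <= K1 := mulr_ge0 (mulr_ge0 (ltW (onem_inv_gt0 alpha1))
  (mulr_ge0 (mulr_ge0 (ler0n R 1000) (ltW C0)) g70)) (addr_ge0 E60 ler01).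
have st0 : 0 < Num.sqrt tau by rewrite sqrtr_gt0.
exists (3 / Num.sqrt tau * Hn + 8 * K1).
  exact: (addr_ge0 (mulr_ge0 (divr_ge0 (ler0n R 3) (ltW st0)) Hn0)
    (mulr_ge0 (ler0n R 8) K10)).
move=> q Q /andP[q0 q1] UQ.
(* The infimum over couplings need not be attained, so a coupling of cost below q'^4 > q^4 is taken.
   The enlargement is harmless: q'^2 <= q^2 + 3 q^3 and q'^3 <= 8 q^3. *)
pose q' := q * (1 + q).
have q'0 : 0 < q' by rewrite mulr_gt0// addr_gt0.
have qq' : q ^+ 4 < q' ^+ 4.
  rewrite ltr_pXn2r// ?nnegrE ?(ltW q0) ?(ltW q'0)//.
  by rewrite /q' mulrDr mulr1 ltrDl mulr_gt0.
have : (Dcost (ctau tau) Q P0 < (q' ^+ 4)%:E)%E.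
  by apply: le_lt_trans UQ _; rewrite lte_fin.
move=> /ereal_inf_lt[_ [pi cpl <-]] /ltW cost.
split.
  exact: (coupling_itg T0 gam_gy t8 c0 iex HC cpl tau0 tauF cost).
have := coupling_bound T0 alpha1 gam_gy gam_bnd t8 c0 C0 iex HC q'0 cpl tau0 tauF cost.
rewrite -/K1 => hb; apply: le_trans hb _.
have -> : Num.sqrt (q' ^+ 4 / tau) = q' ^+ 2 / Num.sqrt tau.
  rewrite sqrtrM ?exprn_ge0 ?(ltW q'0)// sqrtrV ?(ltW tau0)//; congr (_ / _).
  by rewrite (_ : q' ^+ 4 = (q' ^+ 2) ^+ 2) ?sqrtr_sqr ?ger0_norm ?sqr_ge0// -exprM.
have q2 : q' ^+ 2 <= q ^+ 2 + 3 * q ^+ 3.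
  have e : q' ^+ 2 = q ^+ 2 + 2 * q ^+ 3 + q ^+ 3 * q by rewrite /q'; ring.
  have q3 : 0 <= q ^+ 3 by rewrite exprn_ge0// ltW.
  by rewrite e; have := ler_wpM2l q3 q1; lra.
have q3 : q' ^+ 3 <= 8 * q ^+ 3.
  have -> : 8 * q ^+ 3 = (2 * q) ^+ 3 by ring.
  rewrite ler_pXn2r// ?nnegrE ?(ltW q'0) ?mulr_ge0 ?(ltW q0)//.
  by rewrite /q' mulrC ler_pM2r//; lra.
have sH : 0 <= (Num.sqrt tau)^-1 * Hn by rewrite mulr_ge0// invr_ge0 ltW.
have h1 := ler_wpM2r sH q2; have h2 := ler_wpM2l K10 q3.
rewrite -(mulrA (q' ^+ 2)); apply: le_trans (lerD h1 h2) _.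
by rewrite le_eqVlt; apply/orP; left; apply/eqP; ring.
Qed.

(** * The truncated shift: feasibility and value *)

Section Push.
Variable sg : R.
Hypothesis sg2 : sg ^+ 2 = 1.

(** For [Hn] = 0 the inverse is 0 by convention and the shift vanishes, so the degenerate case needs
    no separate construction. *)
Definition pushM := (Num.sqrt tau)^-1 / Hn.
(** Chosen so that its square cancels exp(tau M^2 q^3), M = [pushM], exactly; this is the factor by
    which the exponential cost may exceed the quadratic one. *)
Definition pushTheta (q : R) := expR (- (tau * pushM ^+ 2 / 2 * q ^+ 3)).
(** The sign [sg] is -1 for the infimum and 1 for the supremum. Truncating at |H|^2 <= 1/q makes the
    squared shift at most M^2 q^3, uniformly in b. *)
Definition pushDelta (q : R) (b : 'cV[R]_d) : 'cV[R]_d :=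
  (sg * pushTheta q * (q ^+ 2 * pushM) *
    (if sqnorm2 (H b) <= q^-1 then 1 else 0)) *: H b.
Definition pushMap q (x : V) : V := unvec (vec x + pushDelta q (vec x)).

Let mh i : measurable_fun setT (fun x => h x i 0).
Proof. exact: (measurable_h T0 gam_gy gam_bnd t8 c0 iex HC). Qed.

Let mDelta q i : measurable_fun setT (fun x => pushDelta q (vec x) i 0).
Proof.
apply: (eq_measurable_fun (fun x => sg * pushTheta q * (q ^+ 2 * pushM) *
    (if sqnorm2 (h x) <= q^-1 then 1 else 0) * h x i 0)).
  by move=> x _; rewrite [in RHS]mxE.
apply: measurable_funM => //; apply: measurable_funM => //.
apply: measurable_fun_ifT => //.
by apply: measurable_fun_ler => //; exact: measurable_sqnorm2.
Qed.

Lemma measurable_pushMap q : measurable_fun setT (pushMap q).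
Proof.
apply: measurable_unvec => i.
apply: (eq_measurable_fun (fun x => vec x i 0 + pushDelta q (vec x) i 0)).
  by move=> x _; rewrite [in RHS]mxE.
by apply: measurable_funD => //; exact: measurable_vec.
Qed.

Definition pushQ q : probability V R :=
  distribution P0 (mfun_Sub (mem_set (measurable_pushMap q)) : {mfun V >-> V}).

Lemma pushQ_law q : is_pushforward P0 (pushQ q) (pushMap q).
Proof. by split; [exact: measurable_pushMap|]. Qed.

Let half0 : 0 <= 2^-1 :> R. Proof. by rewrite invr_ge0. Qed.

Let theta01 q : 0 < q -> 0 < pushTheta q <= 1.
Proof.
move=> q0; rewrite expR_gt0/= -expR0 ler_expR oppr_le0.
have := exprn_gt0 3 q0 => q3.
exact: (mulr_ge0 (mulr_ge0 (mulr_ge0 (ltW tau0) (sqr_ge0 _)) half0) (ltW q3)).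
Qed.

Let sqDelta q b : 0 < q ->
  sqnorm2 (pushDelta q b) = pushTheta q ^+ 2 * (q ^+ 4 * pushM ^+ 2) *
    (if sqnorm2 (H b) <= q^-1 then sqnorm2 (H b) else 0).
Proof.
move=> q0; rewrite sqnorm2Z; case: ifP => _; last by rewrite mulr0 expr0n !mul0r mulr0.
rewrite mulr1; transitivity (sg ^+ 2 * (pushTheta q ^+ 2 * (q ^+ 4 * pushM ^+ 2)) * sqnorm2 (H b)).
  by ring.
by rewrite sg2 mul1r.
Qed.

Let sqDelta_le q b : 0 < q -> sqnorm2 (pushDelta q b) <= pushM ^+ 2 * q ^+ 3.
Proof.
move=> q0; rewrite sqDelta//.
have /andP[h0 h1] := theta01 q0.
have q4 : 0 <= q ^+ 4 * pushM ^+ 2 by rewrite mulr_ge0 ?sqr_ge0// exprn_ge0// ltW.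
have th2 : pushTheta q ^+ 2 <= 1 by rewrite -(expr1n _ 2) ler_pXn2r ?nnegrE// ltW.
have th0 := sqr_ge0 (pushTheta q).
have i0 : 0 <= (if sqnorm2 (H b) <= q^-1 then sqnorm2 (H b) else 0) <= q^-1.
  case: ifP => [->|_]; first by rewrite sqnorm2_ge0.
  by rewrite lexx invr_ge0 ltW.
have /andP[i1 i2] := i0.
apply: (@le_trans _ _ (1 * (q ^+ 4 * pushM ^+ 2) * q^-1)).
  by apply: ler_pM => //; [exact: mulr_ge0|exact: (ler_wpM2r q4 th2)].
rewrite le_eqVlt; apply/orP; left; apply/eqP; field.
by rewrite gt_eqF.
Qed.

(** Equality unless [Hn] = 0, where the left side is 0. *)
Let m2Hn : pushM ^+ 2 * Hn ^+ 2 <= tau^-1.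
Proof.
rewrite -exprMn /pushM -mulrA exprMn exprVn sqr_sqrtr ?(ltW tau0)//.
rewrite -[leRHS]mulr1; apply: ler_wpM2l; first by rewrite invr_ge0 ltW.
have [->|hn] := eqVneq Hn 0; first by rewrite mulr0 expr0n.
by rewrite mulVf// expr1n.
Qed.

Let ind_le q x : (if sqnorm2 (h x) <= q^-1 then sqnorm2 (h x) else 0) <= sqnorm2 (h x).
Proof. by case: ifP => // _; exact: sqnorm2_ge0. Qed.

Let ind_ge0 q x : 0 <= (if sqnorm2 (h x) <= q^-1 then sqnorm2 (h x) else 0).
Proof. by case: ifP => // _; exact: sqnorm2_ge0. Qed.

Let isqh : itg P0 (fun x => sqnorm2 (h x)).
Proof. exact: (itg_sqnorm2_h T0 gam_gy gam_bnd t8 c0 iex HC). Qed.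

Let isqh2 : itg P0 (fun x => sqnorm2 (h x) ^+ 2).
Proof. exact: (itg_sqnorm2_h_sqr T0 gam_gy gam_bnd t8 c0 iex HC). Qed.

Let iind q : itg P0 (fun x => if sqnorm2 (h x) <= q^-1 then sqnorm2 (h x) else 0).
Proof.
apply: itg_le _ _ isqh => [|x]; last by rewrite ger0_norm.
have ms : measurable_fun setT (fun x => sqnorm2 (h x)) by exact: measurable_sqnorm2.
by apply: measurable_fun_ifT => //; exact: measurable_fun_ler.
Qed.

(** e^s - 1 <= s e^s and e^s <= exp(tau M^2 q^3); theta^2 cancels the exponential, and what remains
    is tau q^4 M^2 E|H|^2 <= q^4. *)
Lemma pushQ_Uset q : 0 < q -> Uset tau (q ^+ 4) P0 (pushQ q).
Proof.
move=> q0; rewrite /Uset /=.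
have mctau : measurable_fun setT (fun z : V * V => ctau tau z.1 z.2 : \bar R).
  apply/measurable_EFinP; apply: measurable_funB => //; apply: measurable_expR_comp.
  apply: measurable_funM => //; apply: measurable_sqnorm2 => i.
  apply: (eq_measurable_fun (fun z : V * V => vec z.1 i 0 - vec z.2 i 0)).
    by move=> z _; rewrite !mxE.
  by apply: measurable_funB; exact: measurable_vec_comp.
apply: le_trans (Dcost_pushforward (pushQ_law q) mctau ctau_ge0) _.
pose E := tau * pushTheta q ^+ 2 * (q ^+ 4 * pushM ^+ 2) * expR (tau * (pushM ^+ 2 * q ^+ 3)).
pose ub x := E * (if sqnorm2 (h x) <= q^-1 then sqnorm2 (h x) else 0).
have iub : itg P0 ub by exact: itgZ.
have c_le x : expR (tau * sqnorm2 (vec (pushMap q x) - vec x)) - 1 <= ub x.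
  have -> : vec (pushMap q x) - vec x = pushDelta q (vec x).
    by apply/colP => i; rewrite !mxE tnth_mktuple !mxE addrAC subrr add0r.
  apply: le_trans (expR_subr1_le _) _.
  have s0 : 0 <= tau * sqnorm2 (pushDelta q (vec x)).
    by apply: mulr_ge0; [exact: ltW|exact: sqnorm2_ge0].
  apply: le_trans (_ : tau * sqnorm2 (pushDelta q (vec x)) *
      expR (tau * (pushM ^+ 2 * q ^+ 3)) <= _).
    apply: (ler_wpM2l s0); rewrite ler_expR; apply: (ler_wpM2l (ltW tau0)).
    exact: sqDelta_le.
  by rewrite sqDelta// /ub /E le_eqVlt; apply/orP; left; apply/eqP; ring.
have mp : measurable_fun setT (fun x => (pushMap q x, x)).
  by apply: measurable_fun_pair; [exact: measurable_pushMap|exact: measurable_id].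
have mcx : measurable_fun setT (fun x => ctau tau (pushMap q x) x : \bar R).
  exact: (measurableT_comp mctau mp).
apply: (@le_trans _ _ (\int[P0]_x (ub x)%:E)%E).
  apply: ge0_le_integral => //.
  - by move=> x _; exact: ctau_ge0.
  - exact: measurable_int iub.
  - by move=> x _; rewrite lee_fin; exact: c_le.
rewrite Rint_fine// lee_fin RintZ//.
have th : pushTheta q ^+ 2 * expR (tau * (pushM ^+ 2 * q ^+ 3)) = 1.
  rewrite /pushTheta -expRM_natl -expRD -[RHS]expR0; congr expR.
  by lra.
have -> : E = tau * (q ^+ 4 * pushM ^+ 2).
  rewrite /E -[RHS]mulr1 -th; ring.
have E0 : 0 <= tau * (q ^+ 4 * pushM ^+ 2).
  have q4 : 0 <= q ^+ 4 by rewrite exprn_ge0// ltW.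
  exact: (mulr_ge0 (ltW tau0) (mulr_ge0 q4 (sqr_ge0 _))).
apply: le_trans (ler_wpM2l E0 (le_Rint (iind q) isqh (ind_le q))) _.
rewrite -Hn_sqr -mulrA -(mulrA (q ^+ 4)).
have q4 : 0 <= q ^+ 4 by rewrite exprn_ge0// ltW.
have := ler_wpM2l (ltW tau0) (ler_wpM2l q4 m2Hn); move=> hh; apply: le_trans hh _.
by rewrite mulrCA mulfV ?mulr1// gt_eqF.
Qed.

(** Three errors of order q^3: the expansion, with e of order q^3; the truncation, which loses at
    most q E|H|^4 and is multiplied by q^2; and 1 - theta, itself O(q^3). *)
Lemma push_error : exists2 K, 0 <= K & forall q, 0 < q <= 1 ->
  T * F2 * pushM ^+ 2 * q ^+ 3 <= 1 ->
  J (pushQ q) \is a fin_num /\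
  `|fine (J (pushQ q)) - (J0 + sg * (q ^+ 2 / Num.sqrt tau * Hn))| <= K * q ^+ 3.
Proof.
have [K2 K20 HK2] := push_expansion T0 alpha1 gam_gy gam_bnd t8 c0 C0 iex HC.
pose E4 := \int[P0]_x (sqnorm2 (h x) ^+ 2).
have E40 : 0 <= E4 by apply: Rintegral_ge0 => x _; exact: sqr_ge0.
have st0 : 0 < Num.sqrt tau by rewrite sqrtr_gt0.
have m0 : 0 <= pushM by rewrite mulr_ge0// ?invr_ge0// ltW.
have mHn : pushM * Hn ^+ 2 = (Num.sqrt tau)^-1 * Hn.
  rewrite /pushM -mulrA; congr (_ * _).
  by have [->|hn] := eqVneq Hn 0; [rewrite expr0n mulr0|rewrite expr2 mulrA mulVf ?mul1r].
pose K3 := pushM * E4 + pushM * Hn ^+ 2 * (tau * pushM ^+ 2 / 2).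
have K30 : 0 <= K3.
  apply: addr_ge0; first exact: mulr_ge0.
  exact: (mulr_ge0 (mulr_ge0 m0 (sqr_ge0 _)) (mulr_ge0 (mulr_ge0 (ltW tau0) (sqr_ge0 _))
    half0)).
have TF : 0 <= T * F2 * pushM ^+ 2.
  exact: (mulr_ge0 (mulr_ge0 (ltW T0) (sqfrob_ge0 _)) (sqr_ge0 _)).
exists (K2 * (T * F2 * pushM ^+ 2) + K3); first by rewrite addr_ge0// mulr_ge0.
move=> q /andP[q0 q1] e1.
have q20 : 0 <= q ^+ 2 := sqr_ge0 q.
have q30 : 0 <= q ^+ 3 by rewrite exprn_ge0// ltW.
have De x : T * F2 * sqnorm2 (pushDelta q (vec x)) <= T * F2 * pushM ^+ 2 * q ^+ 3.
  rewrite -(mulrA _ (pushM ^+ 2)); apply: ler_wpM2l; last exact: sqDelta_le.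
  exact: (mulr_ge0 (ltW T0) (sqfrob_ge0 _)).
have [iJ hJ] := HK2 _ _ _ (mDelta q) (measurable_pushMap q) (pushQ_law q).2 e1 De.
have JE : J (pushQ q) = (\int[gam]_y (avg (pushQ q) y `^ p))%:E.
  by rewrite (JfunE r sigma alpha T0 gam_ge0) Rint_fine.
rewrite JE; split => //=.
set JQ := \int[gam]_y (avg (pushQ q) y `^ p) in hJ *.
set j0 := J0 in hJ *.
pose ind x := if sqnorm2 (h x) <= q^-1 then sqnorm2 (h x) else 0.
set E1 := \int[P0]_x ind x.
have dE : \int[P0]_x dotv (h x) (pushDelta q (vec x)) =
    sg * pushTheta q * (q ^+ 2 * pushM) * E1.
  rewrite -RintZ; last exact: iind.
  apply: eq_Rintegral => x _; rewrite dotvZr dotvv /ind -mulrA; congr (_ * _).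
  by case: ifP; rewrite ?mul1r ?mul0r.
rewrite dE in hJ.
have E1_le : E1 <= Hn ^+ 2 by rewrite Hn_sqr; apply: le_Rint; [exact: iind|exact: isqh|exact: ind_le].
(* Off the truncation set q |H|^2 > 1, hence |H|^2 <= q |H|^4. *)
have E1_ge : Hn ^+ 2 - q * E4 <= E1.
  rewrite Hn_sqr -RintZ// -RintB//; last exact: itgZ.
  apply: le_Rint; [by apply: itgB => //; exact: itgZ|exact: iind|].
  move=> x; rewrite /ind; have s0 := sqnorm2_ge0 (h x); case: ifP => [_|/negbT].
    by rewrite gerBl mulr_ge0 ?sqr_ge0// ltW.
  rewrite -ltNge => /ltW; rewrite -(ler_pM2l q0) mulfV ?gt_eqF// => qs.
  by rewrite subr_le0 expr2 mulrA ler_peMl.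
have E10 : 0 <= E1 by apply: Rintegral_ge0 => x _; exact: ind_ge0.
have /andP[/ltW th0 th1] := theta01 q0.
have th : 1 - pushTheta q <= tau * pushM ^+ 2 / 2 * q ^+ 3.
  by rewrite /pushTheta; have := expR_ge1Dx (- (tau * pushM ^+ 2 / 2 * q ^+ 3)); lra.
set ka := tau * pushM ^+ 2 / 2 in th *.
have ka0 : 0 <= ka.
  exact: (mulr_ge0 (mulr_ge0 (ltW tau0) (sqr_ge0 _)) half0).
have sgn : `|sg| = 1.
  by apply/eqP; rewrite -(@eqrXn2 _ 2)// real_normK ?num_real// sg2 expr1n.
have gap0 : 0 <= Hn ^+ 2 - pushTheta q * E1.
  by rewrite subr_ge0; apply: le_trans E1_le; rewrite ler_piMl.
have gap : Hn ^+ 2 - pushTheta q * E1 <= q * E4 + ka * q ^+ 3 * Hn ^+ 2.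
  have := ler_pM (_ : 0 <= 1 - pushTheta q) E10 th E1_le.
  by rewrite subr_ge0 => /(_ th1); lra.
have mid : `|sg * pushTheta q * (q ^+ 2 * pushM) * E1 -
    sg * (q ^+ 2 / Num.sqrt tau * Hn)| <= K3 * q ^+ 3.
  have -> : sg * pushTheta q * (q ^+ 2 * pushM) * E1 - sg * (q ^+ 2 / Num.sqrt tau * Hn) =
      - (sg * (q ^+ 2 * pushM * (Hn ^+ 2 - pushTheta q * E1))).
    rewrite -(mulrA (q ^+ 2)) -mHn; ring.
  rewrite normrN normrM sgn mul1r ger0_norm; last exact: (mulr_ge0 (mulr_ge0 q20 m0) gap0).
  apply: le_trans (ler_wpM2l (mulr_ge0 q20 m0) gap) _.
  have -> : q ^+ 2 * pushM * (q * E4 + ka * q ^+ 3 * Hn ^+ 2) =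
      pushM * E4 * q ^+ 3 + q ^+ 2 * (pushM * Hn ^+ 2 * ka * q ^+ 3) by ring.
  rewrite /K3 -/ka [leRHS]mulrDl lerD2l; apply: ler_piMl.
    exact: (mulr_ge0 (mulr_ge0 (mulr_ge0 m0 (sqr_ge0 _)) ka0) q30).
  by rewrite expr_le1// ltW.
move: hJ mid; set A := sg * pushTheta q * _ * _; set B := sg * (_ / _ * _).
move=> hJ mid.
have -> : JQ - (j0 + B) = (JQ - j0 - A) + (A - B) by rewrite addrA subrK opprD addrA.
apply: le_trans (ler_normD _ _) _; rewrite mulrDl; apply: lerD => //.
by rewrite -mulrA.
Qed.

Local Notation q_ := root4.

Lemma sqrt_div_tau x : 0 <= x ->
  Num.sqrt (x / tau) = q_ x ^+ 2 / Num.sqrt tau.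
Proof. by move=> x0; rewrite sqrtrM// sqrtrV ?(ltW tau0)// root4_sqr. Qed.

(** For fixed b the truncation is inactive once q |H(b)|^2 <= 1, and the quotient is then a constant
    multiple of (theta - 1) H(b). The convergence is pointwise in b. *)
Lemma cvg_pushDelta (b : 'cV[R]_d) :
  (Num.sqrt delta)^-1 *: (pushDelta (q_ delta) b -
     (sg * (Num.sqrt (delta / tau) / Hn)) *: H b)
  @[delta --> 0^'+] --> (0 : 'cV[R]_d).
Proof.
pose k := sg * pushM.
have c1 : - (tau * pushM ^+ 2 / 2 * q ^+ 3) @[q --> 0] -->
    - (tau * pushM ^+ 2 / 2 * 0 ^+ 3).
  by apply: cvgN; apply: cvgMl_tmp; exact: exprn_continuous.
have cT : pushTheta q @[q --> 0] --> pushTheta 0.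
  by rewrite /pushTheta; apply: (cvg_comp _ _ c1); exact: continuous_expR.
have T1 : pushTheta 0 = 1 by rewrite /pushTheta expr0n mulr0 oppr0 expR0.
rewrite T1 in cT.
have cq : pushTheta (q_ x) @[x --> 0^'+] --> (1 : R).
  exact: (cvg_comp _ _ (@cvg_root4 R) cT).
have ck : k * (pushTheta (q_ x) - 1) @[x --> 0^'+] --> k * (1 - 1).
  by apply: cvgMl_tmp; apply: cvgB => //; exact: cvg_cst.
rewrite subrr mulr0 in ck.
have : (k * (pushTheta (q_ x) - 1)) *: H b @[x --> 0^'+] --> (0 : R) *: H b.
  exact: cvgZr_tmp.
rewrite scale0r; apply: cvg_trans; apply: near_eq_cvg.
near=> x; have x0 : 0 < x by near: x; exact: nbhs_right_gt.
have q0 : 0 < q_ x := root4_gt0 x0.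
have qb : sqnorm2 (H b) * q_ x ^+ 1 <= 1.
  by near: x; apply: (root4_near (near0_powM_le1 (sqnorm2 (H b)) 0)).
rewrite /pushDelta -[_ <= _^-1](ler_pM2r q0) mulVf ?gt_eqF// qb mulr1.
rewrite -scalerBl scalerA; congr (_ *: _).
rewrite sqrt_div_tau ?(ltW x0)// -root4_sqr /k /pushM.
have q2 : q_ x ^+ 2 != 0 by rewrite expf_neq0// gt_eqF.
rewrite (_ : sg * pushTheta (q_ x) * (q_ x ^+ 2 * ((Num.sqrt tau)^-1 / Hn)) -
    sg * (q_ x ^+ 2 / Num.sqrt tau / Hn) =
  q_ x ^+ 2 * (sg * ((Num.sqrt tau)^-1 / Hn) * (pushTheta (q_ x) - 1))); last by ring.
by rewrite mulKf.
Unshelve. all: by end_near. Qed.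

End Push.

(** * Expansions of the robust infimum and supremum *)

Local Notation q_ := root4.
Local Notation U := (fun delta : R => Uset tau delta P0).
Local Notation shift := (fun (Delta : 'cV[R]_d -> 'cV[R]_d) (x : V) =>
  unvec (vec x + Delta (vec x))).

Let p0 : 0 < p. Proof. exact: onem_inv_gt0. Qed.

Lemma near_root4_le1 : \forall x \near (0 : R)^'+, 0 < q_ x <= 1.
Proof.
near=> x; rewrite root4_gt0/=; last by near: x; exact: nbhs_right_gt.
have : 1 * q_ x ^+ 1 <= 1 by near: x; exact: (root4_near (near0_powM_le1 1 0)).
by rewrite mul1r.
Unshelve. all: by end_near. Qed.

(** Here p >= 1, so tangents bound J from below, and everything follows from the sandwich S - K1 q^3
    <= inf J <= J(Qd) <= S + K2 q^3, where S is the claimed expansion; q^3 is o(sqrt delta). *)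
Lemma robust_inf : 0 < alpha ->
  J P0 \is a fin_num /\
  (\forall delta \near 0^'+, ereal_inf (J @` U delta) \is a fin_num) /\
  ((fine (ereal_inf (J @` U delta)) -
      (fine (J P0) - Num.sqrt (delta / tau) * Hn)) / Num.sqrt delta
      @[delta --> 0^'+] --> 0) /\
  (exists (Delta : R -> 'cV[R]_d -> 'cV[R]_d)
          (Qd : R -> probability V R),
      (\forall delta \near 0^'+,
          is_pushforward P0 (Qd delta) (shift (Delta delta)) /\
          U delta (Qd delta) /\ J (Qd delta) \is a fin_num) /\
      ((fine (J (Qd delta)) - fine (ereal_inf (J @` U delta))) / Num.sqrt delta
         @[delta --> 0^'+] --> 0) /\
      (forall b : 'cV[R]_d,
         (Num.sqrt delta)^-1 *:
           (Delta delta b - (- (Num.sqrt (delta / tau) / Hn)) *: H b)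
         @[delta --> 0^'+] --> (0 : 'cV[R]_d))).
Proof.
move=> al0.
have p1 : 1 <= p by rewrite invf_ge1 ?subr_gt0// gerBl ltW.
have sg2 : (-1) ^+ 2 = 1 :> R by rewrite sqrrN expr1n.
have [K1 K10 HU] := Uset_bound.
have [K2 K20 HP] := push_error sg2.
pose q x := q_ x; pose Qd x := pushQ (-1) (q_ x).
pose I x := ereal_inf (J @` U x).
pose S x := J0 - Num.sqrt (x / tau) * Hn.
pose good x := [/\ I x \is a fin_num, J (Qd x) \is a fin_num & U x (Qd x)] /\
  [/\ S x - K1 * q_ x ^+ 3 <= fine (I x), fine (I x) <= fine (J (Qd x)) &
    fine (J (Qd x)) <= S x + K2 * q_ x ^+ 3].
have main : \forall x \near 0^'+, good x.
  near=> x; have x0 : 0 < x by near: x; exact: nbhs_right_gt.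
  have /andP[q0 q1] : 0 < q_ x <= 1 by near: x; exact: near_root4_le1.
  have e1 : T * F2 * pushM ^+ 2 * q_ x ^+ 3 <= 1.
    by near: x; exact: (root4_near (near0_powM_le1 _ 2)).
  have q01 : 0 < q_ x <= 1 by rewrite q0.
  have [fJ eJ] := HP _ q01 e1.
  have UQ : U x (Qd x) by have := pushQ_Uset sg2 q0; rewrite root4K// ltW.
  have SE : S x = J0 - q_ x ^+ 2 / Num.sqrt tau * Hn by rewrite /S sqrt_div_tau// ltW.
  have lowI : ((S x - K1 * q_ x ^+ 3)%:E <= I x)%E.
    apply: le_ereal_inf_tmp => _ [Q UxQ <-].
    have UQ' : Uset tau (q_ x ^+ 4) P0 Q by rewrite root4K// ltW.
    have [iD bD] := HU _ _ q01 UQ'.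
    apply: le_trans (Jfun_ge T0 alpha1 gam_ge0 a0 itg_J0 iD p1).
    rewrite lee_fin SE; move: bD; rewrite ler_norml => /andP[bD _].
    by rewrite -addrA lerD2l -opprD.
  have IQ : (I x <= J (Qd x))%E by apply: ereal_inf_lbound; exists (Qd x).
  have fI : I x \is a fin_num.
    rewrite fin_numE; apply/andP; split.
      by rewrite gt_eqF//; apply: lt_le_trans lowI; exact: ltNyr.
    rewrite lt_eqF//; apply: le_lt_trans IQ _.
    by rewrite -(fineK fJ) ltry.
  split; split => //.
  - by rewrite -lee_fin fineK.
  - by rewrite fine_le.
  - rewrite SE; move: eJ; rewrite ler_norml mulN1r => /andP[_].
    by rewrite lerBlDl.
have fJ0 : fine (J P0) = J0 by rewrite J_P0.
split; first by rewrite J_P0.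
split; first by near=> x; have [[]] : good x by near: x.
split.
  apply: (@cvg_div_sqrt _ _ (K1 + K2)); near=> x.
  have [_ [h1 h2 h3]] : good x by near: x.
  rewrite fJ0 -/(I x) -/(S x).
  have /andP[q0 q1] : 0 < q_ x <= 1 by near: x; exact: near_root4_le1.
  have q3 : 0 <= q_ x ^+ 3 by rewrite exprn_ge0// ltW.
  have := mulr_ge0 K10 q3; have := mulr_ge0 K20 q3; move: h1 h2 h3.
  rewrite mulrDl; move: (fine (I x)) (fine (J _)) (S x) (K1 * _) (K2 * _).
  move=> a b e f g h1 h2 h3 h4 h5.
  by rewrite ler_norml; apply/andP; split; lra.
exists (fun x => pushDelta (-1) (q_ x)), Qd; split; last split.
- near=> x.
  have [[_ h1 h2] _] : good x by near: x.
  by split => //; exact: pushQ_law.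
- apply: (@cvg_div_sqrt _ _ (K1 + K2)); near=> x.
  have [_ [h1 h2 h3]] : good x by near: x.
  rewrite -/(I x); rewrite ger0_norm ?subr_ge0//.
  move: h1 h2 h3; rewrite mulrDl.
  move: (fine (I x)) (fine (J _)) (S x) (K1 * _) (K2 * _).
  by move=> a b e f g h1 h2 h3; lra.
- by move=> b; have := @cvg_pushDelta (-1) b; under eq_fun do rewrite mulN1r.
Unshelve. all: by end_near. Qed.

(** Now p <= 1: tangents bound J from above, the shift follows +H, and the sandwich is S - K2 q^3 <=
    J(Qd) <= sup J <= S + K1 q^3. *)
Lemma robust_sup : alpha < 0 ->
  J P0 \is a fin_num /\
  (\forall delta \near 0^'+, ereal_sup (J @` U delta) \is a fin_num) /\
  ((fine (ereal_sup (J @` U delta)) -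
      (fine (J P0) + Num.sqrt (delta / tau) * Hn)) / Num.sqrt delta
      @[delta --> 0^'+] --> 0) /\
  (exists (Delta : R -> 'cV[R]_d -> 'cV[R]_d)
          (Qd : R -> probability V R),
      (\forall delta \near 0^'+,
          is_pushforward P0 (Qd delta) (shift (Delta delta)) /\
          U delta (Qd delta) /\ J (Qd delta) \is a fin_num) /\
      ((fine (ereal_sup (J @` U delta)) - fine (J (Qd delta))) / Num.sqrt delta
         @[delta --> 0^'+] --> 0) /\
      (forall b : 'cV[R]_d,
         (Num.sqrt delta)^-1 *:
           (Delta delta b - (Num.sqrt (delta / tau) / Hn) *: H b)
         @[delta --> 0^'+] --> (0 : 'cV[R]_d))).
Proof.
move=> al0.
have p1 : p <= 1 by rewrite invf_le1 ?subr_gt0// lerDl oppr_ge0 ltW.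
have sg2 : 1 ^+ 2 = 1 :> R by rewrite expr1n.
have [K1 K10 HU] := Uset_bound.
have [K2 K20 HP] := push_error sg2.
pose q x := q_ x; pose Qd x := pushQ 1 (q_ x).
pose I x := ereal_sup (J @` U x).
pose S x := J0 + Num.sqrt (x / tau) * Hn.
pose good x := [/\ I x \is a fin_num, J (Qd x) \is a fin_num & U x (Qd x)] /\
  [/\ fine (I x) <= S x + K1 * q_ x ^+ 3, fine (J (Qd x)) <= fine (I x) &
    S x - K2 * q_ x ^+ 3 <= fine (J (Qd x))].
have main : \forall x \near 0^'+, good x.
  near=> x; have x0 : 0 < x by near: x; exact: nbhs_right_gt.
  have /andP[q0 q1] : 0 < q_ x <= 1 by near: x; exact: near_root4_le1.
  have e1 : T * F2 * pushM ^+ 2 * q_ x ^+ 3 <= 1.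
    by near: x; exact: (root4_near (near0_powM_le1 _ 2)).
  have q01 : 0 < q_ x <= 1 by rewrite q0.
  have [fJ eJ] := HP _ q01 e1.
  have UQ : U x (Qd x) by have := pushQ_Uset sg2 q0; rewrite root4K// ltW.
  have SE : S x = J0 + q_ x ^+ 2 / Num.sqrt tau * Hn by rewrite /S sqrt_div_tau// ltW.
  have upI : (I x <= (S x + K1 * q_ x ^+ 3)%:E)%E.
    apply: ge_ereal_sup => _ [Q UxQ <-].
    have UQ' : Uset tau (q_ x ^+ 4) P0 Q by rewrite root4K// ltW.
    have [iD bD] := HU _ _ q01 UQ'.
    apply: le_trans (Jfun_le T0 alpha1 gam_ge0 a0 itg_J0 iD p1) _.
    rewrite lee_fin SE; move: bD; rewrite ler_norml => /andP[_ bD].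
    by rewrite -addrA lerD2l.
  have IQ : (J (Qd x) <= I x)%E by apply: ereal_sup_ubound; exists (Qd x).
  have fI : I x \is a fin_num.
    rewrite fin_numE; apply/andP; split.
      by rewrite gt_eqF//; apply: lt_le_trans IQ; rewrite -(fineK fJ) ltNyr.
    by rewrite lt_eqF//; apply: le_lt_trans upI _; exact: ltry.
  split; split => //.
  - by rewrite -lee_fin fineK.
  - by rewrite fine_le.
  - rewrite SE; move: eJ; rewrite ler_norml mul1r => /andP[eJ _].
    by move: eJ; rewrite lerBrDr addrC.
have fJ0 : fine (J P0) = J0 by rewrite J_P0.
split; first by rewrite J_P0.
split; first by near=> x; have [[]] : good x by near: x.
split.
  apply: (@cvg_div_sqrt _ _ (K1 + K2)); near=> x.
  have [_ [h1 h2 h3]] : good x by near: x.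
  rewrite fJ0 -/(I x) -/(S x).
  have /andP[q0 q1] : 0 < q_ x <= 1 by near: x; exact: near_root4_le1.
  have q3 : 0 <= q_ x ^+ 3 by rewrite exprn_ge0// ltW.
  have := mulr_ge0 K10 q3; have := mulr_ge0 K20 q3; move: h1 h2 h3.
  rewrite mulrDl; move: (fine (I x)) (fine (J _)) (S x) (K1 * _) (K2 * _).
  move=> a b e f g h1 h2 h3 h4 h5.
  by rewrite ler_norml; apply/andP; split; lra.
exists (fun x => pushDelta 1 (q_ x)), Qd; split; last split.
- near=> x.
  have [[_ h1 h2] _] : good x by near: x.
  by split => //; exact: pushQ_law.
- apply: (@cvg_div_sqrt _ _ (K1 + K2)); near=> x.
  have [_ [h1 h2 h3]] : good x by near: x.
  rewrite -/(I x); rewrite ger0_norm ?subr_ge0//.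
  move: h1 h2 h3; rewrite mulrDl.
  move: (fine (I x)) (fine (J _)) (S x) (K1 * _) (K2 * _).
  by move=> a b e f g h1 h2 h3; lra.
- by move=> b; have := @cvg_pushDelta 1 b; under eq_fun do rewrite mul1r.
Unshelve. all: by end_near. Qed.

End Robust.

(** * Choice of the moment order from the constants of the statement *)

Theorem theorem5 (R : realType) (d : nat) (T r : R) (sigma : 'M[R]_d)
    (alpha tau gamma0 : R) (P0 : probability (d.-tuple R) R) :
  (1 <= d)%N -> 0 < T -> 0 < r -> sigma \in unitmx ->
  alpha < 1 -> alpha != 0 ->
  let beta := alpha / (1 - alpha) in
  let F2 := sqfrob (invmx sigma) in
  Num.max (4 * T * F2) (2 * T * (4 * beta ^+ 2 - 2 * beta) * F2) < tau ->
  0 < gamma0 ->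
  (forall gamma : R, 0 <= gamma < gamma0 ->
     (\int[P0]_x (expR (gamma ^+ 2 * sqnorm2 (vec x)))%:E < +oo)%E) ->
  T * Num.max
        (2^-1 * (beta ^+ 2 - beta + 2 +
           Num.sqrt ((beta ^+ 2 - beta + 2) ^+ 2 + 8 * (beta ^+ 2 + beta))))
        (Num.max 8
           (tau * (2 * T * (4 * beta ^+ 2 - 2 * beta)) /
            (tau - 2 * T * (4 * beta ^+ 2 - 2 * beta) * F2)))
    < gamma0 ^+ 2 / F2 ->
  let J := Jfun alpha T r sigma in
  let H := Hfun alpha T r sigma P0 in
  let Hn := HnormL2 alpha T r sigma P0 in
  let U := fun delta : R => Uset tau delta P0 in
  let shift := fun (Delta : 'cV[R]_d -> 'cV[R]_d) (x : d.-tuple R) =>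
                 unvec (vec x + Delta (vec x)) in
  (* case alpha in (0,1): infimum *)
  (0 < alpha ->
     J P0 \is a fin_num /\
     (\forall delta \near 0^'+, ereal_inf (J @` U delta) \is a fin_num) /\
     ((fine (ereal_inf (J @` U delta)) -
        (fine (J P0) - Num.sqrt (delta / tau) * Hn)) / Num.sqrt delta
        @[delta --> 0^'+] --> 0) /\
     (exists (Delta : R -> 'cV[R]_d -> 'cV[R]_d)
             (Qd : R -> probability (d.-tuple R) R),
        (\forall delta \near 0^'+,
            is_pushforward P0 (Qd delta) (shift (Delta delta)) /\
            U delta (Qd delta) /\ J (Qd delta) \is a fin_num) /\
        ((fine (J (Qd delta)) - fine (ereal_inf (J @` U delta))) / Num.sqrt delta
           @[delta --> 0^'+] --> 0) /\
        (forall b : 'cV[R]_d,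
           (Num.sqrt delta)^-1 *:
             (Delta delta b - (- (Num.sqrt (delta / tau) / Hn)) *: H b)
           @[delta --> 0^'+] --> (0 : 'cV[R]_d)))) /\
  (* case alpha < 0: supremum *)
  (alpha < 0 ->
     J P0 \is a fin_num /\
     (\forall delta \near 0^'+, ereal_sup (J @` U delta) \is a fin_num) /\
     ((fine (ereal_sup (J @` U delta)) -
        (fine (J P0) + Num.sqrt (delta / tau) * Hn)) / Num.sqrt delta
        @[delta --> 0^'+] --> 0) /\
     (exists (Delta : R -> 'cV[R]_d -> 'cV[R]_d)
             (Qd : R -> probability (d.-tuple R) R),
        (\forall delta \near 0^'+,
            is_pushforward P0 (Qd delta) (shift (Delta delta)) /\
            U delta (Qd delta) /\ J (Qd delta) \is a fin_num) /\
        ((fine (ereal_sup (J @` U delta)) - fine (J (Qd delta))) / Num.sqrt delta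
           @[delta --> 0^'+] --> 0) /\
        (forall b : 'cV[R]_d,
           (Num.sqrt delta)^-1 *:
             (Delta delta b - (Num.sqrt (delta / tau) / Hn) *: H b)
           @[delta --> 0^'+] --> (0 : 'cV[R]_d)))).
Proof.
move=> _ T0 _ _ alpha1 _ beta F2 htau g0 mom hm J H Hn U shift.
have a10 : 0 < 1 - alpha by rewrite subr_gt0.
have F20 : 0 <= F2 by exact: sqfrob_ge0.
have [tau1 _] : 4 * T * F2 < tau /\ True.
  by split => //; apply: le_lt_trans htau; rewrite le_max lexx.
have tau0 : 0 < tau.
  by apply: le_lt_trans tau1; rewrite !mulr_ge0 ?(ltW T0).
have beta1 : -1 < beta.
  rewrite -subr_gt0 opprK (_ : beta + 1 = (1 - alpha)^-1) ?invr_gt0//.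
  by rewrite /beta; field; rewrite gt_eqF.
(* Order 8 serves the squared increments of the likelihood, order 2 beta the power beta of its
   average. *)
pose t := Num.max 8 (2 * beta).
have t8 : 8 <= t by rewrite le_max lexx.
have bt : 2 * beta <= t by rewrite le_max lexx orbT.
have Tt : T * t < gamma0 ^+ 2 / F2.
  apply: le_lt_trans hm; rewrite ler_pM2l// ge_max; apply/andP; split.
    by rewrite !le_max lexx orbT.
  (* For beta > 4 the first entry of the maximum is used: (s + sqrt(s^2 + e)) / 2 >= s, and s >= 2
     beta because (beta - 1) (beta - 2) >= 0. *)
  have [b8|b8] := leP (2 * beta) 8; first by rewrite !le_max b8 orbT.
  rewrite le_max; apply/orP; left.
  set s := beta ^+ 2 - beta + 2; set e := 8 * (beta ^+ 2 + beta).
  have s0 : 0 <= s by rewrite /s; nra.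
  have e0 : 0 <= e by rewrite /e; nra.
  have : s <= Num.sqrt (s ^+ 2 + e).
    by rewrite -[leLHS](ger0_norm s0) -sqrtr_sqr ler_sqrt ?lerDl// addr_ge0 ?sqr_ge0.
  by rewrite /s; nra.
have [c c0 iex] := itg_ex_of_moments r T0 t8 g0 mom Tt.
have [gam [gam_ge0 gam_exp gam_bnd]] := @gauss_tuple R T d T0.
have gyk k : expy T k = (fun y : d.-tuple R => expR (k / T * sqnorm2 (vec y))).
  by apply/funext => y; rewrite expyE mulrAC mulrA.
have kT k : k < 2^-1 -> k / T < (2 * T)^-1.
  by move=> k2; rewrite invfM ltr_pM2r ?invr_gt0.
have gam_gy k : k < 2^-1 -> itg gam (expy T k).
  by move=> /kT; rewrite gyk; exact: gam_exp.
have gam_bnd' (g : d.-tuple R -> R) k C : k < 2^-1 -> measurable_fun setT g ->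
    (forall y, `|g y| <= C * expy T k y) ->
    lebint (fun y => (g y * phiT T y)%:E) = (\int[gam]_y (g y)%:E)%E.
  by move=> /kT k2 mg; rewrite gyk; exact: gam_bnd.
pose K := \int[P0]_x expm T r sigma (t * (1 + c)) x * expR (t * (1 + c^-1)).
have K0 : 0 <= K.
  rewrite mulr_ge0 ?expR_ge0//; apply: Rintegral_ge0 => x _; exact: expm_ge0.
have [C C0 HC] := @avg_bounds R d T r sigma T0 _ _ _ beta1 t8 bt K0.
split => [al0|al0].
- exact: (robust_inf T0 alpha1 tau0 (ltW tau1) gam_gy gam_ge0 gam_bnd' t8 c0 C0 iex HC al0).
- exact: (robust_sup T0 alpha1 tau0 (ltW tau1) gam_gy gam_ge0 gam_bnd' t8 c0 C0 iex HC al0).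
Qed.
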